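(* Let $K$ be a field, let $\lambda=(\lambda_1,\ldots,\lambda_m)$ be a partition of a positive integer $n$ with $m\ge 2$ and $\lambda_m>0$, and set $k=\min\{\lambda_{i-1}-\lambda_i\mid i=2,3,\ldots,m\}$. Then the generalized permutohedron $\Pi_{n,k}$ is a state polytope of the Specht ideal $I_\lambda\subset K[x_1,\ldots,x_n]$. In particular, the Gröbner fan $\mathrm{GF}(I_\lambda)$ is the normal fan of $\Pi_{n,k}$, and it is refined by the braid fan $\mathrm{Br}_n$.
   Context: A partition of $n$ is a non-increasing sequence of non-negative integers with sum $n$. A tableau of shape $\lambda$ is a bijective filling of the boxes of the Young diagram of $\lambda$ by $1,\ldots,n$; $\mathrm{Tab}(\lambda)$ is the set of these. The Specht polynomial $f_T\in S=K[x_1,\ldots,x_n]$ of $T\in\mathrm{Tab}(\lambda)$ is the product of all $x_i-x_j$ such that $i$ and $j$ are in the same column of $T$ and $j$ is in a lower position than $i$. The Specht ideal is $I_\lambda:=\langle f_T\mid T\in\mathrm{Tab}(\lambda)\rangle\subset S$ (a homogeneous ideal). For a nonzero homogeneous ideal $I\subset S$ and $\mathbf{w}\in\mathbb{R}^n$, $\operatorname{in}_{\mathbf{w}}(I)$ is the ideal generated by the initial forms $\operatorname{in}_{\mathbf{w}}(f)$, $f\in I$, where $\operatorname{in}_{\mathbf{w}}(f)$ is the sum of the terms $c\,x_1^{a_1}\cdots x_n^{a_n}$ of $f$ for which $(a_1,\ldots,a_n)\cdot\mathbf{w}$ is maximal. Put $C[\mathbf{w}]:=\{\mathbf{w}'\in\mathbb{R}^n\mid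 \operatorname{in}_{\mathbf{w}}(I)=\operatorname{in}_{\mathbf{w}'}(I)\}$. The Gröbner fan of $I$ is $\mathrm{GF}(I):=\{\overline{C[\mathbf{w}]}\mid \mathbf{w}\in\mathbb{R}^n\}$ (closures); it is a complete fan. A convex polytope $P\subset\mathbb{R}^n$ is a state polytope of $I$ if $\mathrm{GF}(I)$ is the normal fan of $P$, where the normal fan consists of the cones of all $\mathbf{w}$ that are maximized over $P$ on (at least) a given face. For $(u_1,\ldots,u_n)\in\mathbb{R}^n$, $P_n(u_1,\ldots,u_n)$ is the convex hull of $\{(u_{\sigma(1)},\ldots,u_{\sigma(n)})\mid\sigma\in\mathfrak{S}_n\}$, where $\mathfrak{S}_n$ is the $n$-th symmetric group. For $0\le k<n$, $\Pi_{n,k}:=P_n(1,2,\ldots,n-k-1,n-k,\ldots,n-k)$ (the value $n-k$ occurring $k+1$ times). The braid fan $\mathrm{Br}_n$ is the complete fan in $\mathbb{R}^n$ given by the hyperplanes $x_i-x_j=0$ for all $i\ne j$. A generalized permutohedron is a polytope obtained by moving the vertices of the permutohedron $P_n(1,2,\ldots,n)$ while keeping the same edge directions (equivalently, one whose normal fan is refined by $\mathrm{Br}_n$); each $\Pi_{n,k}$ is one. *)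

(* Defs.v *)
From HB Require Import structures.
From mathcomp Require Import all_boot all_order all_algebra all_fingroup.
From mathcomp Require Import all_classical all_reals all_analysis.
(* The notations of mpoly clash with those of mathcomp-analysis. *)
From mathcomp Require Import -(notations) mpoly.

Set Implicit Arguments.
Unset Strict Implicit.
Unset Printing Implicit Defensive.

Import Order.TTheory GRing.Theory Num.Theory.
Import numFieldNormedType.Exports.

Local Open Scope classical_set_scope.
Local Open Scope ring_scope.

Definition is_partition (n : nat) (la : seq nat) : bool :=
  sorted geq la && (sumn la == n).

(* The minimum over 1 <= i < size la of la_(i-1) - la_i (parts numbered from 0).
   The seed [head 0 la] is an upper bound of every difference, so it has no
   effect as soon as la has at least two parts. *)
Definition min_gap (la : seq nat) : nat :=
  \big[minn/head 0%N la]_(1 <= i < size la)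
    (nth 0%N la i.-1 - nth 0%N la i)%N.

(* English convention: [tag b] is the row of the box b, and [tagged b] its
   column, both counted from 0. *)
Definition box (la : seq nat) : finType :=
  {r : 'I_(size la) & 'I_(nth 0%N la r)}.

Definition box_row (la : seq nat) (b : box la) : nat := tag b.
Definition box_col (la : seq nat) (b : box la) : nat := tagged b.

(* The entries 1, ..., n are represented by the elements 0, ..., n - 1 of 'I_n;
   the entry i stands for the variable of index i. *)
Definition Tab (n : nat) (la : seq nat) : set {ffun box la -> 'I_n} :=
  [set T | bijective T].
Arguments Tab : clear implicits.

Definition specht_poly (K : fieldType) (n : nat) (la : seq nat)
    (T : {ffun box la -> 'I_n}) : mpoly n K :=
  \prod_(b : box la)
    \prod_(b' : box la | (box_col b == box_col b') && (box_row b < box_row b')%N)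
      (mpolyX K (mnm1 (T b)) - mpolyX K (mnm1 (T b'))).

Definition ideal_gen (A : comNzRingType) (G : set A) : set A :=
  [set p | exists (m : nat) (c g : 'I_m -> A),
             (forall i, G (g i)) /\ p = \sum_(i < m) c i * g i].

Definition specht_ideal (K : fieldType) (n : nat) (la : seq nat) :
    set (mpoly n K) :=
  ideal_gen [set specht_poly K T | T in Tab n la].
Arguments specht_ideal : clear implicits.

Section Fans.
Variables (R : realType) (n : nat).
Implicit Types (u v w x : 'rV[R]_n) (P F : set 'rV[R]_n).

Definition dotv u v : R := \sum_(i < n) u 0 i * v 0 i.

Definition weight w (a : multinom n) : R :=
  dotv (\row_(i < n) (a i)%:R) w.

Definition initial_form (K : fieldType) w (f : mpoly n K) :
    mpoly n K :=
  \sum_(a <- msupp f |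
        all (fun b => weight w b <= weight w a) (msupp f))
    mcoeff a f *: mpolyX K a.

Definition initial_ideal (K : fieldType) w (I : set (mpoly n K)) :
    set (mpoly n K) :=
  ideal_gen (initial_form w @` I).

Definition groebner_cell (K : fieldType) (I : set (mpoly n K)) w :
    set 'rV[R]_n :=
  [set w' | initial_ideal w I = initial_ideal w' I].

(* A fan is represented by the set of its cones. *)
Definition groebner_fan (K : fieldType) (I : set (mpoly n K)) :
    set (set 'rV[R]_n) :=
  [set closure (groebner_cell I w) | w in [set: 'rV[R]_n]].

Definition convex_hull P : set 'rV[R]_n :=
  smallest (@convex_set R 'rV[R]_n) P.

Definition convex_polytope P : Prop :=
  exists2 V : set 'rV[R]_n, finite_set V /\ V !=set0 & P = convex_hull V.

Definition max_face P w : set 'rV[R]_n :=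
  [set x | P x /\ forall y, P y -> dotv y w <= dotv x w].

Definition normal_cone P F : set 'rV[R]_n :=
  [set w | F `<=` max_face P w].

(* The (nonempty) faces of a polytope P are the sets [max_face P v]. *)
Definition normal_fan P : set (set 'rV[R]_n) :=
  [set normal_cone P (max_face P v) | v in [set: 'rV[R]_n]].

Definition state_polytope (K : fieldType) (I : set (mpoly n K)) P :
    Prop :=
  convex_polytope P /\ groebner_fan I = normal_fan P.

Definition perm_polytope u : set 'rV[R]_n :=
  convex_hull [set (\row_(i < n) u 0 (s i)) | s in [set: 'S_n]].

(* The relatively open cell containing v of the arrangement of the hyperplanes
   x_i = x_j; the cones of the fan are the closures of these cells. *)
Definition braid_cell v : set 'rV[R]_n :=
  [set w | forall i j, Num.sg (w 0 i - w 0 j) = Num.sg (v 0 i - v 0 j)].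

Definition braid_fan : set (set 'rV[R]_n) :=
  [set closure (braid_cell v) | v in [set: 'rV[R]_n]].

Definition fan_support (Phi : set (set 'rV[R]_n)) : set 'rV[R]_n :=
  \bigcup_(C in Phi) C.

Definition refines (Phi Psi : set (set 'rV[R]_n)) : Prop :=
  fan_support Phi = fan_support Psi /\
  forall C, Phi C -> exists2 D, Psi D & C `<=` D.

End Fans.

(* The coordinates 1, 2, ..., n-k-1, n-k, ..., n-k are the min(i+1, n-k) for
   0 <= i < n. *)
Definition Pi_polytope (R : realType) (n k : nat) : set 'rV[R]_n :=
  perm_polytope (\row_(i < n) (minn i.+1 (n - k))%:R).

Arguments groebner_fan R {n K} I.
Arguments braid_fan R n : clear implicits.
Arguments Pi_polytope R n k : clear implicits.

(* Main.v *)
Require Import Defs.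
From mathcomp Require Import all_boot all_order all_algebra.
From mathcomp Require Import all_classical all_reals all_analysis.
From mathcomp Require Import all_fingroup.
From mathcomp Require Import -(notations) mpoly.
From mathcomp Require Import zify lra.

Set Implicit Arguments.
Unset Strict Implicit.
Unset Printing Implicit Defensive.

Import Order.TTheory GRing.Theory Num.Theory.
Import numFieldNormedType.Exports.

(** The proof describes both fans by the same comparisons between the coordinates
    of a weight [w].  The comparison [w_i <= w_j] is called detected if [i <> j],
    if it holds, and if [x_i] is not among the [k + 1] heaviest variables, that
    is, if at least [k + 2] variables are at least as heavy as [x_i].

    For the polytope this is a rearrangement argument.  The vertices are indexed
    by the permutations [s], with coordinates [min (s_i + 1, n - k)], and a vertex
    maximizes [w] exactly if its coordinates are ordered like those of [w].  Some
    maximizing vertex has a smaller [i]-th than [j]-th coordinate exactly if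
    [w_i <= w_j] is detected ([detected_vertex]), so the face maximizing [w] is
    contained in the face maximizing [w'] exactly if the detected comparisons of
    [w] hold for [w'] ([detected_max_face]).

    For the ideal, the claim is that two weights have the same initial ideal
    exactly if they have the same detected comparisons ([initial_eqP]).

    In one direction, consider a colouring [c] of the variables, and the product
    [vand pos c] of the differences of variables of equal colours.  If the colour
    classes are the columns of a shape dominated by [la], the product is in the
    Specht ideal: this follows from Specht polynomials by a relation of Garnir
    type ([vand_mem]).  Conversely every nonzero element of the ideal has a
    monomial divisible by [x^rho] for a filling [rho] of rows which is dominated
    by [la] and which satisfies the lattice condition for the given order of the
    variables; this is seen by evaluating at points with few distinct coordinates,
    where Specht polynomials vanish unless the classes of equal coordinates are
    dominated by [la] ([ideal_support]).  Hence the products of differences form a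
    Groebner basis.  Since consecutive parts of [la] differ by at least [k], the
    filling [rho] can be chosen with the last [k + 1] variables in distinct
    columns ([horizontal_strip]).  Then the [k + 1] heaviest variables are never
    subtracted from each other, and the initial forms of these products, which
    generate the initial ideal, only depend on the detected comparisons
    ([detected_initial]).

    In the other direction, order the variables by [w] and by [w'], with the same
    rule for ties, and let [s] be the first position where the orders differ.  If
    [s + k + 2 <= n], there is a dominated lattice filling for the second order
    which is not above any dominated lattice filling for the first one
    ([separation]); here it is used that two consecutive parts differ by exactly
    [k].  The corresponding lead monomial distinguishes the initial ideals
    ([initial_eq_lattice]).  Therefore the orders agree in the first [n - k - 1]
    positions, which is what a detected comparison depends on.

    Finally, the closure of the cell of [w] in the Groebner fan consists of the
    [w'] for which the detected comparisons of [w] hold, because [w' + d w] is in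
    the cell for all [d > 0] ([closure_cell]); the same set is the normal cone of
    the face maximizing [w].  A cell of the braid arrangement fixes all
    comparisons, so it is contained in a cell of the Groebner fan. *)

(** * Row fillings of the variables *)

Section Fillings.
Variable n : nat.
Implicit Types (pos : 'S_n) (rho : 'I_n -> nat) (P : pred 'I_n).
Local Open Scope nat_scope.

(** Placing the entries one by one, in the order of [pos], each [l] in the row
    [rho l], the row lengths remain weakly decreasing: these are the lattice
    (Yamanouchi) words. *)
Definition lattice_upto pos rho t := forall x r, x <= t ->
  #|[pred l | (pos l < x) && (rho l == r.+1)]| <=
  #|[pred l | (pos l < x) && (rho l == r)]|.

Definition lattice pos rho := lattice_upto pos rho n.

Definition dominated (L : nat -> nat) rho :=
  forall t, #|[pred l | rho l < t]| <= L t.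

Definition rank pos (c : 'I_n -> 'I_n) l : nat :=
  #|[pred l' | (c l' == c l) && (pos l' < pos l)]|.

Lemma prefix_step pos P x z : pos z = x :> nat ->
  #|[pred l | (pos l < x.+1) && P l]| =
  #|[pred l | (pos l < x) && P l]| + P z.
Proof.
move=> pz; rewrite (cardD1 z) !inE pz ltnSn /= addnC; congr (_ + _).
apply: eq_card => l; rewrite !inE ltnS leq_eqVlt -pz andbA; congr (_ && _).
have [->|lz] := eqVneq l z; first by rewrite ltnn.
have -> : (pos l == pos z :> nat) = false.
  by apply/negbTE; apply: contra lz => /eqP/val_inj/perm_inj ->.
by [].
Qed.

Lemma at_pos pos x : x < n -> exists z, pos z = x :> nat.
Proof. by move=> xn; exists ((pos^-1)%g (Ordinal xn)); rewrite permKV. Qed.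

Lemma card_color (c : 'I_n -> 'I_n) P :
  #|[pred l | P l]| = \sum_j #|[pred l | (c l == j) && P l]|.
Proof.
rewrite -sum1_card (partition_big c predT) //=.
by apply: eq_bigr => j _; rewrite -sum1_card; apply: eq_bigl => l; rewrite !inE andbC.
Qed.

Lemma sub_card (P Q : pred 'I_n) : (forall l, P l -> Q l) ->
  #|[pred l | P l]| <= #|[pred l | Q l]|.
Proof. by move=> PQ; apply/subset_leq_card/fintype.subsetP => l; rewrite !inE; apply: PQ. Qed.

Section Index.
Variables (pos : 'S_n) (rho : 'I_n -> nat).
Hypothesis lat : lattice pos rho.

Let idx l : nat := #|[pred l' | (pos l' < pos l) && (rho l' == rho l)]|.

Let idx_lt l l' : rho l = rho l' -> pos l < pos l' -> idx l < idx l'.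
Proof.
move=> rll' pll'; rewrite /idx [X in _ < X](cardD1 l) !inE pll' rll' eqxx /= add1n ltnS.
apply: sub_card => l2 /=; rewrite !inE => /andP[p2 ->]; rewrite (ltn_trans p2 pll') /= andbT.
by apply: contraTN p2 => /eqP->; rewrite ltnn.
Qed.

Let idx_inj l l' : rho l = rho l' -> idx l = idx l' -> l = l'.
Proof.
move=> rll' ill'; case: (ltngtP (pos l) (pos l')) => [h|h|/val_inj/perm_inj //].
- by have := idx_lt rll' h; rewrite ill' ltnn.
- by have := idx_lt (esym rll') h; rewrite ill' ltnn.
Qed.

Let idx_ex x r c : x <= n -> c < #|[pred l | (pos l < x) && (rho l == r)]| ->
  exists l, [/\ pos l < x, rho l = r & idx l = c].
Proof.
elim: x => [|x IH] xn; first by rewrite eq_card0.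
have [z pz] := at_pos pos xn.
rewrite (prefix_step _ pz) => cx.
have [/IH[|l [h1 h2 h3]]|cx'] := ltnP c #|[pred l | (pos l < x) && (rho l == r)]|.
- exact: ltnW.
- by exists l; rewrite ltnW.
have rz : rho z = r.
  by move: cx; case: eqP => // _ /=; rewrite addn0 ltnNge cx'.
exists z; rewrite pz ltnS leqnn rz /idx pz rz; split=> //.
by apply/eqP; rewrite eqn_leq cx' /= -ltnS; move: cx; rewrite rz eqxx addn1.
Qed.

Let idx_below l r : r < rho l -> exists l', [/\ rho l' = r, idx l' = idx l & pos l' < pos l].
Proof.
move=> rl.
have le_count r' : r' <= rho l ->
    #|[pred l' | (pos l' < (pos l).+1) && (rho l' == rho l)]| <=
    #|[pred l' | (pos l' < (pos l).+1) && (rho l' == r')]|.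
  move=> h; rewrite -(subKn h); elim: (rho l - r') => [|d IHd]; first by rewrite subn0.
  have [dl|ld] := ltnP d (rho l).
    apply: leq_trans IHd _.
    by rewrite -[rho l - d]prednK ?subn_gt0 // -subnS lat // ltn_ord.
  apply: leq_trans IHd _; move: ld; rewrite -subn_eq0 => /eqP ld.
  by rewrite ld subnS ld.
have [|l' [h1 h2 h3]] := @idx_ex (pos l).+1 r (idx l) (ltn_ord _).
  apply: leq_trans (le_count r (ltnW rl)).
  by rewrite (@prefix_step _ _ (pos l) l) // eqxx addn1.
exists l'; split=> //; move: h1; rewrite ltnS leq_eqVlt => /orP[/eqP/val_inj/perm_inj ll'|//].
by move: rl; rewrite -h2 ll' ltnn.
Qed.

Let idx_pos l l' : idx l = idx l' -> rho l < rho l' -> pos l < pos l'.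
Proof.
move=> ill' /idx_below[l2 [r2 i2 p2]].
by rewrite (idx_inj (esym r2)) ?i2.
Qed.

Let idx_bound l : idx l < n.
Proof.
rewrite -[X in _ < X]card_ord -add1n -[X in X + _](card1 l) -cardUI.
rewrite [X in _ + X]eq_card0 ?addn0 ?max_card // => l'; rewrite !inE.
by case: eqP => // ->; rewrite ltnn.
Qed.

(** The colour of an entry is its index inside its row, so that the colours are
    the columns of the tableau obtained by pushing every row to the left; the
    lattice condition says exactly that the columns increase downwards. *)
Lemma lattice_columns : exists c : 'I_n -> 'I_n,
  [/\ forall l, rank pos c l = rho l,
      forall j t, minn #|[pred l | c l == j]| t <=
                  #|[pred l | (c l == j) && (rho l < t)]|,
      forall l l', c l = c l' -> rho l = rho l' -> l = l' &
      forall l, c l = #|[pred l' | (pos l' < pos l) && (rho l' == rho l)]| :> nat].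
Proof.
exists (fun l => Ordinal (idx_bound l)); split.
- move=> l; rewrite /rank cardE -(size_map rho).
  have /perm_size -> : perm_eq [seq rho l' | l' <- enum [pred l' |
       (Ordinal (idx_bound l') == Ordinal (idx_bound l)) && (pos l' < pos l)]]
       (iota 0 (rho l)).
    apply: uniq_perm; last 1 first.
    + move=> r; rewrite mem_iota /= add0n; apply/mapP/idP => [[l']|].
        rewrite mem_enum !inE -val_eqE /= => /andP[/eqP ill' pl'] ->.
        case: (ltngtP (rho l') (rho l)) => // h.
          by have := idx_pos (esym ill') h; rewrite ltnNge (ltnW pl').
        by move: pl'; rewrite (idx_inj h ill') ltnn.
      move=> /idx_below[l' [h1 h2 h3]]; exists l' => //.
      by rewrite mem_enum !inE -val_eqE /= h2 eqxx.
    + rewrite map_inj_in_uniq ?enum_uniq // => l1 l2.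
      rewrite !mem_enum !inE -!val_eqE /= => /andP[/eqP h1 _] /andP[/eqP h2 _] h.
      by apply: idx_inj; rewrite ?h1.
    + exact: iota_uniq.
  by rewrite size_iota.
- move=> j t; have [/existsP[l /andP[/eqP cl tl]]|] :=
    boolP [exists l, (Ordinal (idx_bound l) == j) && (t <= rho l)].
    apply: leq_trans (geq_minr _ _) _.
    rewrite cardE -(size_map rho) -(size_iota 0 t); apply: uniq_leq_size.
      exact: iota_uniq.
    move=> r; rewrite mem_iota /= add0n => rt; apply/mapP.
    have [l' [h1 h2 h3]] := idx_below (leq_trans rt tl).
    exists l'; last by rewrite h1.
    by rewrite mem_enum !inE -cl -val_eqE /= h2 eqxx h1 size_iota rt.
  rewrite negb_exists => /forallP h; apply: leq_trans (geq_minl _ _) _.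
  apply: sub_card => l /eqP lj; rewrite lj eqxx /= ltnNge.
  by have := h l; rewrite lj eqxx.
- by move=> l l' [] ill' rll'; apply: idx_inj.
- by [].
Qed.

End Index.

End Fillings.

Definition part_sum (la : seq nat) (t : nat) : nat :=
  (\sum_(r < t) nth 0 la r)%N.

Section Strip.
Variables (n k : nat) (la : seq nat) (pos : 'S_n).
Implicit Types (rho : 'I_n -> nat).
Local Open Scope nat_scope.

Hypothesis la_sum : forall t, size la <= t -> part_sum la t = n.
Hypothesis la_gap : forall t, 0 < t -> t < size la -> nth 0 la t + k <= nth 0 la t.-1.

Lemma part_sumS t : part_sum la t.+1 = part_sum la t + nth 0 la t.
Proof. by rewrite /part_sum big_ord_recr. Qed.

Lemma card_below rho t :
  #|[pred l | rho l < t.+1]| = #|[pred l | rho l < t]| + #|[pred l | rho l == t]|.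
Proof.
rewrite -cardUI [X in _ = _ + X]eq_card0 ?addn0.
  by apply: eq_card => l; rewrite !inE ltnS leq_eqVlt orbC.
by move=> l; rewrite !inE; case: ltngtP.
Qed.

Lemma card_pos_lt t : t <= n -> #|[pred l | pos l < t]| = t.
Proof.
elim: t => [|t IH] tn; first by rewrite eq_card0.
have [z pz] := at_pos pos tn.
have E y : #|[pred l | (pos l < y) && predT l]| = #|[pred l | pos l < y]|.
  by apply: eq_card => l; rewrite !inE andbT.
by rewrite -E (prefix_step _ pz) E IH ?addn1 // ltnW.
Qed.

Lemma card_update (T : Type) (rho : 'I_n -> T) u x (P : pred T) :
  #|[pred l | P (if l == u then x else rho l)]| + P (rho u) =
  #|[pred l | P (rho l)]| + P x.
Proof.
rewrite (cardD1 u) [in RHS](cardD1 u) !inE eqxx.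
have -> : #|[predD1 [pred l | P (if l == u then x else rho l)] & u]| =
          #|[predD1 [pred l | P (rho l)] & u]|.
  by apply: eq_card => l; rewrite !inE; have [->|] := eqVneq l u.
by rewrite addnAC [in RHS]addnC addnA [P x + _]addnC.
Qed.

(** Let [x0] be such that the entries from position [x0] on are at most [k + 1]
    in number.  If two of them lie in the same column, then some row [q + 1]
    sticks out below the part of row [q] filled before [x0], and one of its boxes
    can be moved up to the first row as long as row [q].  Dominance could only be
    lost where it is an equality, say between rows [t - 1] and [t]; there the
    rows differ by at least the gap [k], and for lack of late entries this is
    impossible. *)
Lemma horizontal_strip rho x0 :
  lattice pos rho -> dominated (part_sum la) rho -> x0 <= n -> n <= x0 + k.+1 ->
  exists rho', [/\ lattice pos rho', dominated (part_sum la) rho',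
    forall l, rho' l <= rho l &
    forall r, #|[pred l | rho' l == r.+1]| <=
              #|[pred l | (pos l < x0) && (rho' l == r)]| ].
Proof.
move=> lat dom x0n nx0.
pose good rho' := [/\ dominated (part_sum la) rho', forall l, rho' l <= rho l,
  forall l, pos l < x0 -> rho' l = rho l &
  forall r, #|[pred l | rho' l == r.+1]| <= #|[pred l | rho' l == r]|].
have : good rho.
  have E r : #|[pred l | (pos l < n) && (rho l == r)]| = #|[pred l | rho l == r]|.
    by apply: eq_card => l; rewrite !inE ltn_ord.
  by split=> // r; have := lat n r (leqnn n); rewrite !E.
suff main N rho' : \sum_l rho' l < N -> good rho' -> exists rho', [/\ lattice pos rho',
    dominated (part_sum la) rho', forall l, rho' l <= rho l &
    forall r, #|[pred l | rho' l == r.+1]| <=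
              #|[pred l | (pos l < x0) && (rho' l == r)]| ].
  by apply: main; apply: leqnn.
elim: N rho' => [//|N IH] rho' leN [dom' le' eq' dec'].
pose nu r := #|[pred l | (pos l < x0) && (rho' l == r)]|.
have [strip|nstrip] := pselect (forall r, #|[pred l | rho' l == r.+1]| <= nu r).
  exists rho'; split=> // x r xn.
  have [xx0|x0x] := leqP x x0.
    have E r' : #|[pred l | (pos l < x) && (rho' l == r')]| =
                #|[pred l | (pos l < x) && (rho l == r')]|.
      apply: eq_card => l; rewrite !inE; case: ltnP => //= px.
      by rewrite eq' // (leq_trans px).
    by rewrite !E lat.
  apply: leq_trans (leq_trans (strip r) _); apply: sub_card => l.
    by case/andP.
  by case/andP=> /leq_trans -> //=; rewrite ltnW.
pose mu r := #|[pred l | rho' l == r]|.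
have mu_noninc i j : i <= j -> mu j <= mu i.
  move=> ij; rewrite -(subnK ij); elim: (j - i) => [//|d IHd].
  by rewrite addSn (leq_trans (dec' _)).
have nu_noninc r : nu r.+1 <= nu r.
  have E r' : nu r' = #|[pred l | (pos l < x0) && (rho l == r')]|.
    by apply: eq_card => l; rewrite !inE; case: ltnP => //= px; rewrite eq'.
  by rewrite !E lat.
have late r : mu r = nu r + #|[pred l | (x0 <= pos l) && (rho' l == r)]|.
  rewrite /mu -(cardID [pred l | pos l < x0]); congr (_ + _); apply: eq_card => l.
    by rewrite !inE andbC.
  by rewrite !inE -leqNgt.
have [q0 viol0] : exists q, nu q < mu q.+1.
  by case/existsNP: nstrip => q /negP; rewrite -ltnNge; exists q.
have viol_bound q : nu q < mu q.+1 -> q <= \sum_l rho' l.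
  move=> /(leq_ltn_trans (leq0n _)) /card_gt0P[l]; rewrite inE => /eqP E.
  by rewrite (bigD1 l) //= E (leq_trans _ (leq_addr _ _)).
have exq : exists q, nu q < mu q.+1 by exists q0.
(* The last violation [q]: row [q + 2] is shorter than row [q + 1], which can
   therefore give a box to the first row [x] as long as row [q]. *)
case: (ex_maxnP exq viol_bound) => q viol qmax {exq q0 viol0 viol_bound nstrip}.
have exx : exists x, mu x == mu q by exists q.
case: (ex_minnP exx) => x /eqP mux xmin {exx}.
have xq : x <= q by apply: xmin.
have mu_q2 : mu q.+2 < mu q.+1.
  rewrite ltnNge; apply/negP => h.
  have := qmax q.+1; rewrite ltnn => H.
  by apply/negP: (H (leq_trans (leq_ltn_trans (nu_noninc q) viol) h)).
have u_late : 0 < #|[pred l | (x0 <= pos l) && (rho' l == q.+1)]|.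
  by move: viol; rewrite late; have := nu_noninc q; lia.
have /card_gt0P[u] := u_late; rewrite inE => /andP[ux0 /eqP ru].
pose rho2 l := if l == u then x else rho' l.
have cnt2 (P : pred nat) :
    #|[pred l | P (rho2 l)]| + P q.+1 = #|[pred l | P (rho' l)]| + P x.
  by rewrite -ru; apply: card_update.
have mu2 r : #|[pred l | rho2 l == r]| + (q.+1 == r) = mu r + (x == r).
  exact: (cnt2 (fun y => y == r)).
apply: (IH rho2).
  rewrite -ltnS (leq_trans _ leN) // ltnS (bigD1 u) //= [X in _ < X](bigD1 u) //= /rho2 eqxx ru.
  have -> : \sum_(i | i != u) (if i == u then x else rho' i) = \sum_(i | i != u) rho' i.
    by apply: eq_bigr => i /negbTE ->.
  by rewrite ltn_add2r ltnS.
split.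
- move=> t; have := cnt2 (fun y => y < t).
  have := dom' t; have [xt|tx] := ltnP x t; last first.
    by rewrite [q.+1 < t]ltnNge (leq_trans tx) ?(leq_trans xq) // !addn0 => + ->.
  have [qt|tq] := ltnP q.+1 t; first by move=> + /addIn ->.
  rewrite /= addn0 addn1 => + ->; rewrite leq_eqVlt => /orP[/eqP tight|//].
  (* Dominance is tight at [t], so that row [t] is shorter than row [t - 1] by at
     least [k]: more boxes than there are entries after [x0] would be needed to
     make row [q + 1] longer than the early part of row [q]. *)
  exfalso.
  have [lat_|tla] := leqP (size la) t.
    move: tight; rewrite la_sum // => full.
    have : #|[pred l | rho' l < t]| + #|[pred l | t <= rho' l]| = n.
      rewrite -[RHS](card_ord n) -(cardC [pred l | rho' l < t]); congr (_ + _).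
      by apply: eq_card => l; rewrite !inE -leqNgt.
    rewrite full -[RHS]addn0 => /addnI /(@card0_eq _ _) /(_ u).
    by rewrite !inE ru tq.
  case: t xt tq tight tla => // t xt tq tight tla.
  have gap_t : mu t.+1 + k <= mu t.
    have := la_gap (ltn0Sn t) tla; rewrite /=.
    have := dom' t; have := dom' t.+2; move: tight.
    rewrite !card_below !part_sumS -/(mu t) -/(mu t.+1).
    move: (#|_|) (mu t) (mu t.+1) (part_sum la t) => a b c d.
    by lia.
  have late2 : #|[pred l | (x0 <= pos l) && (rho' l == q)]| +
      #|[pred l | (x0 <= pos l) && (rho' l == q.+1)]| <= k.+1.
    rewrite -cardUI [X in _ + X <= _]eq_card0 ?addn0; last first.
      by move=> l; rewrite !inE; case: eqP => [->|]; rewrite ?andbF // ltn_eqF ?andbF.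
    have : #|[pred l | pos l < x0]| + #|[predC [pred l | pos l < x0]]| = n.
      by rewrite cardC card_ord.
    rewrite card_pos_lt // => E; rewrite -(leq_add2l x0); apply: leq_trans nx0.
    rewrite -[X in _ <= X]E leq_add2l; apply: subset_leq_card.
    by apply/fintype.subsetP => l; rewrite !inE -leqNgt; case: (x0 <= pos l).
  have lq := late q; have dq := mu_noninc q q.+1 (leqnSn q).
  move: tq; rewrite ltnS leq_eqVlt => /orP[/eqP tq|tq].
    by move: gap_t late2 u_late lq viol; rewrite tq; lia.
  have E1 := mu_noninc _ _ tq; have E2 := mu_noninc x t xt.
  by move: mux gap_t late2 u_late lq viol; lia.
- by move=> l; rewrite /rho2; case: eqP => // ->; apply: leq_trans (le' u); rewrite ru leqW.
- move=> l pl; rewrite /rho2; case: eqP => [lu|_]; last exact: eq'.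
  by move: pl; rewrite lu ltnNge ux0.
- move=> r; have := mu2 r; have := mu2 r.+1; have dr := mu_noninc r r.+1 (leqnSn r).
  rewrite eqSS.
  have xr : x = r.+1 -> mu r.+1 < mu r.
    move=> xr; rewrite ltn_neqAle dr andbT -xr mux eq_sym; apply/negP => /xmin.
    by rewrite xr ltnn.
  have qr : q.+1 = r -> mu r.+1 < mu r by move=> <-.
  move: (#|_|) (#|_|) (mu r.+1) (mu r) dr xr qr => a b c d.
  by case: (x =P r.+1); case: (x =P r); case: (q =P r); case: (q.+1 =P r); move=> /= *; lia.
Qed.

End Strip.

Section StripColumns.
Variables (n : nat) (pos : 'S_n) (rho : 'I_n -> nat).
Local Open Scope nat_scope.

Lemma columns_dominated (c : 'I_n -> 'I_n) L : dominated L rho ->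
  (forall j t, minn #|[pred l | c l == j]| t <=
               #|[pred l | (c l == j) && (rho l < t)]|) ->
  forall t, \sum_j minn #|[pred l | c l == j]| t <= L t.
Proof.
move=> dom minc t; apply: leq_trans (dom t).
by rewrite (card_color c (fun l => rho l < t)) leq_sum.
Qed.

(** If two late entries [l] and [l'] shared a column, [l'] below [l], then the
    index of [l'] in its row would be less than the length of this row, hence
    less than the number of early entries in the row of [l], all of which come
    before [l]; but the indices of [l] and [l'] are equal. *)
Lemma strip_columns x0 : lattice pos rho ->
  (forall r, #|[pred l | rho l == r.+1]| <=
             #|[pred l | (pos l < x0) && (rho l == r)]|) ->
  exists c : 'I_n -> 'I_n,
  [/\ forall l, rank pos c l = rho l,
      forall j t, minn #|[pred l | c l == j]| t <=
                  #|[pred l | (c l == j) && (rho l < t)]| &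
      forall l l', x0 <= pos l -> x0 <= pos l' -> c l = c l' -> l = l' ].
Proof.
move=> lat strip; have [c [c1 c2 c4 c5]] := lattice_columns lat.
exists c; split=> // l l' xl xl' cll'.
wlog rll' : l l' xl xl' cll' / rho l < rho l'.
  case: (ltngtP (rho l) (rho l')) => [h H|h H|h _].
  - exact: H.
  - by apply/esym/H.
  - exact: c4.
exfalso; have noninc i j : i <= j ->
    #|[pred l | rho l == j]| <= #|[pred l | rho l == i]|.
  move=> ij; rewrite -(subnK ij); elim: (j - i) => [//|d IHd].
  rewrite addSn (leq_trans _ IHd) // (leq_trans (strip _)) //.
  by apply: sub_card => l2 /andP[].
have : c l' < #|[pred l2 | rho l2 == rho l']|.
  rewrite c5 [X in _ < X](cardD1 l') inE eqxx add1n ltnS.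
  apply: sub_card => l2 /andP[p2]; rewrite inE => ->; rewrite andbT.
  by apply: contraTN p2 => /eqP->; rewrite ltnn.
rewrite ltnNge -cll' c5 => /negP; apply.
apply: leq_trans (noninc _ _ rll') _; apply: leq_trans (strip _) _.
by apply: sub_card => l2 /andP[p2 ->]; rewrite (leq_trans p2).
Qed.

End StripColumns.

(** * Products of differences and the Specht ideal *)

Section IdealGen.
Variables (A : comNzRingType) (G : set A).
Local Open Scope ring_scope.

Lemma ideal_gen0 : ideal_gen G 0.
Proof. by exists 0%N, (fun=> 0), (fun=> 0); split=> [[]//|]; rewrite big_ord0. Qed.

Lemma ideal_genD p q : ideal_gen G p -> ideal_gen G q -> ideal_gen G (p + q).
Proof.
move=> [m [c [g [hg ->]]]] [m' [c' [g' [hg' ->]]]].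
exists (m + m')%N.
exists (fun i => match fintype.split i with inl j => c j | inr j => c' j end).
exists (fun i => match fintype.split i with inl j => g j | inr j => g' j end).
split; first by move=> i; case: fintype.splitP.
rewrite big_split_ord /=; congr (_ + _); apply: eq_bigr => i _.
  by rewrite (unsplitK (inl i)).
by rewrite (unsplitK (inr i)).
Qed.

Lemma ideal_genM a p : ideal_gen G p -> ideal_gen G (a * p).
Proof.
move=> [m [c [g [hg ->]]]]; exists m, (fun i => a * c i), g; split=> //.
by rewrite mulr_sumr; apply: eq_bigr => i _; rewrite mulrA.
Qed.

Lemma ideal_gen_mem p : G p -> ideal_gen G p.
Proof.
by exists 1%N, (fun=> 1), (fun=> p); split=> //; rewrite big_ord1 mul1r.
Qed.

Lemma ideal_genN p : ideal_gen G p -> ideal_gen G (- p).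
Proof. by rewrite -mulN1r; apply: ideal_genM. Qed.

Lemma ideal_gen_le (J : set A) : (forall p, G p -> J p) -> J 0 ->
  (forall p q, J p -> J q -> J (p + q)) -> (forall a p, J p -> J (a * p)) ->
  forall p, ideal_gen G p -> J p.
Proof.
move=> GJ J0 JD JM p [m [c [g [hg ->]]]].
by elim/big_ind: _ => // i _; apply/JM/GJ.
Qed.

End IdealGen.

Section Interpolation.
Variables (R : idomainType) (I : finType) (x : I -> R).
Hypothesis x_inj : injective x.
Local Open Scope ring_scope.

(** Top coefficient of the Lagrange interpolation of [v X^e prod_(b in B)
    (X - x_b)] at the points of [A]: a polynomial of degree less than [#|A|]
    vanishing at [#|A|] points is zero. *)
Lemma interpolation_top (A B : pred I) e (co : I -> R) (v : R) :
  #|A| = (e + #|B|).+1 ->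
  (forall a, A a -> co a * \prod_(l | (l != a) && A l) (x a - x l) =
                    v * (x a ^+ e * \prod_(l | B l) (x a - x l))) ->
  v = \sum_(a | A a) co a.
Proof.
move=> szA Eco.
pose F a : {poly R} := \prod_(l | (l != a) && A l) ('X - (x l)%:P).
pose G : {poly R} := 'X^e * \prod_(l | B l) ('X - (x l)%:P).
pose Q := \sum_(a | A a) (co a)%:P * F a - v%:P * G.
have monF a : F a \is monic by apply: monic_prod => *; apply: monicXsubC.
have monG : G \is monic.
  by rewrite monicMr ?monicXn //; apply: monic_prod => *; apply: monicXsubC.
have sz_prod (P : pred I) : size (\prod_(l | P l) ('X - (x l)%:P)) = #|P|.+1.
  have <- : \prod_(l <- enum P) ('X - (x l)%:P) =
            \prod_(l | P l) ('X - (x l)%:P) by rewrite big_enum.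
  by rewrite size_prod_XsubC -cardE.
have szF a : A a -> size (F a) = #|A|.
  move=> Aa; rewrite sz_prod [in RHS](cardD1 a) [a \in _]Aa add1n.
  by congr _.+1; apply: eq_card.
have szG : size G = #|A|.
  rewrite size_monicM ?monicXn ?monic_neq0 //; last first.
    by apply: monic_prod => *; apply: monicXsubC.
  by rewrite size_polyXn sz_prod addnS szA.
have Q0 : Q = 0.
  apply: (@roots_geq_poly_eq0 _ _ [seq x a | a <- enum A]).
  - apply/allP => y /mapP[a]; rewrite mem_enum => Aa ->; apply/rootP.
    rewrite /Q hornerD hornerN horner_sum (bigD1 a) //= big1 ?addr0; last first.
      move=> a' /andP[Aa' a'a]; rewrite hornerM /F horner_prod (bigD1 a) /=; last first.
        by rewrite eq_sym a'a.
      by rewrite hornerXsubC subrr mul0r mulr0.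
    rewrite !hornerM !hornerC hornerXn !horner_prod.
    under eq_bigr do rewrite hornerXsubC.
    under [X in _ - _ * (_ * X)]eq_bigr do rewrite hornerXsubC.
    by rewrite Eco ?subrr.
  - by rewrite map_inj_uniq ?enum_uniq.
  - rewrite size_map -cardE (leq_trans (size_polyD _ _)) // geq_max size_polyN.
    rewrite !mul_polyC (leq_trans (size_scale_leq _ _)) ?szG // andbT.
    apply: leq_trans (size_sum _ _ _) _; apply/bigmax_leqP => a Aa.
    by rewrite mul_polyC (leq_trans (size_scale_leq _ _)) ?szF.
have lead1 (p : {poly R}) : p \is monic -> size p = #|A| -> p`_#|A|.-1 = 1.
  by move=> /monicP <- <-.
have := congr1 (fun p : {poly R} => p`_#|A|.-1) Q0.
rewrite coef0 coefB coef_sum mul_polyC coefZ lead1 // mulr1 => /subr0_eq <-.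
by apply: eq_bigr => a Aa; rewrite mul_polyC coefZ lead1 ?szF ?mulr1.
Qed.

End Interpolation.

Section Vandermonde.
Variables (K : fieldType) (n : nat).
Implicit Types (pos : 'S_n) (c : 'I_n -> 'I_n).
Local Open Scope ring_scope.
Local Notation var i := (mpolyX K (mnm1 i)).

(** The Specht polynomial of the tableau whose columns are the colour classes,
    sorted by position; the lengths of these columns are arbitrary here. *)
Definition vand pos c : mpoly n K :=
  \prod_l \prod_(l' | (c l' == c l) && (pos l' < pos l)%N) (var l - var l').

Let vand_off pos c a : mpoly n K :=
  \prod_(l | l != a)
    \prod_(l' | (l' != a) && ((c l' == c l) && (pos l' < pos l)%N)) (var l - var l').

Let vand_split pos c a : exists b : bool, vand pos c =
  (-1) ^+ b * vand_off pos c a * \prod_(l | (l != a) && (c l == c a)) (var a - var l).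
Proof.
pose s l : bool := (pos a < pos l)%N.
exists (odd (\sum_(l | (l != a) && (c l == c a)) s l)).
rewrite signr_odd expr_sum -mulrA [X in _ * X]mulrC mulrA -big_split /=.
rewrite /vand (bigD1 a) //= /vand_off.
rewrite [X in _ * X](_ : _ = (\prod_(l | l != a) (if (c l == c a) && (pos a < pos l)%N
     then var l - var a else 1)) * vand_off pos c a); last first.
  rewrite -big_split /=; apply: eq_bigr => l la.
  case: ifP => [/andP[cl pl]|h].
    by rewrite (bigD1 a) ?cl ?pl 1?eq_sym ?cl //=; congr (_ * _); apply: eq_bigl => l'; rewrite andbC.
  rewrite mul1r; apply: eq_bigl => l'; have [->|//] := eqVneq l' a.
  by rewrite eq_sym h.
rewrite mulrA; congr (_ * _).
rewrite -big_mkcondr /= [X in X * _]big_mkcond [X in _ * X]big_mkcond -big_split /=.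
rewrite [RHS]big_mkcond; apply: eq_bigr => l _; rewrite /s.
have [->|la] := eqVneq l a; first by rewrite ltnn andbF mulr1.
have /= := ltngtP (pos l) (pos a); case: (c l == c a) => /=; case=> //; rewrite ?mulr1 ?mul1r //.
- by move=> _; rewrite expr1 mulN1r opprB.
- by move=> /val_inj/perm_inj E; rewrite E eqxx in la.
Qed.

Lemma mpolyX_neq (i j : 'I_n) : i != j -> var i != var j :> mpoly n K.
Proof.
move=> ij; apply/eqP => /(congr1 (mcoeff (mnm1 i))).
by rewrite !mcoeffX eqxx eq_mnm1 eq_sym (negbTE ij) => /eqP; rewrite oner_eq0.
Qed.

Definition recolor c a B l : 'I_n := if l == a then B else c l.

(** A relation of Garnir type: interpolating at the entries of the larger class
    [A] expresses a product of differences through those in which one entry of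
    [A] has been moved to the smaller class [B]. *)
Lemma garnir pos c A B (J : set (mpoly n K)) : A != B ->
  (#|[pred l | c l == B]| < #|[pred l | c l == A]|)%N ->
  J 0 -> (forall p q, J p -> J q -> J (p + q)) -> (forall p q, J q -> J (p * q)) ->
  (forall a, c a = A -> J (vand pos (recolor c a B))) -> J (vand pos c).
Proof.
move=> AB szAB J0 JD JM Jrec.
have [b hb] : exists b : 'I_n -> bool, forall a, c a = A ->
    vand pos c * \prod_(l | c l == B) (var a - var l) =
    (-1) ^+ b a * vand pos (recolor c a B) * \prod_(l | (l != a) && (c l == A)) (var a - var l).
  suff : forall a, exists b : bool, c a = A ->
    vand pos c * \prod_(l | c l == B) (var a - var l) =
    (-1) ^+ b * vand pos (recolor c a B) * \prod_(l | (l != a) && (c l == A)) (var a - var l).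
    by move=> /fin_all_exists.
  move=> a; have [b1 E1] := vand_split pos c a.
  have [b2 E2] := vand_split pos (recolor c a B) a.
  exists (b1 (+) b2) => caA; rewrite E1 E2 signr_addb.
  have -> : vand_off pos (recolor c a B) a = vand_off pos c a.
    apply: eq_bigr => l la; apply: eq_bigl => l'.
    by rewrite /recolor (negbTE la); case: (l' =P a).
  have -> : \prod_(l | (l != a) && (recolor c a B l == recolor c a B a)) (var a - var l) =
            \prod_(l | c l == B) (var a - var l).
    apply: eq_bigl => l; rewrite /recolor eqxx; have [->|//] := eqVneq l a.
    by rewrite caA (negbTE AB).
  by rewrite caA [RHS](AC (2*3*1) ((2*3)*(1*4*6*5))) /= -expr2 sqrr_sign mul1r.
pose D := #|[pred l | c l == A]|.
pose e := (D.-1 - #|[pred l | c l == B]|)%N.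
pose co a : mpoly n K := (-1) ^+ b a * var a ^+ e * vand pos (recolor c a B).
rewrite (@interpolation_top _ _ (fun l => var l) _ [pred l | c l == A] [pred l | c l == B] e co (vand pos c)).
- elim/big_ind: _ => // a /eqP ca.
  by rewrite /co -mulrA; apply/JM/JM/Jrec.
- by move=> l l' E; apply/eqP; apply: contraTT isT => /mpolyX_neq; rewrite E eqxx.
- rewrite -/D /e subnK; first by rewrite prednK //; apply: leq_ltn_trans szAB.
  by rewrite -ltnS prednK //; apply: leq_ltn_trans szAB.
- move=> a /eqP ca; rewrite /= [RHS]mulrCA hb // /co.
  by rewrite [RHS]mulrA; congr (_ * _); rewrite mulrA [(-1) ^+ _ * _]mulrC.
Qed.

Local Notation csize c j := #|[pred l | c l == j]|.

Section InSpecht.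
Variable la : seq nat.
Hypothesis la_part : is_partition n la.
Local Open Scope nat_scope.

Lemma part_sum_full t : size la <= t -> part_sum la t = n.
Proof.
case/andP: la_part => _ /eqP <- lat; rewrite /part_sum sumnE (big_nth 0) big_mkord.
rewrite (big_ord_widen _ (fun i => nth 0 la i) lat) [RHS]big_mkcond; apply: eq_bigr => i _.
by case: ltnP => // h; rewrite nth_default.
Qed.

Lemma part_noninc i j : i <= j -> nth 0 la j <= nth 0 la i.
Proof.
case/andP: la_part => so _ ij.
have [jla|laj] := ltnP j (size la); last by rewrite nth_default.
have := @sorted_leq_nth _ geq (fun a1 a2 a3 h1 h2 => leq_trans h2 h1) leqnn 0 la so i j.
by rewrite !inE jla (leq_ltn_trans ij jla) => h; apply: h.
Qed.

Lemma part_sum_le t : part_sum la t <= n.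
Proof.
have [h|h] := leqP (size la) t; first by rewrite part_sum_full.
rewrite -(part_sum_full (leqnn (size la))) -(subnKC (ltnW h)) /part_sum.
by rewrite big_split_ord leq_addr.
Qed.

Lemma card_box : #|box la| = n.
Proof.
rewrite card_tagged sumnE big_map big_enum /= -[RHS](part_sum_full (leqnn _)).
by apply: eq_bigr => i _; rewrite card_ord.
Qed.

Lemma box_ex r j : j < nth 0 la r ->
  exists b : box la, box_row b = r /\ box_col b = j.
Proof.
move=> jr; have rla : r < size la.
  by rewrite ltnNge; apply/negP => h; rewrite nth_default in jr.
by exists (existT (fun r : 'I_(size la) => 'I_(nth 0 la r)) (Ordinal rla) (Ordinal jr)).
Qed.

(** When the column sizes are those of [la], the product of differences is a
    Specht polynomial: the column of an entry is the rank of its colour for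
    decreasing sizes, its row the number of larger entries of its colour. *)
Let vand_specht pos c :
  (forall t, \sum_j minn (csize c j) t = part_sum la t) ->
  specht_ideal K n la (vand pos c).
Proof.
move=> Esum.
have gt_card r : #|[pred j | r < csize c j]| = nth 0 la r.
  apply/eqP; rewrite -(eqn_add2l (part_sum la r)) -part_sumS -!Esum -sum1_card.
  rewrite [X in _ + X]big_mkcond -big_split /=; apply/eqP/eq_bigr => j _.
  by rewrite inE; case: ltnP; lia.
pose before j j' := (csize c j < csize c j') || ((csize c j == csize c j') && (j' < j)).
pose ka j := #|[pred j' | before j j']|.
pose row l := #|[pred l' | (c l' == c l) && (pos l < pos l')]|.
have row_lt l l' : c l = c l' -> pos l < pos l' -> row l' < row l.
  move=> cll' pll'; rewrite /row [X in _ < X](cardD1 l') !inE cll' eqxx pll' add1n ltnS.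
  apply: sub_card => l2; rewrite !inE => /andP[-> h]; rewrite (ltn_trans pll' h) andbT /=.
  by rewrite ?andbT; apply: contraTN h => /eqP->; rewrite ltnn.
have row_size l : row l < csize c (c l).
  rewrite /row [X in _ < X](cardD1 l) inE eqxx add1n ltnS.
  apply: sub_card => l2; rewrite !inE => /andP[-> h]; rewrite andbT.
  by rewrite ?andbT; apply: contraTN h => /eqP->; rewrite ltnn.
have ka_lt j j' : before j j' -> ka j' < ka j.
  move=> h; rewrite /ka [X in _ < X](cardD1 j') !inE h add1n ltnS.
  apply: sub_card => j2; rewrite !inE => h2; apply/andP; split.
    by apply: contraTN h2 => /eqP->; rewrite /before !ltnn andbF.
  by move: h h2; rewrite /before; lia.
have ka_inj j j' : ka j = ka j' -> j = j'.
  move=> E; apply/eqP; apply: contraT => jj'.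
  have : before j j' || before j' j.
    rewrite /before; case: (ltngtP (csize c j) (csize c j')) => //= _.
    by case: (ltngtP j j') => //= /val_inj E'; rewrite E' eqxx in jj'.
  by case/orP=> /ka_lt; rewrite E ltnn.
have in_box l : ka (c l) < nth 0 la (row l).
  rewrite -gt_card (cardD1 (c l)) inE row_size add1n ltnS.
  apply: sub_card => j; rewrite !inE => h; apply/andP; split.
    by apply: contraTN h => /eqP->; rewrite /before !ltnn andbF.
  by move: h (row_size l); rewrite /before; lia.
have [Phi hPhi] : exists Phi : 'I_n -> box la, forall l,
    box_row (Phi l) = row l /\ box_col (Phi l) = ka (c l).
  apply: (@fin_all_exists _ (fun=> box la)
    (fun l b => box_row b = row l /\ box_col b = ka (c l))) => l.
  exact: box_ex.
have Phi_inj : injective Phi.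
  move=> l l' E; have [r1 k1] := hPhi l; have [r2 k2] := hPhi l'.
  have cll' : c l = c l' by apply: ka_inj; rewrite -k1 -k2 E.
  have rll' : row l = row l' by rewrite -r1 -r2 E.
  case: (ltngtP (pos l) (pos l')) => [h|h|/val_inj/perm_inj //].
    by have := row_lt _ _ cll' h; rewrite rll' ltnn.
  by have := row_lt _ _ (esym cll') h; rewrite rll' ltnn.
have [Psi PhiK PsiK] : bijective Phi.
  by apply: inj_card_bij => //; rewrite card_box card_ord.
apply: ideal_gen_mem; exists [ffun b => Psi b].
  by exists Phi => x; rewrite ffunE.
rewrite /specht_poly /vand (reindex Phi) /=; last by apply: onW_bij; exists Psi.
apply: eq_bigr => l _; rewrite (reindex Phi) /=; last by apply: onW_bij; exists Psi.
have [r1 k1] := hPhi l.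
apply: eq_big => [l'|l' _]; last by rewrite !ffunE !PhiK.
have [r2 k2] := hPhi l'; rewrite r1 r2 k1 k2 (inj_eq ka_inj) eq_sym.
have [E|//] := eqVneq (c l') (c l) => /=.
case: (ltngtP (pos l') (pos l)) => [h|h|/val_inj/perm_inj ->].
- exact: row_lt.
- by apply/negbTE; rewrite -leqNgt ltnW // row_lt.
- by rewrite ltnn.
Qed.

(** As long as the colouring does not have the shape [la], an entry can be moved
    from a column of length [q] to one of length [p < q - 1] with dominance
    preserved, where [p] and [q] bound an interval in which the dominance is
    strict. *)
Lemma vand_mem pos c : (forall t, \sum_j minn (csize c j) t <= part_sum la t) ->
  specht_ideal K n la (vand pos c).
Proof.
pose M c t := \sum_j minn (csize c j) t.
pose N := n + size la.
have sum_csize c' : \sum_j csize c' j = n.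
  have := card_color c' predT; rewrite [X in X = _ -> _](_ : _ = n); last first.
    by rewrite -[RHS]card_ord; apply: eq_card => l; rewrite !inE.
  move=> E; rewrite [RHS]E; apply: eq_bigr => j _; apply: eq_card => l.
  by rewrite !inE andbT.
have M_full c' t : n <= t -> M c' t = n.
  move=> nt; rewrite -[RHS](sum_csize c'); apply: eq_bigr => j _; apply/minn_idPl.
  by apply: leq_trans nt; rewrite -[X in _ <= X]card_ord max_card.
move: {2}(\sum_(t < N.+1) (part_sum la t - M c t)).+1 (ltnSn (\sum_(t < N.+1) (part_sum la t - M c t))) => m.
elim: m c => // m IH c lem dom; have {}dom t : M c t <= part_sum la t := dom t.
have [/forallP eqM|] := boolP [forall t : 'I_N.+1, M c t == part_sum la t].
  apply: vand_specht => t; have [tN|Nt] := ltnP t N.+1.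
    exact: eqP (eqM (Ordinal tN)).
  rewrite -/(M c t) M_full ?part_sum_full //.
    by apply: leq_trans (ltnW Nt); apply: leq_addl.
  by apply: leq_trans (ltnW Nt); apply: leq_addr.
rewrite negb_forall => /existsP[t0 ne0].
have lt0 : M c t0 < part_sum la t0 by rewrite ltn_neqAle ne0 dom.
have exp : exists p, (p <= t0) && (M c p == part_sum la p).
  exists 0; rewrite /part_sum big_ord0 /M big1 // => j _; exact: minn0.
have pb p : (p <= t0) && (M c p == part_sum la p) -> p <= t0 by case/andP.
case: (ex_maxnP exp pb) => p /andP[pt0 /eqP Mp] pmax {exp pb}.
have exq : exists q, (t0 <= q) && (M c q == part_sum la q).
  by exists N; rewrite -ltnS ltn_ord /= M_full ?leq_addr // part_sum_full ?leq_addl.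
case: (ex_minnP exq) => q /andP[qt0 /eqP Mq] qmin {exq}.
have strict t : p < t -> t < q -> M c t < part_sum la t.
  move=> pt tq; rewrite ltn_neqAle dom andbT; apply/negP => /eqP E.
  case: (leqP t t0) => tt0.
    by have := pmax t; rewrite tt0 E eqxx leqNgt pt => /(_ isT).
  by have := qmin t; rewrite (ltnW tt0) E eqxx leqNgt tq => /(_ isT).
have pt : p < t0.
  by rewrite ltn_neqAle pt0 andbT; apply/eqP => E; move: lt0; rewrite -E Mp ltnn.
have tq : t0 < q.
  by rewrite ltn_neqAle qt0 andbT; apply/eqP => E; move: lt0; rewrite E Mq ltnn.
have concave t : 0 < t -> part_sum la t.-1 + part_sum la t.+1 <= part_sum la t + part_sum la t.
  by case: t => // t _; rewrite /= !part_sumS; have := part_noninc (leqnSn t); lia.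
have kink t : 0 < t -> (forall j, csize c j != t) -> M c t.-1 + M c t.+1 = M c t + M c t.
  move=> t_gt0 h; rewrite /M -!big_split /=; apply: eq_bigr => j _.
  by have := h j; lia.
(* Dominance becomes tight again at [q], which is only possible if [M c] bends
   there, that is, if some column has length [q]; similarly for [p]. *)
have [A szA] : exists A, csize c A = q.
  case: (boolP [exists A, csize c A == q]) => [/existsP[A /eqP]|]; first by exists A.
  rewrite negb_exists => /forallP h; exfalso.
  have q0 : 0 < q by apply: leq_ltn_trans tq.
  have := kink q q0 h; have := concave q q0; have := dom q.+1; rewrite Mq.
  have := strict q.-1; lia.
have [B szB] : exists B, csize c B = p.
  case: (boolP [exists B, csize c B == p]) => [/existsP[B /eqP]|]; first by exists B.
  rewrite negb_exists => /forallP h; exfalso.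
  have [p0|p0] := posnP p; last first.
    have := kink p p0 h; have := concave p p0; have := dom p.-1; rewrite Mp.
    have := strict p.+1; lia.
  have := sum_csize c; rewrite (bigD1 A) //= szA.
  have : \sum_(j | j != A) 1 <= \sum_(j | j != A) csize c j.
    by apply: leq_sum => j _; rewrite lt0n -p0 h.
  by rewrite sum1_card cardC1 card_ord -(leq_add2l q) => + E; rewrite E; have := ltn_ord A; lia.
have AB : A != B.
  apply/eqP => E; move: szA; rewrite E szB; lia.
apply: (@garnir pos c A B _ AB).
- by rewrite szA szB; lia.
- exact: ideal_gen0.
- exact: ideal_genD.
- by move=> x y; apply: ideal_genM.
move=> a ca; pose c' := recolor c a B.
have csz j : csize c' j + (A == j) = csize c j + (B == j).
  by rewrite -ca; apply: (card_update c a B (fun x => x == j)).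
have M' t : M c' t + minn q t + minn p t = M c t + minn q.-1 t + minn p.+1 t.
  rewrite /M (bigD1 A) //= (bigD1 B) 1?eq_sym //= [in RHS](bigD1 A) //= [in RHS](bigD1 B) 1?eq_sym //=.
  have -> : \sum_(i | (i != A) && (i != B)) minn (csize c' i) t =
            \sum_(i | (i != A) && (i != B)) minn (csize c i) t.
    apply: eq_bigr => j /andP[jA jB]; have := csz j.
    by rewrite eq_sym (negbTE jA) eq_sym (negbTE jB) !addn0 => ->.
  have := csz A; have := csz B; rewrite !eqxx [B == A]eq_sym (negbTE AB) szA szB.
  move: (\sum_(_ | _) _) (csize c' A) (csize c' B) => x y z; lia.
have M'1 t : p < t < q -> M c' t = (M c t).+1 by have := M' t; lia.
have M'2 t : ~~ (p < t < q) -> M c' t = M c t by have := M' t; lia.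
apply: IH.
  rewrite -ltnS (leq_trans _ lem) // ltnS (bigD1 t0) //= [X in _ < X](bigD1 t0) //=.
  rewrite -addSn leq_add //.
    by rewrite M'1 ?pt //; lia.
  apply: leq_sum => t _; rewrite leq_sub2l // -/c'.
  by case: (boolP (p < t < q)) => h; rewrite ?(M'1 _ h) ?(M'2 _ h).
move=> t; rewrite -/(M c' t); case: (boolP (p < t < q)) => h.
  by rewrite M'1 //; case/andP: h => *; apply: strict.
by rewrite M'2.
Qed.

End InSpecht.
End Vandermonde.

(** * Evaluations with coinciding variables *)

Section Evaluation.
Variables (K : fieldType) (n : nat) (la : seq nat).
Hypothesis la_part : is_partition n la.
Variables (A : idomainType) (f : {rmorphism K -> A}) (y : nat -> A).
Hypothesis y_inj : injective y.
Implicit Types (pos : 'S_n) (pi rho : 'I_n -> nat) (tau : nat -> nat).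

Let ev pi : mpoly n K -> A := mmap f (fun l => y (pi l)).

(** A Specht polynomial survives the identification of the variables of each
    class of [pi] only if no column meets a class twice; counting column by
    column, [t] classes then have at most as many elements as the first [t] rows
    of [la]. *)
Lemma specht_ev_dominated pi (T : {ffun box la -> 'I_n}) tau t :
  Tab n la T -> ev pi (specht_poly K T) != 0%R ->
  (#|[pred l | [exists r : 'I_t, pi l == tau r]]| <= part_sum la t)%N.
Proof.
move=> [T' TK T'K] ne0.
have distinct b b' : box_col b = box_col b' -> (box_row b < box_row b')%N ->
    pi (T b) != pi (T b').
  move=> cb rb; move: ne0; rewrite /ev /specht_poly rmorph_prod => /prodf_neq0 /(_ b isT).
  rewrite rmorph_prod => /prodf_neq0 /(_ b'); rewrite cb eqxx rb => /(_ isT).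
  by rewrite rmorphB /= !mmapX !mmap1U; apply: contraNN => /eqP->; rewrite subrr.
pose C l := [exists r : 'I_t, pi l == tau r].
pose N := (\max_b (@box_col la b)).+1.
have bN b : (@box_col la b < N)%N by rewrite ltnS; apply: leq_bigmax.
pose col b : 'I_N := Ordinal (bN b).
have -> : #|[pred l | C l]| = #|[pred b | C (T b)]|.
  rewrite -!sum1_card (reindex T) //=.
  by apply: onW_bij; exists T'.
have card_col (P : pred (box la)) :
    #|[pred b | P b]| = (\sum_j #|[pred b | (col b == j) && P b]|)%N.
  rewrite -sum1_card (partition_big col predT) //=.
  by apply: eq_bigr => j _; rewrite -sum1_card; apply: eq_bigl => b; rewrite !inE andbC.
apply: (@leq_trans #|[pred b : box la | (box_row b < t)%N]|); last first.
  have -> : #|[pred b : box la | (box_row b < t)%N]| =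
      (\sum_(r < size la | (r < t)%N) nth 0 la r)%N.
    rewrite -sum1_card [RHS](_ : _ = \sum_(r < size la | (r < t)%N) \sum_(j < nth 0 la r) 1)%N.
      rewrite sig_big_dep /=; apply: eq_bigl => b; by rewrite inE andbT.
    by apply: eq_bigr => r _; rewrite sum1_card card_ord.
  have [lat|tla] := leqP (size la) t.
    rewrite (part_sum_full la_part lat) -(part_sum_full la_part (leqnn _)) /part_sum.
    by rewrite big_mkcond leq_sum // => i _; case: ifP.
  rewrite /part_sum.
  by rewrite (big_ord_widen (size la) (fun i => nth 0 la i) (ltnW tla)).
rewrite (card_col (fun b => C (T b))) (card_col (fun b => box_row b < t)%N).
apply: leq_sum => j _.
have [/existsP[b0 /andP[/eqP cb0 tb0]]|] :=
    boolP [exists b, (col b == j) && (t <= box_row b)%N]; last first.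
  rewrite negb_exists => /forallP h; apply: subset_leq_card.
  apply/fintype.subsetP => b; rewrite !inE => /andP[cb _]; rewrite cb /= ltnNge.
  by have := h b; rewrite cb.
apply: (@leq_trans t).
  rewrite cardE -(size_map (fun b => pi (T b))) -[X in (_ <= X)%N](size_iota 0 t) -[X in (_ <= X)%N](size_map tau).
  apply: uniq_leq_size.
    rewrite map_inj_in_uniq ?enum_uniq // => b b'; rewrite !mem_enum !inE.
    move=> /andP[/eqP cb _] /andP[/eqP cb' _] E.
    have Ec : box_col b = box_col b' by have := congr1 val cb; rewrite -cb' => - /= ->.
    case: (ltngtP (box_row b) (box_row b')) => h.
    - by have := distinct _ _ Ec h; rewrite E eqxx.
    - by have := distinct _ _ (esym Ec) h; rewrite E eqxx.
    - case: b b' {E cb cb'} Ec h => [r j1] [r' j1'] /= Ec /val_inj h.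
      rewrite /box_row /= in h; case: _ / h j1' Ec => j1' Ec.
      by congr existT; apply: val_inj.
  move=> v /mapP[b]; rewrite mem_enum inE => /andP[_ /existsP[r /eqP ->]] ->.
  by apply/mapP; exists (val r) => //; rewrite mem_iota /= add0n ltn_ord.
rewrite cardE -(size_map (fun b => box_row b)) -[X in (X <= _)%N](size_iota 0 t); apply: uniq_leq_size.
  exact: iota_uniq.
move=> r; rewrite mem_iota /= add0n => rt; apply/mapP.
have [|b [rb cb]] := @box_ex la r (box_col b0).
  apply: leq_trans (part_noninc la_part (leq_trans (ltnW rt) tb0)).
  exact: ltn_ord.
exists b => //; rewrite mem_enum inE -cb0 -val_eqE /= cb eqxx.
by rewrite rb.
Qed.

(** The induction behind the Groebner basis property.  Among the monomials of
    [S], which agree from position [t] on, restrict to those of highest degree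
    [d] in the last active variable [z].  By induction some evaluation of their
    part below [z] is nonzero, so the whole sum is a nonzero polynomial of degree
    [d] in [z], and one of the [d + 1] values given to the rows [0, ..., d] is
    not a root: [z] joins that class [c].  In terms of sizes this adds a box to
    the first row [c' <= c <= d] as long as row [c]. *)
Lemma lattice_support pos (k : multinom n -> K) t (S : seq (multinom n)) :
  (t <= n)%N -> S != [::] -> {in S, forall a, k a != 0%R} -> uniq S ->
  {in S &, forall a b : multinom n, forall l, (t <= pos l)%N -> a l = b l} ->
  exists (a : multinom n) rho tau pi,
  [/\ a \in S, lattice_upto pos rho t & forall l, (pos l < t)%N -> (rho l <= a l)%N] /\
  [/\ injective tau,
     forall r, #|[pred l | (pos l < t)%N && (pi l == tau r)]| =
               #|[pred l | (pos l < t)%N && (rho l == r)]| &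
     (\sum_(b <- S) f (k b) * \prod_(l | (pos l < t)%N) y (pi l) ^+ b l != 0)%R].
Proof.
elim: t S => [|t IH] S tn S0 kS uS agree.
  case: S S0 kS uS agree => // a S _ kS uS agree.
  exists a, (fun=> 0%N), id, (fun=> 0%N); split; split.
  - exact: mem_head.
  - by move=> x r; rewrite leqn0 => /eqP->; rewrite !eq_card0.
  - by [].
  - by [].
  - by move=> r; rewrite !eq_card0.
  have -> : S = [::].
    case: S kS uS agree => // b S _ /=; rewrite inE negb_or => /andP[/andP[/eqP ab _] _] agree.
    by case: ab; apply/mnmP => l; apply: agree; rewrite ?inE ?eqxx ?orbT.
  by rewrite big_seq1 big_pred0 // mulr1 fmorph_eq0 kS ?mem_head.
have [z pz] := at_pos pos tn.
pose d := (\max_(a <- S) (a : multinom n) z)%N.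
pose S' := [seq a : multinom n <- S | a z == d].
have dS (a : multinom n) : a \in S -> (a z <= d)%N by move=> aS; apply: leq_bigmax_seq.
have S'0 : S' != [::].
  have [a aS az] : exists2 a : multinom n, a \in S & a z = d.
    rewrite /d; case: (S) S0 => // a0 S1 _; elim: S1 a0 => [|b S1 IHS] a0.
      by exists a0; rewrite ?big_seq1 ?mem_head.
    rewrite big_cons; have [a aS <-] := IHS b.
    case: (leqP (a0 z) (a z)) => h.
      by exists a; rewrite // inE aS orbT.
    by exists a0; rewrite // mem_head.
  by rewrite -has_filter; apply/hasP; exists a; rewrite // az.
have sub : {subset S' <= S} by move=> a; rewrite mem_filter => /andP[].
have z_at l : pos l = t :> nat -> l = z.
  by move=> pl; apply: (@perm_inj _ pos); apply: val_inj; rewrite /= pl -pz.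
have [|||||a [rho [tau [pi [[aS' lat le] [tinj sizes ne]]]]]] := IH S' => //.
- exact: ltnW.
- by move=> b bS; apply: kS; apply: sub.
- exact: filter_uniq.
- move=> b b' bS bS' l; rewrite leq_eqVlt => /orP[/eqP/esym/z_at->|h].
    by move: bS bS'; rewrite !mem_filter => /andP[/eqP-> _] /andP[/eqP-> _].
  by apply: agree => //; apply: sub.
have := aS'; rewrite mem_filter => /andP[/eqP az aS].
pose co (b : multinom n) := (f (k b) * \prod_(l | (pos l < t)%N) y (pi l) ^+ b l)%R.
pose F : {poly A} := (\sum_(b <- S) (co b)%:P * 'X^(b z))%R.
have Fd : (F`_d = \sum_(b <- S') co b)%R.
  rewrite coef_sum big_filter [RHS]big_mkcond; apply: eq_bigr => b _.
  rewrite mul_polyC coefZ coefXn eq_sym.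
  by case: eqP; rewrite ?mulr1 ?mulr0.
have szF : (size F <= d.+1)%N.
  rewrite /F big_seq; apply: (leq_trans (size_sum _ _ _)); apply/bigmax_leqP_seq => b _ bS.
  rewrite mul_polyC (leq_trans (size_scale_leq _ _)) // size_polyXn ltnS.
  exact: dS.
have [c cd Fc] : exists2 c, (c <= d)%N & (F.[y (tau c)] != 0)%R.
  have [/hasP[c]|] := boolP (has (fun c => F.[y (tau c)] != 0)%R (iota 0 d.+1)).
    by rewrite mem_iota /= add0n ltnS; exists c.
  rewrite -all_predC => /allP h; have := @max_poly_roots A F [seq y (tau c) | c <- iota 0 d.+1].
  rewrite size_map size_iota => H; suff : (d.+1 < size F)%N by rewrite ltnNge szF.
  apply: H => //.
  - by apply: contraNneq ne => F0; rewrite -[X in X == _]Fd F0 coef0.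
  - by apply/allP => v /mapP[c /h /=]; rewrite negbK => Fc ->.
  - by rewrite map_inj_uniq ?iota_uniq // => c c' /y_inj/tinj.
pose mu r := #|[pred l | (pos l < t)%N && (rho l == r)]|.
have exc : exists r, mu r == mu c by exists c.
case: (ex_minnP exc) => c' /eqP muc' cmin {exc}.
have c'c : (c' <= c)%N by apply: cmin.
pose rho2 l := if l == z then c' else rho l.
pose pi2 l := if l == z then tau c else pi l.
pose sw r := if r == c' then c else if r == c then c' else r.
have not_z l : (pos l < t)%N -> (l == z) = false.
  by move=> h; apply/eqP => E; move: h; rewrite E pz ltnn.
have mu2 r : #|[pred l | (pos l < t)%N && (rho2 l == r)]| = mu r.
  by apply: eq_card => l; rewrite !inE /rho2; case: ltnP => //= h; rewrite not_z.
have sw_inj : injective sw.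
  move=> r r'; rewrite /sw; do ![case: eqP => //]; congruence.
exists a, rho2, (tau \o sw), pi2; split; split => //.
- move=> x r; rewrite leq_eqVlt => /orP[/eqP->|xt].
    rewrite !(prefix_step _ pz) !mu2 /rho2 eqxx.
    have dec : (mu r.+1 <= mu r)%N by apply: lat.
    have : c' = r.+1 -> (mu r.+1 < mu r)%N.
      move=> E; rewrite ltn_neqAle dec andbT -E muc' eq_sym; apply/negP => /cmin.
      by rewrite E ltnn.
    move: dec; move: (mu r.+1) (mu r) => u v; case: eqP => [E _ /(_ E) h|_ h _].
      by rewrite addn1 (leq_trans h) ?leq_addr.
    by rewrite addn0 (leq_trans h) ?leq_addr.
  have E r' : #|[pred l | (pos l < x)%N && (rho2 l == r')]| =
              #|[pred l | (pos l < x)%N && (rho l == r')]|.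
    apply: eq_card => l; rewrite !inE /rho2; case: ltnP => //= h.
    by rewrite not_z // (leq_trans h).
  by rewrite !E; apply: lat.
- move=> l; rewrite ltnS leq_eqVlt => /orP[/eqP/z_at->|h].
    by rewrite /rho2 eqxx az (leq_trans c'c).
  by rewrite /rho2 not_z // le.
- exact: inj_comp.
- move=> r; rewrite !(prefix_step _ pz) mu2 /pi2 /rho2 eqxx /=.
  have -> : #|[pred l | (pos l < t)%N && ((if l == z then tau c else pi l) == tau (sw r))]| =
            mu (sw r).
    by rewrite /mu -sizes; apply: eq_card => l; rewrite !inE; case: ltnP => //= h; rewrite not_z.
  rewrite (inj_eq tinj); congr (_ + nat_of_bool _)%N.
    rewrite /sw; case: eqP => [->//|_]; by case: eqP => [->|].
  rewrite /sw [c' == r]eq_sym; case: (r =P c') => [_|rc']; first by rewrite eqxx.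
  by apply/negbTE/eqP; case: (r =P c) => [rc|rc] E; [apply: rc'; rewrite rc|apply: rc].
have <- : (F.[y (tau c)] =
    \sum_(b <- S) f (k b) * \prod_(l | (pos l < t.+1)%N) y (pi2 l) ^+ b l)%R; last exact: Fc.
rewrite horner_sum; apply: eq_bigr => b _.
rewrite hornerM hornerC hornerXn /co -mulrA; congr (_ * _)%R.
rewrite [RHS](bigD1 z) ?pz //= mulrC /pi2 eqxx; congr (_ * _)%R.
apply: eq_big => [l|l h].
  rewrite [in RHS]ltnS [in RHS]leq_eqVlt; case: (l =P z) => [->|lz]; first by rewrite pz ltnn andbF.
  by rewrite andbT; case: eqP => //= /z_at.
by rewrite not_z.
Qed.

(** An evaluation at which [g] does not vanish is one at which some generator
    does not vanish, and such an evaluation has classes dominated by [la]. *)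
Lemma ideal_support pos (g : mpoly n K) : specht_ideal K n la g -> g != 0%R ->
  exists2 a, a \in msupp g & exists rho,
    [/\ lattice pos rho, dominated (part_sum la) rho & forall l, (rho l <= a l)%N].
Proof.
move=> gI g0.
have [||||a [rho [tau [pi [[aS lat le] [tinj sizes ne]]]]]] :=
    @lattice_support pos (fun a => mcoeff a g) n (msupp g) (leqnn n).
- by rewrite msupp_eq0.
- by move=> a; rewrite mcoeff_msupp.
- exact: msupp_uniq.
- by move=> a b _ _ l; rewrite leqNgt ltn_ord.
exists a => //; exists rho; split=> // [t|l]; last exact: le.
have evg : ev pi g != 0%R.
  suff -> : (ev pi g = \sum_(b <- msupp g) f (mcoeff b g) *
      \prod_(l | (pos l < n)%N) y (pi l) ^+ b l)%R by [].
  by apply: eq_bigr => b _; congr (_ * _)%R; apply: eq_bigl => l; rewrite ltn_ord.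
have [T TT evT] : exists2 T, Tab n la T & ev pi (specht_poly K T) != 0%R.
  case: gI evg => m [c [h [hG ->]]]; rewrite /ev rmorph_sum /= => ne1.
  have [/existsP[i]|] := boolP [exists i, mmap f (fun l => y (pi l)) (h i) != 0%R].
    by have [T TT <-] := hG i; exists T.
  rewrite negb_exists => /forallP h0; case/eqP: ne1; apply: big1 => i _.
  by rewrite rmorphM /=; move: (h0 i); rewrite negbK => /eqP->; rewrite mulr0.
have := specht_ev_dominated tau t TT evT; apply: leq_trans; apply: eq_leq.
have sum_rows (p : nat -> nat) (q : 'I_n -> nat) : injective p ->
    #|[pred l | [exists r : 'I_t, q l == p r]]| = (\sum_(r < t) #|[pred l | q l == p r]|)%N.
  move=> pinj; elim: t {evT} => [|t IHt].
    by rewrite big_ord0 eq_card0 // => l; rewrite !inE; apply/existsP => -[[]].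
  rewrite big_ord_recr /= -IHt -cardUI [X in _ = (_ + X)%N]eq_card0 ?addn0.
    apply: eq_card => l; rewrite !inE; apply/existsP/orP => [[r /eqP E]|].
      have [rt|] := ltnP r t; first by left; apply/existsP; exists (Ordinal rt); rewrite E.
      move=> tr; right; rewrite E; apply/eqP; congr p; apply/eqP.
      by rewrite eqn_leq tr -ltnS ltn_ord.
    case=> [/existsP[r E]|E]; last by exists ord_max.
    by exists (widen_ord (leqnSn t) r).
  move=> l; rewrite !inE; apply/negbTE/negP => /andP[/existsP[r /eqP->] /eqP/pinj E].
  by have := ltn_ord r; rewrite E ltnn.
have -> : #|[pred l | (rho l < t)%N]| = #|[pred l | [exists r : 'I_t, rho l == id (r : nat)]]|.
  apply: eq_card => l; rewrite !inE; apply/idP/existsP => [h|[r /eqP->]]; last exact: ltn_ord.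
  by exists (Ordinal h).
rewrite (sum_rows id rho (@inj_id nat)) (sum_rows tau pi tinj); apply: eq_bigr => r _.
have := sizes r; rewrite (eq_card (B := [pred l | pi l == tau r])); last first.
  by move=> l; rewrite !inE ltn_ord.
by move=> ->; apply: eq_card => l; rewrite !inE ltn_ord.
Qed.

End Evaluation.

(** * Reduction modulo the products of differences *)

Section Lead.
Variables (K : fieldType) (n : nat) (pos : 'S_n).
Variable lt : multinom n -> multinom n -> Prop.
Local Notation "a +m b" := (mnm_add a b) (at level 50, left associativity).
Hypothesis lt_trans : forall a b c, lt a b -> lt b c -> lt a c.
Hypothesis lt_add : forall a b c, lt a b -> lt (a +m c) (b +m c).
Hypothesis lt_swap : forall l l', (pos l' < pos l)%N -> lt (mnm1 l') (mnm1 l).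
Local Open Scope ring_scope.

Definition monic_lead (p : mpoly n K) m :=
  exists2 p', p = mpolyX K m + p' & {in msupp p', forall b, lt b m}.

Lemma monic_lead1 : monic_lead 1 (@mnm0 n).
Proof. by exists 0; rewrite ?mpolyX0 ?addr0 // => b; rewrite msupp0. Qed.

Lemma monic_leadM p q m m' : monic_lead p m -> monic_lead q m' -> monic_lead (p * q) (m +m m').
Proof.
move=> [p' -> hp] [q' -> hq].
exists (mpolyX K m * q' + (p' * mpolyX K m' + p' * q')).
  by rewrite mulrDl !mulrDr mpolyXD -!addrA.
move=> b /msuppD_le; rewrite mem_cat => /orP[|/msuppD_le].
  move=> /msuppM_le /allpairsP[[b1 b2]] /= []; rewrite msuppX inE => /eqP -> /hq h ->.
  by rewrite ![m +m _]addmC; apply: lt_add.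
rewrite mem_cat => /orP[] /msuppM_le /allpairsP[[b1 b2]] /= [/hp h].
  by rewrite msuppX inE => /eqP -> ->; apply: lt_add.
move=> /hq h' ->; apply: lt_trans (lt_add _ h) _.
by rewrite ![m +m _]addmC; apply: lt_add.
Qed.

Lemma monic_lead_prod (I : Type) (r : seq I) (P : pred I) (F : I -> mpoly n K) m :
  (forall i, P i -> monic_lead (F i) (m i)) ->
  monic_lead (\prod_(i <- r | P i) F i) (\big[@mnm_add n/@mnm0 n]_(i <- r | P i) m i).
Proof.
move=> h; elim/big_rec2: _ => [|i q m' Pi]; first exact: monic_lead1.
exact/monic_leadM/h.
Qed.

(** The lead monomial of [vand K pos c]. *)
Definition rank_mnm c : multinom n := Multinom [tuple rank pos c i | i < n].

Lemma rank_mnmE c l : rank_mnm c l = rank pos c l.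
Proof. exact: mnmE. Qed.

Lemma rank_mnm_sum c : rank_mnm c = \big[@mnm_add n/@mnm0 n]_l
  \big[@mnm_add n/@mnm0 n]_(l' | (c l' == c l) && (pos l' < pos l)%N) mnm1 l.
Proof.
apply/mnmP => j; rewrite rank_mnmE mnm_sumE (bigD1 j) //= [X in (_ + X)%N]big1 ?addn0.
  rewrite mnm_sumE /rank -sum1_card; apply: eq_big => l; first by rewrite !inE.
  by rewrite mnm1E eqxx.
move=> l lj; rewrite mnm_sumE big1 // => l' _.
by rewrite mnm1E (negbTE lj).
Qed.

Lemma vand_lead c : monic_lead (vand K pos c) (rank_mnm c).
Proof.
rewrite rank_mnm_sum; apply: monic_lead_prod => l _; apply: monic_lead_prod => l' /andP[_ pl'].
exists (- mpolyX K (mnm1 l')) => // b.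
rewrite (perm_mem (msuppN _)) msuppX inE => /eqP ->.
exact: lt_swap.
Qed.

End Lead.

Section Reduction.
Variables (K : fieldType) (n k : nat) (la : seq nat).
Hypothesis la_part : is_partition n la.
Hypothesis la_gap : forall t, (0 < t)%N -> (t < size la)%N -> (nth 0 la t + k <= nth 0 la t.-1)%N.
Variables (pos : 'S_n) (x0 : nat).
Hypotheses (x0_le : (x0 <= n)%N) (x0_late : (n <= x0 + k.+1)%N).
Local Notation "a +m b" := (mnm_add a b) (at level 50, left associativity).
Local Notation vand := (vand K pos).
Local Open Scope ring_scope.

(** Colourings whose products of differences lie in the ideal and do not compare
    any two of the variables from position [x0] on. *)
Record good_columns (c : 'I_n -> 'I_n) : Prop := GoodColumns {
  good_lattice : lattice pos (rank pos c);
  good_dominated : dominated (part_sum la) (rank pos c);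
  good_ideal : specht_ideal K n la (vand c);
  good_strip : forall l l', (x0 <= pos l)%N -> (x0 <= pos l')%N -> c l = c l' -> l = l'
}.

Definition standard (b : multinom n) :=
  ~ exists2 c, good_columns c & forall l, (rank pos c l <= b l)%N.

(** The good products of differences form a Groebner basis: lead exponents can
    be lowered until the late variables lie in distinct columns. *)
Lemma good_support g : specht_ideal K n la g -> g != 0 ->
  exists2 a, a \in msupp g & ~ standard a.
Proof.
move=> gI g0; have inj : injective (fun i : nat => 'X^i : {poly K}).
  by move=> i j /(congr1 (fun p : {poly K} => size p)); rewrite !size_polyXn => -[].
have [a ag [rho [lat dom le]]] := @ideal_support K n la la_part {poly K} (@polyC K) _ inj pos g gI g0.
exists a => //; apply; have la_sum := part_sum_full la_part.
have [rho' [lat' dom' le' strip]] := horizontal_strip la_sum la_gap lat dom x0_le x0_late.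
have [c [c1 c2 c3]] := strip_columns lat' strip.
have E : rank pos c = rho' by apply/funext => l; rewrite c1.
exists c; last by move=> l; rewrite c1 (leq_trans (le' l)).
split; rewrite ?E //.
by apply: (vand_mem K la_part pos); apply: columns_dominated dom' c2.
Qed.

(** Combinations of multiples of good products of differences with all lead
    monomials in [P]: with [P] an initial segment of a monomial order, these are
    the standard representations with respect to a Groebner basis. *)
Inductive span (P : multinom n -> Prop) : mpoly n K -> Prop :=
| Span0 : span P 0
| SpanD e m c h : good_columns c -> P (m +m rank_mnm pos c) -> span P h ->
    span P (e *: (mpolyX K m * vand c) + h).

Lemma span_add P p q : span P p -> span P q -> span P (p + q).
Proof.
move=> hp hq; elim: hp => [|e m c h gc Pm _ IH]; first by rewrite add0r.
by rewrite -addrA; apply: SpanD.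
Qed.

Lemma span_scale P e p : span P p -> span P (e *: p).
Proof.
elim=> [|e' m c h gc Pm _ IH]; first by rewrite scaler0; apply: Span0.
by rewrite scalerDr scalerA; apply: SpanD.
Qed.

Lemma span_ideal P p : span P p -> specht_ideal K n la p.
Proof.
elim=> [|e m c h gc _ _ IH]; first exact: ideal_gen0.
apply: ideal_genD IH; rewrite -mul_mpolyC mulrA; apply: ideal_genM.
exact: good_ideal.
Qed.

Definition reduces (P : multinom n -> Prop) (p : mpoly n K) :=
  exists h r, [/\ p = h + r, span P h & {in msupp r, forall b, standard b /\ P b}].

Lemma reduces0 P : reduces P 0.
Proof.
exists 0, 0; split; rewrite ?addr0 //; first exact: Span0.
by move=> b; rewrite msupp0.
Qed.

Lemma reducesD P p q : reduces P p -> reduces P q -> reduces P (p + q).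
Proof.
move=> [h [r [-> hh hr]]] [h' [r' [-> hh' hr']]].
exists (h + h'), (r + r'); split; first by rewrite addrACA.
  exact: span_add.
by move=> b /msuppD_le; rewrite mem_cat => /orP[/hr|/hr'].
Qed.

Lemma reducesZ P e p : reduces P p -> reduces P (e *: p).
Proof.
move=> [h [r [-> hh hr]]]; exists (e *: h), (e *: r); split.
- by rewrite scalerDr.
- exact: span_scale.
- by move=> b /msuppZ_le /hr.
Qed.

Lemma reduces_sum P (s : seq (multinom n)) (F : multinom n -> K) (G : multinom n -> multinom n) :
  {in s, forall b, reduces P (mpolyX K (G b))} ->
  reduces P (\sum_(b <- s) F b *: mpolyX K (G b)).
Proof.
move=> h; rewrite big_seq; elim/big_ind: _ => [|p q|b bs].
- exact: reduces0.
- exact: reducesD.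
- by apply/reducesZ/h.
Qed.

Section Order.
Variable le : multinom n -> multinom n -> Prop.
Hypothesis le_trans : forall a b c, le a b -> le b c -> le a c.
Hypothesis le_add : forall a b c, le a b -> le (a +m c) (b +m c).
Hypothesis le_swap : forall l l', (pos l' < pos l)%N -> le (mnm1 l') (mnm1 l).

(** Replacing the lead monomial of a good product of differences by its other
    terms only moves exponents to lower variables, so the process terminates and
    stays below the initial monomial for every order compatible with the
    positions. *)
Lemma reduces_monomial (P : multinom n -> Prop) a :
  (forall b c, le b c -> P c -> P b) -> P a -> reduces P (mpolyX K a).
Proof.
move=> Pdown; pose pw (b : multinom n) := (\sum_l b l * pos l)%N.
have pwD b c : pw (b +m c) = (pw b + pw c)%N.
  by rewrite /pw -big_split /=; apply: eq_bigr => l _; rewrite mnmDE mulnDl.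
have pw1 l : pw (mnm1 l) = pos l.
  rewrite /pw (bigD1 l) //= mnm1E eqxx mul1n big1 ?addn0 // => l' ll'.
  by rewrite mnm1E eq_sym (negbTE ll').
move: {2}(pw a).+1 (ltnSn (pw a)) => N; elim: N a => // N IH a aN Pa.
have [sa|/contrapT [c gc ca]] := pselect (standard a).
  exists 0, (mpolyX K a); split; rewrite ?add0r //; first exact: Span0.
  by move=> b; rewrite msuppX inE => /eqP ->.
have [|||p' Ep' hp'] := @vand_lead K n pos (fun b b' => le b b' /\ (pw b < pw b')%N) _ _ _ c.
- by move=> b1 b2 b3 [h1 h2] [h3 h4]; split; [apply: le_trans h1 h3|apply: ltn_trans h2 h4].
- by move=> b1 b2 b3 [h1 h2]; split; [apply: le_add|rewrite !pwD ltn_add2r].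
- by move=> l l' h; split; [apply: le_swap|rewrite !pw1].
pose m := mnm_sub a (rank_mnm pos c).
have Ea : m +m rank_mnm pos c = a.
  by apply/mnmP => l; rewrite mnmDE mnmBE rank_mnmE subnK.
have -> : mpolyX K a = 1 *: (mpolyX K m * vand c) +
    (-1) *: (\sum_(b <- msupp p') mcoeff b p' *: mpolyX K (m +m b)).
  rewrite Ep' mulrDr -mpolyXD Ea scale1r scaleN1r -addrA.
  rewrite {1}(mpolyE p') mulr_sumr -sumrN -big_split /= big1 ?addr0 // => b _.
  by rewrite -scalerAr mpolyXD subrr.
apply: reducesD; last first.
  apply/reducesZ/reduces_sum => b /hp' [leb pwb]; apply: IH.
    by rewrite -ltnS (leq_trans _ aN) // ltnS -Ea !pwD ltn_add2l.
  apply: Pdown Pa; rewrite -Ea ![m +m _]addmC; exact: le_add.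
exists (1 *: (mpolyX K m * vand c)), 0; rewrite addr0; split=> //.
  by rewrite -[X in span _ X]addr0; apply: SpanD; rewrite ?Ea //; apply: Span0.
by move=> b; rewrite msupp0.
Qed.

Lemma reduces_poly (P : multinom n -> Prop) p :
  (forall b c, le b c -> P c -> P b) -> {in msupp p, forall b, P b} -> reduces P p.
Proof.
move=> Pdown h; rewrite (mpolyE p); apply: reduces_sum => b /h.
exact: reduces_monomial.
Qed.

(** No nonzero element of the ideal is standard, so reduction writes every
    element of the ideal in terms of the products of differences. *)
Lemma ideal_span (P : multinom n -> Prop) p :
  (forall b c, le b c -> P c -> P b) -> {in msupp p, forall b, P b} ->
  specht_ideal K n la p -> span P p.
Proof.
move=> Pdown hP pI; have [h [r [E hh hr]]] := reduces_poly Pdown hP.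
suff r0 : r = 0 by rewrite E r0 addr0.
apply/eqP; apply: contraT => rn0.
have rI : specht_ideal K n la r.
  rewrite (_ : r = p + - h); last by rewrite E addrC addKr.
  by apply: ideal_genD => //; apply/ideal_genN/span_ideal/hh.
have [a ar] := good_support rI rn0.
by case: (hr a ar).
Qed.

End Order.
End Reduction.

(** * Initial forms *)

Section InitialForms.
Variables (R : realType) (K : fieldType) (n : nat).
Implicit Types (w : 'rV[R]_n) (p q : mpoly n K) (a b m : multinom n).
Local Notation "a +m b" := (mnm_add a b) (at level 50, left associativity).
Local Open Scope ring_scope.

Lemma weightE w a : weight w a = \sum_l (a l)%:R * w 0 l.
Proof. by apply: eq_bigr => l _; rewrite mxE. Qed.

Lemma weightD w a b : weight w (a +m b) = weight w a + weight w b.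
Proof.
by rewrite !weightE -big_split /=; apply: eq_bigr => l _; rewrite mnmDE natrD mulrDl.
Qed.

Lemma weight0 w : weight w (@mnm0 n) = 0.
Proof. by rewrite weightE big1 // => l _; rewrite mnm0E mul0r. Qed.

Lemma weight1 w l : weight w (mnm1 l) = w 0 l.
Proof.
rewrite weightE (bigD1 l) //= mnm1E eqxx mul1r big1 ?addr0 // => l' ll'.
by rewrite mnm1E eq_sym (negbTE ll') mul0r.
Qed.

Definition graded_part w W p : mpoly n K :=
  \sum_(b <- msupp p | weight w b == W) mcoeff b p *: mpolyX K b.

Lemma mcoeff_graded w W p b :
  mcoeff b (graded_part w W p) = if weight w b == W then mcoeff b p else 0.
Proof.
rewrite raddf_sum /=.
have [bp|bp] := boolP (b \in msupp p).
  rewrite big_mkcond (bigD1_seq b) //= ?msupp_uniq // big1 ?addr0 => [|a ab].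
    by case: ifP => // _; rewrite mcoeffZ mcoeffX eqxx mulr1.
  by case: ifP => // _; rewrite mcoeffZ mcoeffX (negbTE ab) mulr0.
rewrite (memN_msupp_eq0 bp) if_same big_seq_cond big1 // => a /andP[ap _].
rewrite mcoeffZ mcoeffX; case: eqP => [E|_]; last by rewrite mulr0.
by rewrite -E ap in bp.
Qed.

Lemma msupp_graded w W p b : b \in msupp (graded_part w W p) ->
  b \in msupp p /\ weight w b = W.
Proof.
by rewrite !mcoeff_msupp mcoeff_graded; case: ifP => [/eqP->|]; rewrite ?eqxx.
Qed.

Lemma graded0 w W : graded_part w W 0 = 0.
Proof. by apply/mpolyP => b; rewrite mcoeff_graded !mcoeff0 if_same. Qed.

Lemma gradedD w W p q : graded_part w W (p + q) = graded_part w W p + graded_part w W q.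
Proof.
by apply/mpolyP => b; rewrite mcoeffD !mcoeff_graded mcoeffD; case: ifP; rewrite ?addr0.
Qed.

Lemma gradedZ w W e p : graded_part w W (e *: p) = e *: graded_part w W p.
Proof.
by apply/mpolyP => b; rewrite mcoeffZ !mcoeff_graded mcoeffZ; case: ifP; rewrite ?mulr0.
Qed.

Lemma graded_sum w W (I : Type) (r : seq I) (P : pred I) (F : I -> mpoly n K) :
  graded_part w W (\sum_(i <- r | P i) F i) = \sum_(i <- r | P i) graded_part w W (F i).
Proof. exact: (big_morph _ (gradedD w W) (graded0 w W)). Qed.

Lemma gradedX w W b :
  graded_part w W (mpolyX K b) = if weight w b == W then mpolyX K b else 0.
Proof.
apply/mpolyP => a; rewrite mcoeff_graded mcoeffX.
case: (b =P a) => [->|ba]; first by case: ifP; rewrite ?mcoeff0 // mcoeffX eqxx.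
by rewrite mulr0n if_same; case: ifP => _; rewrite ?mcoeff0 // mcoeffX; case: eqP.
Qed.

Lemma gradedXM w W m p :
  graded_part w W (mpolyX K m * p) = mpolyX K m * graded_part w (W - weight w m) p.
Proof.
rewrite {1}(mpolyE p) mulr_sumr graded_sum [X in _ = _ * X]/graded_part mulr_sumr [RHS]big_mkcond.
apply: eq_bigr => b _; rewrite -scalerAr gradedZ -mpolyXD gradedX weightD.
have -> : (weight w b == W - weight w m) = (weight w m + weight w b == W).
  by rewrite eq_sym subr_eq eq_sym addrC.
by case: ifP => // _; rewrite ?scaler0 // -scalerAr.
Qed.

Lemma gradedM w W1 W2 p q :
  {in msupp p, forall b, weight w b <= W1} -> {in msupp q, forall b, weight w b <= W2} ->
  graded_part w (W1 + W2) (p * q) = graded_part w W1 p * graded_part w W2 q.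
Proof.
move=> hp hq; rewrite {1}(mpolyE p) mulr_suml graded_sum.
rewrite [X in _ = X * _]/graded_part mulr_suml [RHS]big_mkcond big_seq [RHS]big_seq.
apply: eq_bigr => b bp; rewrite -scalerAl gradedZ gradedXM.
have [->|lt1] := eqVneq (weight w b) W1.
  by rewrite [W1 + W2]addrC addrK -scalerAl.
rewrite (_ : graded_part _ _ q = 0) ?mulr0 ?scaler0 //; apply/mpolyP => a.
rewrite mcoeff_graded mcoeff0; case: eqP => // E; apply/memN_msupp_eq0/negP => /hq.
have {}lt1 : weight w b < W1 by rewrite lt_neqAle lt1 hp.
by rewrite E; lra.
Qed.

Lemma msuppM_weight w W1 W2 p q :
  {in msupp p, forall b, weight w b <= W1} -> {in msupp q, forall b, weight w b <= W2} ->
  {in msupp (p * q), forall b, weight w b <= W1 + W2}.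
Proof.
move=> hp hq b /msuppM_le /allpairsP[[b1 b2]] /= [/hp h1 /hq h2 ->].
by rewrite weightD lerD.
Qed.

Lemma graded_prod w (I : Type) (r : seq I) (P : pred I) (F : I -> mpoly n K) (W : I -> R) :
  (forall i, P i -> {in msupp (F i), forall b, weight w b <= W i}) ->
  graded_part w (\sum_(i <- r | P i) W i) (\prod_(i <- r | P i) F i) =
    \prod_(i <- r | P i) graded_part w (W i) (F i) /\
  {in msupp (\prod_(i <- r | P i) F i), forall b, weight w b <= \sum_(i <- r | P i) W i}.
Proof.
move=> h; elim: r => [|i r [IH1 IH2]].
  rewrite !big_nil; split; last by move=> b; rewrite msupp1 inE => /eqP ->; rewrite weight0.
  by rewrite -mpolyX0 gradedX weight0 eqxx.
rewrite !big_cons; case: ifP => // Pi; split; first by rewrite gradedM ?IH1 //; apply: h.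
by apply: msuppM_weight => //; apply: h.
Qed.

Lemma initial_form_graded w p a : a \in msupp p ->
  {in msupp p, forall b, weight w b <= weight w a} ->
  initial_form w p = graded_part w (weight w a) p.
Proof.
move=> ap hp; rewrite /initial_form /graded_part big_seq_cond [RHS]big_seq_cond.
apply: eq_bigl => b; case bp: (b \in msupp p) => //=; apply/allP/eqP => [h|->//].
by apply/eqP; rewrite eq_le hp //= h.
Qed.

Lemma initial_form0 w : initial_form w (0 : mpoly n K) = 0.
Proof. by rewrite /initial_form msupp0 big_nil. Qed.

Lemma heaviest w p : p != 0 ->
  exists2 a, a \in msupp p & {in msupp p, forall b, weight w b <= weight w a}.
Proof.
rewrite -msupp_eq0; case: (msupp p) => // a0 s _.
have [i _ hi] := @arg_maxP _ R 'I_(size (a0 :: s)) ord0 xpredT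
  (fun i => weight w (nth a0 (a0 :: s) i)) isT.
exists (nth a0 (a0 :: s) i); first by rewrite mem_nth.
move=> b bs; have ib : (index b (a0 :: s) < size (a0 :: s))%N by rewrite index_mem.
by have := hi (Ordinal ib) isT; rewrite /= nth_index.
Qed.

Section OfVand.
Variables (pos : 'S_n) (c : 'I_n -> 'I_n).
Local Notation var i := (mpolyX K (mnm1 i)).

(** Initial forms of products of differences only depend on which entries of a
    column have equal weights, once the column is sorted by weight. *)
Lemma initial_form_vand w :
  (forall l l', c l = c l' -> (pos l' < pos l)%N -> w 0 l' <= w 0 l) ->
  [/\ initial_form w (vand K pos c) =
    graded_part w (weight w (rank_mnm pos c)) (vand K pos c),
  graded_part w (weight w (rank_mnm pos c)) (vand K pos c) =
    \prod_l \prod_(l' | (c l' == c l) && (pos l' < pos l)%N)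
      (if w 0 l' == w 0 l then var l - var l' else var l) &
  {in msupp (vand K pos c), forall b, weight w b <= weight w (rank_mnm pos c)} ].
Proof.
move=> cw.
have W1 l l' : (c l' == c l) && (pos l' < pos l)%N ->
    {in msupp (var l - var l'), forall b, weight w b <= w 0 l}.
  move=> /andP[/eqP/esym cl pl] b /msuppB_le; rewrite mem_cat !msuppX !inE.
  by case/orP => /eqP ->; rewrite weight1 // cw.
have G1 l l' : (c l' == c l) && (pos l' < pos l)%N ->
    graded_part w (w 0 l) (var l - var l') = if w 0 l' == w 0 l then var l - var l' else var l.
  move=> _; rewrite -scaleN1r gradedD gradedZ !gradedX !weight1 eqxx.
  by case: ifP; rewrite ?scaler0 ?addr0.
have EW : weight w (rank_mnm pos c) =
    \sum_l \sum_(l' | (c l' == c l) && (pos l' < pos l)%N) w 0 l.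
  rewrite rank_mnm_sum (big_morph _ (weightD w) (weight0 w)); apply: eq_bigr => l _.
  by rewrite (big_morph _ (weightD w) (weight0 w)); apply: eq_bigr => l' _; rewrite weight1.
have inner l := @graded_prod w _ (index_enum 'I_n) _ _ _ (W1 l).
have outer := @graded_prod w _ (index_enum 'I_n) xpredT _ _ (fun l _ => (inner l).2).
have [E1 E2] : graded_part w (weight w (rank_mnm pos c)) (vand K pos c) =
    \prod_l \prod_(l' | (c l' == c l) && (pos l' < pos l)%N)
      (if w 0 l' == w 0 l then var l - var l' else var l) /\
    {in msupp (vand K pos c), forall b, weight w b <= weight w (rank_mnm pos c)}.
  rewrite EW; split; last exact: outer.2.
  rewrite [LHS]outer.1; apply: eq_bigr => l _; rewrite (inner l).1.
  by apply: eq_bigr => l' h; rewrite G1.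
split=> //.
have : graded_part w (weight w (rank_mnm pos c)) (vand K pos c) != 0.
  rewrite E1; apply/prodf_neq0 => l _; apply/prodf_neq0 => l' /andP[_ pl].
  case: ifP => _; last by rewrite -msupp_eq0 msuppX.
  by rewrite subr_eq0 mpolyX_neq //; apply: contraTneq pl => ->; rewrite ltnn.
rewrite -msupp_eq0; case S: (msupp _) => [//|b s] _.
have [bV Wb] : b \in msupp (vand K pos c) /\ weight w b = weight w (rank_mnm pos c).
  by apply: msupp_graded; rewrite S mem_head.
by rewrite -Wb; apply: initial_form_graded => // a /E2; rewrite Wb.
Qed.

End OfVand.

Lemma initial_ideal_mem w (I : set (mpoly n K)) p : I p -> initial_ideal w I (initial_form w p).
Proof. by move=> Ip; apply: ideal_gen_mem; exists p. Qed.

(** Initial forms are homogeneous for the grading by [w], so the polynomials with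
    this property form an ideal that contains them. *)
Lemma initial_ideal_graded w (G : set (mpoly n K)) h W :
  initial_ideal w (ideal_gen G) h ->
  exists2 g, ideal_gen G g &
    {in msupp g, forall b, weight w b <= W} /\ graded_part w W g = graded_part w W h.
Proof.
pose J h := forall W, exists2 g, ideal_gen G g &
  {in msupp g, forall b, weight w b <= W} /\ graded_part w W g = graded_part w W h.
have J0 : J 0.
  by move=> V; exists 0; [exact: ideal_gen0|split=> // b; rewrite msupp0].
have JD p q : J p -> J q -> J (p + q).
  move=> Jp Jq V; have [g1 G1 [s1 E1]] := Jp V; have [g2 G2 [s2 E2]] := Jq V.
  exists (g1 + g2); first exact: ideal_genD.
  split; last by rewrite !gradedD E1 E2.
  by move=> b /msuppD_le; rewrite mem_cat => /orP[/s1|/s2].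
have JM f p : J p -> J (f * p).
  move=> Jp; rewrite (mpolyE f) mulr_suml; elim/big_ind: _ => // b _ V.
  have [g gI [sg Eg]] := Jp (V - weight w b).
  exists (mcoeff b f *: mpolyX K b * g); first exact: ideal_genM.
  split; last by rewrite -!scalerAl !gradedZ !gradedXM Eg.
  move=> b'; rewrite -scalerAl => /msuppZ_le /msuppM_le /allpairsP[[b1 b2]] /=.
  by rewrite msuppX inE => -[/eqP-> /sg h2 ->]; rewrite weightD; lra.
move=> hI; suff : J h by apply.
move: h hI; apply: (@ideal_gen_le _ _ J _ J0 JD JM) => _ [p Ip <-] {}W.
have [->|p0] := eqVneq p 0; first by rewrite initial_form0; apply: J0.
have [a ap ha] := heaviest w p0; rewrite (initial_form_graded ap ha).
have [EW|aW] := eqVneq (weight w a) W.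
  exists p => //; split=> [b /ha|]; first by rewrite EW.
  by apply/mpolyP => b; rewrite !mcoeff_graded -EW; case: ifP.
exists 0; first exact: ideal_gen0.
split=> [b|]; first by rewrite msupp0.
apply/mpolyP => b; rewrite graded0 mcoeff0 !mcoeff_graded.
by case: (weight w b =P W) => // ->; rewrite eq_sym (negbTE aW).
Qed.

End InitialForms.

(** * Weights with equal initial ideals *)

Definition sorts (R : realType) n (pos : 'S_n) (w : 'rV[R]_n) (v : 'I_n -> nat) :=
  forall l l', (pos l < pos l')%N =
    ((w 0 l < w 0 l') || ((w 0 l == w 0 l') && (v l < v l')%N))%R.

Section InitialSpecht.
Variables (R : realType) (K : fieldType) (n k : nat) (la : seq nat).
Hypothesis la_part : is_partition n la.
Hypothesis la_gap : forall t, (0 < t)%N -> (t < size la)%N -> (nth 0 la t + k <= nth 0 la t.-1)%N.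
Implicit Types (w : 'rV[R]_n) (pos : 'S_n).
Local Notation "a +m b" := (mnm_add a b) (at level 50, left associativity).
Local Notation I := (specht_ideal K n la).
Local Open Scope ring_scope.

(** A standard representation of [p] stays below the weight of [p], so the
    initial form of [p] is a combination of initial forms of good products of
    differences; the latter are the same for both weights. *)
Lemma initial_ideal_sub pos x0 w w' : (x0 <= n)%N -> (n <= x0 + k.+1)%N ->
  (forall l l', (pos l' < pos l)%N -> w 0 l' <= w 0 l) ->
  (forall c, good_columns K la pos x0 c ->
     initial_form w (vand K pos c) = initial_form w' (vand K pos c)) ->
  forall h, initial_ideal w I h -> initial_ideal w' I h.
Proof.
move=> x0n nx0 wpos ww'; apply: ideal_gen_le.
- move=> _ [p Ip <-].
  have [->|p0] := eqVneq p 0; first by rewrite initial_form0; apply: ideal_gen0.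
  have [a ap ha] := heaviest w p0; rewrite (initial_form_graded ap ha).
  have : span la pos x0 (fun b => weight w b <= weight w a) p.
    apply: (@ideal_span K n k la la_part la_gap pos x0 x0n nx0 (fun b c => weight w b <= weight w c)) => //.
    + by move=> b1 b2 b3; apply: le_trans.
    + by move=> b1 b2 b3; rewrite !weightD lerD2r.
    + by move=> l l' /wpos; rewrite !weight1.
    + by move=> b c; apply: le_trans.
  elim=> [|e m c h gc hm _ IH]; first by rewrite graded0; apply: ideal_gen0.
  rewrite gradedD gradedZ gradedXM; apply: ideal_genD IH.
  rewrite -mul_mpolyC mulrA; have [E1 _ E3] := @initial_form_vand R K n pos c w (fun l l' _ => wpos l l').
  have := ww' c gc; rewrite E1 => Ein.
  have [Ew|ne] := eqVneq (weight w a - weight w m) (weight w (rank_mnm pos c)).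
    by rewrite Ew Ein; apply/ideal_genM/initial_ideal_mem/(good_ideal gc).
  rewrite (_ : graded_part _ _ _ = 0) ?mulr0; first exact: ideal_gen0.
  apply/mpolyP => b; rewrite mcoeff_graded mcoeff0; case: eqP => // E.
  apply/memN_msupp_eq0/negP => /E3; rewrite E => h'.
  by move: hm ne; rewrite weightD => h'' /eqP; apply; lra.
- exact: ideal_gen0.
- exact: ideal_genD.
- exact: ideal_genM.
Qed.

Definition heavier w i : nat := #|[pred l | w 0 i <= w 0 l]|.

(** The comparisons [w_i <= w_j] that the initial ideal detects: [x_i] must not
    be among the [k + 1] heaviest variables.  They also determine the face of the
    polytope maximizing [w]. *)
Definition detected w i j : bool :=
  [&& i != j, w 0 i <= w 0 j & (k.+1 < heavier w i)%N].

Lemma weight_order w (v : 'I_n -> nat) : injective v ->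
  exists pos, sorts pos w v.
Proof.
move=> v_inj; pose lt l l' := (w 0 l < w 0 l') || ((w 0 l == w 0 l') && (v l < v l')%N).
have ltxx l : lt l l = false by rewrite /lt ltxx ltnn andbF.
have lt_tr l1 l2 l3 : lt l1 l2 -> lt l2 l3 -> lt l1 l3.
  rewrite /lt => /orP[h1|/andP[/eqP -> h1]] /orP[h2|/andP[/eqP <- h2]].
  - by rewrite (lt_trans h1 h2).
  - by rewrite h1.
  - by rewrite h2.
  - by rewrite eqxx (ltn_trans h1 h2) orbT.
pose p l : nat := #|[pred l' | lt l' l]|.
have p_lt l l' : lt l l' -> (p l < p l')%N.
  move=> h; rewrite /p [X in (_ < X)%N](cardD1 l) inE h add1n ltnS.
  apply: sub_card => l2 /= h2; rewrite inE (lt_tr _ _ _ h2 h) andbT.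
  by apply: contraTneq h2 => ->; rewrite ltxx.
have p_n l : (p l < n)%N.
  rewrite -[X in (_ < X)%N]card_ord [X in (_ < X)%N](cardD1 l) add1n ltnS.
  apply: (@sub_card _ (fun l' => lt l' l) (fun l' => (l' != l) && true)) => l' h; rewrite andbT.
  by apply: contraTneq h => ->; rewrite ltxx.
have total l l' : l != l' -> lt l l' || lt l' l.
  move=> ll'; rewrite /lt; case: (ltgtP (w 0 l) (w 0 l')) => //= _.
  by case: (ltngtP (v l) (v l')) => // /v_inj E; rewrite E eqxx in ll'.
have q_inj : injective (fun l => Ordinal (p_n l)).
  move=> l l' [] E; apply/eqP; apply: contraT => /total /orP[] /p_lt; rewrite E ltnn //.
exists (perm q_inj) => l l'; rewrite !permE /=; rewrite -/(lt l l').
have [->|ll'] := eqVneq l l'; first by rewrite ltnn ltxx.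
have [h|h] := orP (total _ _ ll'); first by rewrite h p_lt.
rewrite ltnNge ltnW ?p_lt //; apply/esym/negbTE/negP => h'.
by have := lt_tr _ _ _ h h'; rewrite ltxx.
Qed.

Lemma heavier_le w i j : w 0 i <= w 0 j -> (heavier w j <= heavier w i)%N.
Proof. by move=> h; apply: sub_card => l; apply: le_trans. Qed.

(** The tie-breaking rule that puts [i] first among the entries of its weight. *)
Definition first_in_tie (i l : 'I_n) : nat := if l == i then 0 else l.+1.

Lemma first_in_tie_inj i : injective (first_in_tie i).
Proof.
move=> l l'; rewrite /first_in_tie.
by case: eqP => [->|_]; case: eqP => [->|_] // [] /ord_inj.
Qed.

Lemma first_in_tie_pos w pos i : sorts pos w (first_in_tie i) ->
  (pos i + heavier w i)%N = n.
Proof.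
move=> hpos; rewrite -[RHS]card_ord -(cardC [pred l | (pos l < pos i)%N]).
congr (_ + _)%N; first by rewrite card_pos_lt // ltnW.
by apply: eq_card => l; rewrite !inE hpos /first_in_tie eqxx andbF orbF -leNgt.
Qed.

Lemma first_in_tie_lt w pos i j : sorts pos w (first_in_tie i) -> i != j ->
  (pos i < pos j)%N = (w 0 i <= w 0 j).
Proof.
move=> -> ij; rewrite /first_in_tie eqxx [j == i]eq_sym (negbTE ij) le_eqVlt andbT.
by rewrite orbC.
Qed.

(** The lightest of these variables has at least all of them above it. *)
Lemma card_heaviest w : (#|[pred i | heavier w i <= k.+1]| <= k.+1)%N.
Proof.
have [/existsP[i0 Ui0]|] := boolP [exists i, heavier w i <= k.+1]%N; last first.
  by rewrite negb_exists => /forallP h; rewrite eq_card0 // => i; rewrite inE; apply/negbTE/h.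
have [i Ui imin] := @arg_minP _ R 'I_n i0 (fun i => heavier w i <= k.+1)%N (fun i => w 0 i) Ui0.
by apply: leq_trans Ui; apply: sub_card => j Uj; apply: imin.
Qed.

Let detected_heavier w w' : (forall i j, detected w i j = detected w' i j) ->
  forall i, (k.+1 < heavier w i)%N -> (k.+1 < heavier w' i)%N.
Proof.
move=> same i hi.
have [j /andP[ji wij]] : exists j, (j != i) && (w 0 i <= w 0 j).
  apply/existsP; apply: contraLR hi; rewrite negb_exists => /forallP h.
  rewrite -leqNgt (@leq_trans 1%N) // -(card1 i); apply: subset_leq_card.
  apply/fintype.subsetP => l; rewrite !inE => wl; apply: contraT => li.
  by have := h l; rewrite li wl.
have : detected w i j by rewrite /detected eq_sym ji wij.
by rewrite same => /and3P[].
Qed.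

(** Weights with the same detected comparisons differ only among at most [k + 1]
    heaviest variables, and these lie in distinct columns of the generators. *)
Lemma detected_initial_sub w w' : (forall i j, detected w i j = detected w' i j) ->
  forall h, initial_ideal w I h -> initial_ideal w' I h.
Proof.
move=> same; have [pos hpos] := weight_order w (@ord_inj n).
(* [U] contains the late variables, those from position [x0] on. *)
pose U i := (heavier w i <= k.+1)%N.
have notU i : ~~ U i = (k.+1 < heavier w i)%N by rewrite -ltnNge.
have U' i : U i = (heavier w' i <= k.+1)%N.
  rewrite /U leqNgt [RHS]leqNgt; congr (~~ _).
  by apply/idP/idP; apply: detected_heavier.
have Uup i j : U i -> w 0 i <= w 0 j -> U j.
  by move=> Ui /heavier_le h; apply: leq_trans h Ui.
pose x0 := #|[pred i | ~~ U i]|.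
have x0n : (x0 <= n)%N by rewrite -[X in (_ <= X)%N]card_ord max_card.
have nx0 : (n <= x0 + k.+1)%N.
  rewrite -[X in (X <= _)%N]card_ord -(cardC [pred i | ~~ U i]) leq_add2l.
  by apply: leq_trans (card_heaviest w); apply: subset_leq_card; apply/fintype.subsetP => i; rewrite !inE negbK.
have posU l : (x0 <= pos l)%N -> U l.
  apply: contraLR => nUl; rewrite -ltnNge -[X in (X < _)%N](card_pos_lt pos (ltnW (ltn_ord (pos l)))).
  rewrite /x0 [X in (_ < X)%N](cardD1 l) inE nUl add1n ltnS.
  apply: sub_card => l' pl'; rewrite inE; apply/andP; split.
    by apply: contraTneq pl' => ->; rewrite ltnn.
  apply: contra nUl => /Uup; apply.
  by move: pl'; rewrite hpos => /orP[/ltW//|/andP[/eqP->]].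
have Upos l : U l -> (x0 <= pos l)%N.
  move=> Ul; rewrite -[X in (_ <= X)%N](card_pos_lt pos (ltnW (ltn_ord (pos l)))).
  apply: sub_card => l' nUl'; rewrite hpos; apply/orP; left; rewrite ltNge.
  by apply: contra nUl' => /(Uup _ _ Ul).
have posw l l' : (pos l' < pos l)%N -> w 0 l' <= w 0 l.
  by rewrite hpos => /orP[/ltW//|/andP[/eqP->]].
apply: (initial_ideal_sub x0n nx0 posw) => c gc.
have pair l l' : c l = c l' -> (pos l' < pos l)%N ->
    w' 0 l' <= w' 0 l /\ (w 0 l' == w 0 l) = (w' 0 l' == w' 0 l).
  move=> cll' pl; have ll' : l' != l by apply: contraTneq pl => ->; rewrite ltnn.
  have nUl' : ~~ U l'.
    apply: contra ll' => Ul'; apply/eqP/esym; apply: (good_strip gc) => //.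
      by rewrite (leq_trans (Upos _ Ul')) // ltnW.
    exact: Upos.
  have w'le : w' 0 l' <= w' 0 l.
    have : detected w l' l by rewrite /detected ll' (posw _ _ pl) -notU nUl'.
    by rewrite same => /and3P[].
  split=> //; rewrite !eq_le w'le (posw _ _ pl) /=.
  have [Ul|nUl] := boolP (U l).
    have nw : ~~ (w 0 l <= w 0 l') by apply: contra nUl' => /(Uup _ _ Ul).
    have nw' : ~~ (w' 0 l <= w' 0 l').
      by apply: contra nUl' => /heavier_le h; rewrite U' (leq_trans h) // -U'.
    by rewrite (negbTE nw) (negbTE nw').
  have := same l l'; rewrite /detected eq_sym ll' -notU nUl.
  by have -> : (k.+1 < heavier w' l)%N by [rewrite ltnNge -U']; rewrite !andbT.
have [E1 F1 _] := @initial_form_vand R K n pos c w (fun l l' _ => posw l l').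
have [E2 F2 _] := @initial_form_vand R K n pos c w' (fun l l' h h' => (pair l l' h h').1).
rewrite E1 E2 F1 F2; apply: eq_bigr => l _; apply: eq_bigr => l' /andP[/eqP/esym cl pl].
by rewrite (pair l l' cl pl).2.
Qed.

Lemma detected_initial w w' : (forall i j, detected w i j = detected w' i j) ->
  initial_ideal w I = initial_ideal w' I.
Proof.
move=> same; apply/seteqP; split=> h; apply: detected_initial_sub => //.
Qed.

(** The product of differences with lead exponent [rho'] has a leading part in the
    common initial ideal.  Its heaviest monomial, ties being broken by [v], is
    [x^rho'], and such a monomial cannot be standard for the order [pos]. *)
Lemma initial_eq_lattice w w' (v : 'I_n -> nat) pos pos' rho' :
  sorts pos w v -> sorts pos' w' v ->
  initial_ideal w I = initial_ideal w' I ->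
  lattice pos' rho' -> dominated (part_sum la) rho' ->
  exists rho, [/\ lattice pos rho, dominated (part_sum la) rho & forall l, (rho l <= rho' l)%N].
Proof.
move=> hpos hpos' same lat dom.
have [c [c1 c2 _ _]] := lattice_columns lat.
have vI : I (vand K pos' c) by apply: (vand_mem K la_part pos'); apply: columns_dominated dom c2.
(* Monomials are compared by weight, then by [wv]. *)
pose wv (b : multinom n) := (\sum_l b l * v l)%N.
have wvD b b' : wv (b +m b') = (wv b + wv b')%N.
  by rewrite /wv -big_split /=; apply: eq_bigr => l _; rewrite mnmDE mulnDl.
have wv1 l : wv (mnm1 l) = v l.
  rewrite /wv (bigD1 l) //= mnm1E eqxx mul1n big1 ?addn0 // => l' ll'.
  by rewrite mnm1E eq_sym (negbTE ll').
set a := rank_mnm pos' c.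
pose lt' b b' := weight w' b < weight w' b' \/ (weight w' b = weight w' b' /\ (wv b < wv b')%N).
have [|||p' Ep' hp'] := @vand_lead K n pos' lt' _ _ _ c.
- move=> b1 b2 b3 [h1|[e1 h1]] [h2|[e2 h2]].
  + by left; apply: lt_trans h1 h2.
  + by left; rewrite -e2.
  + by left; rewrite e1.
  + by right; split; [rewrite e1|apply: ltn_trans h1 h2].
- by move=> b1 b2 b3; rewrite /lt' !weightD !wvD ltrD2r ltn_add2r => -[h|[-> h]]; [left|right].
- by move=> l l'; rewrite hpos' /lt' !weight1 !wv1 => /orP[h|/andP[/eqP h1 h2]]; [left|right].
have lt'a : ~ lt' a a by rewrite /lt' ltxx ltnn => -[|[]].
have cw l l' : c l = c l' -> (pos' l' < pos' l)%N -> w' 0 l' <= w' 0 l.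
  by move=> _; rewrite hpos' => /orP[/ltW//|/andP[/eqP->]].
have [Eh _ _] := initial_form_vand K cw.
have : initial_ideal w I (initial_form w' (vand K pos' c)).
  by rewrite same; apply: initial_ideal_mem.
rewrite Eh; set h := graded_part _ _ _ => /initial_ideal_graded - /(_ (weight w a)) [g gI [sg Eg]].
have ha : mcoeff a h = 1.
  rewrite mcoeff_graded eqxx Ep' mcoeffD mcoeffX eqxx (memN_msupp_eq0 (m := a)) ?addr0 //.
  by apply/negP => /hp'.
have hb b : b \in msupp h -> b != a -> (wv b < wv a)%N.
  move=> /msupp_graded [bV Wb] ba.
  have /hp' : b \in msupp p'.
    by move: bV; rewrite !mcoeff_msupp Ep' mcoeffD mcoeffX [a == b]eq_sym (negbTE ba) add0r.
  by case; [rewrite Wb ltxx|case].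
have ga : mcoeff a g = 1.
  have := congr1 (mcoeff a) Eg.
  by rewrite mcoeff_graded [mcoeff a (graded_part _ _ h)]mcoeff_graded ha eqxx.
pose le b b' := weight w b < weight w b' \/ (weight w b = weight w b' /\ (wv b <= wv b')%N).
pose P b := weight w b < weight w a \/ (weight w b = weight w a /\ (wv b < wv a)%N).
have x0n : (n <= n)%N by [].
have nx0 : (n <= n + k.+1)%N by apply: leq_addr.
have gP b : b \in msupp (g - mcoeff a g *: mpolyX K a) -> P b.
  rewrite mcoeff_msupp mcoeffB mcoeffZ mcoeffX.
  case: (a =P b) => [<-|ab]; first by rewrite mulr1 subrr eqxx.
  rewrite mulr0 subr0 => gb.
  have := sg b; rewrite mcoeff_msupp gb le_eqVlt => /(_ isT) /orP[/eqP Wb|]; last by left.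
  right; split=> //; apply: hb; last by rewrite eq_sym; apply/eqP.
  have := congr1 (mcoeff b) Eg; rewrite [in LHS]mcoeff_graded Wb eqxx => gb'.
  rewrite gb' mcoeff_graded Wb eqxx in gb.
  by rewrite mcoeff_msupp.
(* All monomials of [g] except [x^a] are below [x^a] for the order of [pos]; once
   they are reduced, [x^a] is the only monomial that may fail to be standard. *)
have [||||hh [r [Er hs hr]]] := @reduces_poly K n la pos n le _ _ _ P _ _ gP.
+ move=> b1 b2 b3 [h1|[e1 h1]] [h2|[e2 h2]].
  * by left; apply: lt_trans h1 h2.
  * by left; rewrite -e2.
  * by left; rewrite e1.
  * by right; split; [rewrite e1|apply: leq_trans h1 h2].
+ by move=> b1 b2 b3; rewrite /le !weightD !wvD ltrD2r leq_add2r => -[H|[-> H]]; [left|right].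
+ move=> l l'; rewrite hpos /le !weight1 !wv1 => /orP[H|/andP[/eqP h1 h2]]; [by left|right].
  by split=> //; apply: ltnW.
+ move=> b1 b2 [h1|[e1 h1]] [h2|[e2 h2]].
  * by left; apply: lt_trans h1 h2.
  * by left; rewrite -e2.
  * by left; rewrite e1.
  * by right; split; [rewrite e1|apply: leq_ltn_trans h1 h2].
pose f := mcoeff a g *: mpolyX K a + r.
have fI : I f.
  have -> : f = g + - hh by rewrite /f -[X in _ = X - _](subrK (mcoeff a g *: mpolyX K a)) Er addrAC [hh + _]addrC addrK addrC.
  by apply: ideal_genD => //; apply/ideal_genN/span_ideal/hs.
have nPa : ~ P a by rewrite /P ltxx ltnn => -[|[]].
have fa : mcoeff a f = 1.
  rewrite mcoeffD mcoeffZ mcoeffX eqxx mulr1 ga (memN_msupp_eq0 (m := a)) ?addr0 //.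
  by apply/negP => /hr [].
have f0 : f != 0 by apply: contraTneq isT => f0; move: fa; rewrite f0 mcoeff0 => /esym/eqP; rewrite oner_eq0.
have [b bf] := good_support la_part la_gap pos x0n nx0 fI f0.
have [->|ba] := eqVneq b a.
  move=> /contrapT [c0 gc0 le0]; exists (rank pos c0); split.
  * exact: good_lattice gc0.
  * exact: good_dominated gc0.
  * by move=> l; have := le0 l; rewrite rank_mnmE c1.
case; move: bf; rewrite mcoeff_msupp mcoeffD mcoeffZ mcoeffX [a == b]eq_sym (negbTE ba) mulr0 add0r.
by rewrite -mcoeff_msupp => /hr [].
Qed.

End InitialSpecht.

(** * Separating two orders by row fillings *)

Section Fill.
Variables (n : nat) (pos : 'S_n).
Implicit Types (rho : 'I_n -> nat) (X : pred 'I_n) (m : nat -> nat).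
Local Open Scope nat_scope.

Lemma card_split (P Q : pred 'I_n) :
  #|[pred l | P l]| = #|[pred l | P l && Q l]| + #|[pred l | P l && ~~ Q l]|.
Proof.
rewrite -(cardID [pred l | Q l]); congr (_ + _); apply: eq_card => l; rewrite !inE //.
exact: andbC.
Qed.

Lemma prefix_card X x : x <= #|[pred l | X l]| ->
  exists2 p, p <= n & #|[pred l | (pos l < p) && X l]| = x.
Proof.
move=> xX; have full : #|[pred l | (pos l < n) && X l]| = #|[pred l | X l]|.
  by apply: eq_card => l; rewrite !inE ltn_ord.
have ex : exists p, x <= #|[pred l | (pos l < p) && X l]| by exists n; rewrite full.
case: (ex_minnP ex) => p px pmin.
have pn : p <= n by apply: pmin; rewrite full.
exists p => //; apply/eqP; rewrite eqn_leq px andbT.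
case: p pn px pmin => [|p] pn px pmin; first by rewrite eq_card0.
have [z pz] := at_pos pos pn; rewrite (prefix_step _ pz).
have : ~~ (x <= #|[pred l | (pos l < p) && X l]|).
  by apply/negP => /pmin; rewrite ltnn.
by rewrite -ltnNge; case: (X z); rewrite ?addn1 // addn0 => /ltnW.
Qed.

(** The witness fills [X] row by row, in the order of the positions. *)
Lemma row_fill X m N : (forall r, N <= r -> m r = 0) ->
  \sum_(r < N) m r = #|[pred l | X l]| ->
  exists rho, (forall r, #|[pred l | X l && (rho l == r)]| = m r) /\
    forall x r, #|[pred l | (pos l < x) && (X l && (rho l == r.+1))]| = 0 \/
                #|[pred l | (pos l < x) && (X l && (rho l == r))]| = m r.
Proof.
move=> mN sumX.
suff [rho [cnt mono]] : exists rho, (forall r, #|[pred l | X l && (rho l == r)]| = m r) /\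
    forall l l', X l -> X l' -> pos l < pos l' -> rho l <= rho l'.
  exists rho; split=> // x r.
  have [->|] := posnP #|[pred l | (pos l < x) && (X l && (rho l == r.+1))]|; first by left.
  move=> /card_gt0P[l]; rewrite inE => /and3P[lx Xl /eqP rl]; right.
  rewrite -cnt; apply: eq_card => l'; rewrite !inE.
  case Xl': (X l') => /=; last by rewrite andbF.
  case: eqP => [rl'|_]; last by rewrite andbF.
  rewrite andbT (leq_trans _ lx) // ltnS leqNgt; apply/negP => /(mono _ _ Xl Xl').
  by rewrite rl rl' ltnn.
elim: N X m mN sumX => [|N IH] X m mN sumX.
  have X0 l : X l = false.
    by move: sumX; rewrite big_ord0 => /esym /(@card0_eq _ _) /(_ l).
  exists (fun=> 0); split=> [r|l l']; last by rewrite X0.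
  by rewrite mN // eq_card0 // => l; rewrite !inE X0.
rewrite big_ord_recr /= in sumX.
have [|p pn cp] := @prefix_card X (\sum_(r < N) m r).
  by rewrite -sumX leq_addr.
pose m' r := if r < N then m r else 0.
have [||rho [cnt mono]] := IH [pred l | (pos l < p) && X l] m'.
- by move=> r; rewrite /m' ltnNge => ->.
- by rewrite cp; apply: eq_bigr => r _; rewrite /m' ltn_ord.
exists (fun l => if pos l < p then rho l else N); split=> [r|l l' Xl Xl' ll'].
  rewrite (@card_split _ (fun l => pos l < p)).
  rewrite (_ : #|_| = m' r); last first.
    rewrite -cnt; apply: eq_card => l; rewrite !inE.
    by case: ltnP => /=; rewrite ?andbT ?andbF.
  have -> : #|[pred l | X l && ((if pos l < p then rho l else N) == r) && ~~ (pos l < p)]| =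
            if r == N then m N else 0.
    case: (r =P N) => [->|rN']; last first.
      apply: eq_card0 => l; rewrite !inE; case: ltnP => _; rewrite ?andbF //.
      by case: eqP => [E|]; [case: rN'|rewrite andbF].
    have : #|[pred l | X l]| = #|[pred l | (pos l < p) && X l]| +
        #|[pred l | X l && ((if pos l < p then rho l else N) == N) && ~~ (pos l < p)]|.
      rewrite (@card_split X (fun l => pos l < p)); congr (_ + _); apply: eq_card => l; rewrite !inE.
        by rewrite andbC.
      by case: ltnP; rewrite ?andbF // eqxx !andbT.
    by rewrite cp -sumX => /addnI.
  rewrite /m'; case: (ltngtP r N) => [_|h|->]; rewrite ?addn0 //.
  by rewrite mN.
case: ltnP => pl; case: ltnP => pl' //.
- by apply: mono; rewrite //= ?pl ?pl'.
- apply: ltnW; rewrite ltnNge; apply/negP => Nr.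
  have : #|[pred l0 | (pos l0 < p) && X l0 && (rho l0 == rho l)]| = 0.
    by rewrite cnt /m' ltnNge Nr.
  by move=> /(@card0_eq _ _) /(_ l); rewrite !inE pl Xl eqxx.
- by have := leq_ltn_trans pl (ltn_trans ll' pl'); rewrite ltnn.
Qed.

(** The first [t] rows of [rho'] are contained in those of [rho], which are not
    allowed more entries. *)
Lemma tight_rows (L : nat -> nat) rho rho' t :
  #|[pred l | rho' l < t]| = L t -> dominated L rho -> (forall l, rho l <= rho' l) ->
  forall l, (rho l < t) = (rho' l < t).
Proof.
move=> tight dom le l; apply/idP/idP; last exact: leq_ltn_trans.
have sub : [pred l | rho' l < t] \subset [pred l | rho l < t].
  by apply/fintype.subsetP => l'; rewrite !inE; apply: leq_ltn_trans.
have : [pred l | rho' l < t] =i [pred l | rho l < t].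
  by apply/subset_cardP => //; apply/eqP; rewrite eqn_leq subset_leq_card //= tight dom.
by move=> /(_ l); rewrite !inE => ->.
Qed.

(** By tightness [i] is below row [u] in [rho] as well.  When it comes there must
    be an entry in row [u] in the first case, and strictly more entries in row
    [u] than in row [u + 1] in the second. *)
Lemma tight_block (L : nat -> nat) rho rho' i u :
  lattice pos rho -> dominated L rho -> (forall l, rho l <= rho' l) ->
  #|[pred l | rho' l < u.+1]| = L u.+1 -> u < rho' i ->
  #|[pred l | (pos l < pos i) && (rho' l == u)]| = 0 \/
  (rho' i = u.+1 /\
   #|[pred l | (pos l < pos i) && (rho' l == u)]| <=
   #|[pred l | (pos l < pos i) && (rho' l == u.+1)]|) -> False.
Proof.
move=> lat dom le tight ui.
have tr := tight_rows tight dom le.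
have riu : u < rho i by rewrite ltnNge -ltnS tr -leqNgt.
have sub_u : #|[pred l | (pos l < pos i) && (rho l == u)]| <=
             #|[pred l | (pos l < pos i) && (rho' l == u)]|.
  apply: sub_card => l /andP[-> /eqP E] /=.
  by have := tr l; rewrite E ltnSn ltnS eqn_leq => /esym -> /=; rewrite -E le.
case=> [none|[ri' le_rows]].
  have chain d : d <= rho i ->
      0 < #|[pred l | (pos l < (pos i).+1) && (rho l == rho i - d)]|.
    elim: d => [|d IHd] dr.
      by apply/card_gt0P; exists i; rewrite inE ltnSn subn0 eqxx.
    apply: leq_trans (IHd (ltnW dr)) _.
    rewrite (_ : rho i - d = (rho i - d.+1).+1); last by rewrite subnS prednK // subn_gt0.
    by apply: lat; rewrite ltn_ord.
  have := chain (rho i - u) (leq_subr _ _); rewrite subKn ?(ltnW riu) //.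
  rewrite (@prefix_step _ _ _ (pos i) i) // (gtn_eqF riu) addn0.
  by move=> /leq_trans /(_ sub_u); rewrite none.
have ri : rho i = u.+1 by apply/eqP; rewrite eqn_leq riu andbT -ri' le.
have := lat (pos i).+1 u (ltn_ord _).
rewrite !(@prefix_step _ _ _ (pos i) i) // ri eqxx (gtn_eqF (ltnSn u)) addn0 addn1.
apply/negP; rewrite -ltnNge ltnS; apply: leq_trans sub_u (leq_trans le_rows _).
apply: sub_card => l /andP[-> /eqP E] /=.
by rewrite eqn_leq -{1}E le /= ltnNge -ltnS tr E ltnn.
Qed.

(** Row fillings adapted to an order: the entries before position [s] fill [nu]
    row by row, the entry [j] at position [s] opens a box in row [u], the entries
    of [F] have their rows prescribed by [g], and the others are filled in row by
    row, so that none of them enters row [r + 1] before row [r] has received its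
    [m r] boxes. *)
Lemma assembled_filling s j (F : pred 'I_n) (g : 'I_n -> nat) u nu m N :
  let phi x r := #|[pred l | (pos l < x) && (F l && (g l == r))]| in
  pos j = s :> nat -> (forall l, F l -> s < pos l) ->
  (forall r, nu r.+1 <= nu r) ->
  (forall r, N <= r -> nu r = 0) -> (forall r, N <= r -> m r = 0) ->
  \sum_(r < N) nu r = s -> \sum_(r < N) m r + #|[pred l | F l]| + s.+1 = n ->
  (forall x r o1 o0, s < x -> o1 <= m r.+1 -> o0 <= m r -> o1 = 0 \/ o0 = m r ->
    nu r.+1 + (r.+1 == u) + phi x r.+1 + o1 <= nu r + (r == u) + phi x r + o0) ->
  exists rho, [/\ lattice pos rho,
    forall r, #|[pred l | rho l == r]| = nu r + (r == u) + #|[pred l | F l && (g l == r)]| + m r,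
    forall l, F l -> rho l = g l, rho j = u &
    forall r, #|[pred l | (pos l < s) && (rho l == r)]| = nu r].
Proof.
move=> phi pj Fs nu_dec nuN mN sum_nu sum_m compat.
have sn : s < n by rewrite -pj.
have [|f1 [cnt1 pre1]] := @row_fill [pred l | pos l < s] nu N nuN.
  by rewrite sum_nu card_pos_lt // ltnW.
have notj l : F l -> l != j.
  by move=> /Fs; apply: contraTneq => ->; rewrite pj ltnn.
have Fs' l : F l -> (pos l < s) = false.
  by move=> /Fs h; rewrite ltnNge (ltnW h).
pose O := [pred l | (s < pos l) && ~~ F l].
have cardO : \sum_(r < N) m r = #|[pred l | O l]|.
  have := @card_split predT (fun l => pos l <= s).
  rewrite (_ : #|[pred l | predT l]| = n); last first.
    by rewrite -[RHS]card_ord; apply: eq_card => l; rewrite !inE.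
  rewrite (_ : #|[pred l | predT l && (pos l <= s)]| = s.+1); last first.
    by rewrite -[RHS](card_pos_lt pos sn); apply: eq_card => l; rewrite !inE.
  rewrite (@card_split _ F) (_ : #|[pred l | predT l && ~~ (pos l <= s) && F l]| = #|[pred l | F l]|); last first.
    apply: eq_card => l; rewrite !inE /= -ltnNge; case Fl: (F l); rewrite ?andbF //.
    by rewrite Fs.
  rewrite (_ : #|[pred l | predT l && ~~ (pos l <= s) && ~~ F l]| = #|[pred l | O l]|); last first.
    by apply: eq_card => l; rewrite !inE /= -ltnNge.
  lia.
have [f2 [cnt2 pre2]] := @row_fill O m N mN cardO.
pose rho l := if pos l < s then f1 l else if l == j then u else if F l then g l else f2 l.
have count x r : #|[pred l | (pos l < x) && (rho l == r)]| =
    #|[pred l | (pos l < x) && ((pos l < s) && (f1 l == r))]| +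
    ((s < x) && (r == u)) + #|[pred l | (pos l < x) && (F l && (g l == r))]| +
    #|[pred l | (pos l < x) && (O l && (f2 l == r))]|.
  rewrite (@card_split _ (fun l => pos l < s)) -!addnA; congr (_ + _).
    apply: eq_card => l; rewrite !inE /rho.
    by case: (ltnP (pos l) s) => _; rewrite ?andbF // andbT.
  rewrite (@card_split _ (fun l => l == j)); congr (_ + _).
    case sx: (s < x) => /=; last first.
      by apply: eq_card0 => l; rewrite !inE; case: (l =P j) => [->|]; rewrite ?andbF // pj sx.
    have rj : rho j = u by rewrite /rho pj ltnn eqxx.
    case: (r =P u) => [->|ru].
      rewrite -[RHS](card1 j); apply: eq_card => l; rewrite !inE.
      by case: (l =P j) => [->|]; rewrite ?andbF // rj pj sx ltnn eqxx.
    apply: eq_card0 => l; rewrite !inE; case: (l =P j) => [->|]; rewrite ?andbF // rj.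
    by case: (u =P r) => [E|]; [case: ru|rewrite !andbF].
  rewrite (@card_split _ F); congr (_ + _).
    apply: eq_card => l; rewrite !inE; case Fl: (F l); rewrite ?andbF //.
    by rewrite /rho Fl (negbTE (notj _ Fl)) (Fs' _ Fl) !andbT.
  apply: eq_card => l; rewrite !inE /rho.
  have [ls|sl] := ltnP (pos l) s; first by rewrite [s < pos l]ltnNge (ltnW ls) !andbF.
  have [->|lj] := eqVneq l j; first by rewrite pj ltnn !andbF.
  have sl' : s < pos l.
    rewrite ltn_neqAle sl andbT -pj; apply: contra lj => /eqP/val_inj/perm_inj ->.
    by [].
  rewrite sl' /= !andbT; case: (F l); rewrite ?andbF ?andbT //.
have pre_full r : #|[pred l | (pos l < n) && ((pos l < s) && (f1 l == r))]| = nu r.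
  by rewrite -cnt1; apply: eq_card => l; rewrite !inE ltn_ord.
exists rho.
have total r : #|[pred l | rho l == r]| =
    nu r + (r == u) + #|[pred l | F l && (g l == r)]| + m r.
  have := count n r; rewrite pre_full sn /=.
  rewrite (_ : #|[pred l | (pos l < n) && (rho l == r)]| = #|[pred l | rho l == r]|); last first.
    by apply: eq_card => l; rewrite !inE ltn_ord.
  rewrite (_ : #|[pred l | (pos l < n) && (F l && (g l == r))]| = #|[pred l | F l && (g l == r)]|); last first.
    by apply: eq_card => l; rewrite !inE ltn_ord.
  rewrite (_ : #|[pred l | (pos l < n) && (O l && (f2 l == r))]| = m r); last first.
    by rewrite -cnt2; apply: eq_card => l; rewrite !inE ltn_ord.
  by [].
split=> //; first last.
- move=> r; rewrite -cnt1; apply: eq_card => l; rewrite !inE /rho.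
  by case: ltnP.
- by rewrite /rho pj ltnn eqxx.
- by move=> l Fl; rewrite /rho Fl (negbTE (notj _ Fl)) (Fs' _ Fl).
move=> x r xn; rewrite !count.
have Ox r' : #|[pred l | (pos l < x) && (O l && (f2 l == r'))]| <= m r'.
  by rewrite -cnt2; apply: sub_card => l /andP[].
have [xs|sx] := leqP x s.
  have F0 r' : #|[pred l | (pos l < x) && (F l && (g l == r'))]| = 0.
    apply: eq_card0 => l; rewrite !inE; case Fl: (F l); rewrite ?andbF //.
    by rewrite ltnNge (leq_trans xs) // ltnW // Fs.
  have O0 r' : #|[pred l | (pos l < x) && (O l && (f2 l == r'))]| = 0.
    apply: eq_card0 => l; rewrite !inE; case: ltnP => //= lx.
    by rewrite [s < _]ltnNge (ltnW (leq_trans lx xs)).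
  rewrite !F0 !O0 /= !addn0.
  have [->//|->] := pre1 x r.
  by apply: leq_trans (nu_dec r); rewrite -cnt1; apply: sub_card => l /andP[].
have pre_x r' : #|[pred l | (pos l < x) && ((pos l < s) && (f1 l == r'))]| = nu r'.
  rewrite -cnt1; apply: eq_card => l; rewrite !inE; case: (ltnP (pos l) s) => /= h.
    by rewrite (ltn_trans h sx).
  by rewrite andbF.
by rewrite !pre_x /=; apply: compat => //; apply: pre2.
Qed.

(** The case of a single row [u + 1] of prescribed entries. *)
Lemma adapted_filling s j (F : pred 'I_n) u nu m N :
  let mu r := nu r + m r + (r == u) + #|[pred l | F l]| * (r == u.+1) in
  pos j = s :> nat -> (forall l, F l -> s < pos l) ->
  (forall r, nu r.+1 <= nu r) -> (forall r, u = r.+1 -> nu u < nu r) ->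
  (forall r, N <= r -> nu r = 0) -> (forall r, N <= r -> m r = 0) ->
  \sum_(r < N) nu r = s -> \sum_(r < N) m r + #|[pred l | F l]| + s.+1 = n ->
  nu u.+1 + #|[pred l | F l]| <= (nu u).+1 ->
  (forall r, mu r.+1 <= mu r) -> mu u.+2 <= nu u.+1 + m u.+1 ->
  exists rho, [/\ lattice pos rho, forall r, #|[pred l | rho l == r]| = mu r,
    forall l, F l -> rho l = u.+1, rho j = u &
    forall r, #|[pred l | (pos l < s) && (rho l == r)]| = nu r].
Proof.
move=> mu pj Fs nu_dec nu_u nuN mN sum_nu sum_m Ffit mu_dec corner.
have phiE (P : pred 'I_n) r : #|[pred l | P l && (F l && (u.+1 == r))]| =
    #|[pred l | P l && F l]| * (r == u.+1).
  rewrite eq_sym; case: (r == u.+1); rewrite ?muln1 ?muln0.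
    by apply: eq_card => l; rewrite !inE andbT.
  by apply: eq_card0 => l; rewrite !inE !andbF.
have [//|rho [lat rows Frow rj pre]] := @assembled_filling s j F (fun=> u.+1) u nu m N
  pj Fs nu_dec nuN mN sum_nu sum_m; last first.
  exists rho; split=> // r; rewrite rows /mu.
  have -> : #|[pred l | F l && (u.+1 == r)]| = #|[pred l | F l]| * (r == u.+1) by exact: (phiE predT).
  by rewrite addnAC [X in X + _]addnAC.
move=> x r o1 o0 sx h1 h0 hp; rewrite !phiE.
have Fx : #|[pred l | (pos l < x) && F l]| <= #|[pred l | F l]|.
  by apply: sub_card => l /andP[].
have := nu_dec r; have := mu_dec r; rewrite /mu.
move: (#|[pred l | (pos l < x) && F l]|) Fx => fx Fx md nd.
have [ru|ru] := eqVneq r u.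
  rewrite ru in hp h1 h0 nd md *; move: md Ffit; rewrite eqSS eqxx (gtn_eqF (ltnSn u)) (ltn_eqF (ltnSn u)) !muln1 !muln0.
  by case: hp => ->; lia.
rewrite eqSS (negbTE ru) muln0 in md *.
have [ru'|ru'] := eqVneq r u.+1.
  rewrite ru' in hp h1 h0 nd md *; move: corner; rewrite /mu (gtn_eqF (leqnSn u.+1)).
  by rewrite (gtn_eqF (ltnSn u.+1)) muln0 muln1; case: hp => ->; lia.
rewrite (negbTE ru') muln0 in md.
have [ur|ur] := eqVneq r.+1 u.
  rewrite ur in hp h1 nd md *; rewrite eqxx in md *; have := nu_u r (esym ur).
  by case: hp => ->; lia.
by rewrite (negbTE ur) in md; case: hp => ->; lia.
Qed.

End Fill.

Section Intervals.
Local Open Scope nat_scope.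

(** Starting from [al], the first row that is not yet full can be incremented
    until the size is [s]. *)
Lemma partition_between (al be : nat -> nat) N s :
  (forall r, al r.+1 <= al r) -> (forall r, be r.+1 <= be r) ->
  (forall r, al r <= be r) -> (forall r, N <= r -> be r = 0) ->
  \sum_(r < N) al r <= s <= \sum_(r < N) be r ->
  exists nu, [/\ forall r, nu r.+1 <= nu r, forall r, al r <= nu r <= be r &
    \sum_(r < N) nu r = s].
Proof.
move=> al_dec be_dec ab beN /andP[]; elim: s => [|s IH] als sbe.
  by exists al; split=> // [r|]; [rewrite leqnn ab|apply/eqP; rewrite -leqn0].
move: als; rewrite leq_eqVlt => /orP[/eqP als|als].
  by exists al; split=> // r; rewrite leqnn ab.
have [|nu [nu_dec nu_bd sum_nu]] := IH als; first exact: ltnW.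
have ex : exists r, nu r < be r.
  apply: contrapT => no; move: sbe; rewrite -sum_nu ltnNge => /negP; apply.
  by apply: leq_sum => r _; rewrite leqNgt; apply/negP => h; apply: no; exists r.
case: (ex_minnP ex) => r rlt rmin {ex}.
have rN : r < N by rewrite ltnNge; apply/negP => /beN E; rewrite E in rlt.
exists (fun r' => nu r' + (r' == r)); split.
- move=> r'; have := nu_dec r'; have [E|_] := eqVneq r'.+1 r; last first.
    by rewrite addn0 => h; apply: leq_trans h (leq_addr _ _).
  have /andP[_ h1] := nu_bd r'.
  have h2 : ~~ (nu r' < be r') by apply/negP => /rmin; rewrite -E ltnn.
  have := be_dec r'; rewrite E ltn_eqF -?E // E; lia.
- move=> r'; have /andP[h1 h2] := nu_bd r'; have [->|_] := eqVneq r' r.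
    by rewrite addn1 rlt andbT (leq_trans _ (leqnSn _)) //; case/andP: (nu_bd r).
  by rewrite addn0 h1.
- rewrite big_split /= sum_nu -[RHS]addn1; congr (_ + _).
  rewrite (bigD1 (Ordinal rN)) //= eqxx big1 // => r' /negbTE.
  by rewrite -val_eqE /= => ->.
Qed.

Lemma sum_split3 (f : nat -> nat) u b :
  \sum_(r < u + 2 + b) f r =
  \sum_(r < u) f r + f u + f u.+1 + \sum_(r < b) f (u.+2 + r).
Proof.
elim: b => [|b IH].
  by rewrite addn0 addn2 !big_ord_recr big_ord0 addn0.
by rewrite addnS big_ord_recr IH [in RHS]big_ord_recr /= -addnA addn2.
Qed.

End Intervals.

Section Rows.
Variables (n : nat) (la : seq nat).
Hypothesis la_part : is_partition n la.
Implicit Type rho : 'I_n -> nat.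
Local Open Scope nat_scope.

Lemma card_rows rho t : #|[pred l | rho l < t]| = \sum_(r < t) #|[pred l | rho l == r]|.
Proof.
elim: t => [|t IH]; first by rewrite big_ord0 eq_card0.
by rewrite card_below IH big_ord_recr.
Qed.

Lemma rows_dominated rho :
  (forall r, r < size la -> #|[pred l | rho l == r]| <= nth 0 la r) ->
  dominated (part_sum la) rho.
Proof.
move=> h t; have [tla|lat] := leqP t (size la); last first.
  by rewrite (part_sum_full la_part (ltnW lat)) -[X in _ <= X]card_ord max_card.
by rewrite card_rows; apply: leq_sum => r _; rewrite h // (leq_trans (ltn_ord r)).
Qed.

Lemma rows_tight rho t :
  (forall r, r < t -> #|[pred l | rho l == r]| = nth 0 la r) ->
  #|[pred l | rho l < t]| = part_sum la t.
Proof. by move=> h; rewrite card_rows; apply: eq_bigr => r _; rewrite h. Qed.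

End Rows.

Local Ltac case_ifs := repeat match goal with
  |- context [if (?a < ?b)%N then _ else _] => case: (ltnP a b) => ?
  end.

Section Separation.
Variables (n : nat) (la : seq nat).
Hypothesis la_part : is_partition n la.
Hypothesis la_pos : forall r, (r < size la)%N -> (0 < nth 0 la r)%N.
Variables (pos pos' : 'S_n) (s : nat) (i j : 'I_n).
Hypothesis agree : forall l, (pos l < s)%N || (pos' l < s)%N -> pos l = pos' l.
Hypotheses (pi : pos i = s :> nat) (pj : pos' j = s :> nat) (ij : i != j).
Local Open Scope nat_scope.
Local Notation L := (part_sum la).

(** When [pos] and [pos'] are the orders of the variables for two weights, such a
    [rho'] is an obstruction to the equality of the initial ideals. *)
Definition separates rho' := [/\ lattice pos' rho', dominated L rho' &
  forall rho, lattice pos rho -> dominated L rho -> (forall l, rho l <= rho' l) -> False].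

Lemma prefix_agree l : (pos l < s) = (pos' l < s).
Proof.
by apply/idP/idP => h; have := @agree l; rewrite h ?orbT => /(_ isT) E; rewrite ?E // -?E.
Qed.

Lemma after_prefix l : l != j -> ~~ (pos l < s) -> s < pos' l.
Proof.
rewrite prefix_agree -leqNgt leq_eqVlt => lj /orP[/eqP E|//].
case/eqP: lj; apply: (@perm_inj _ pos'); apply: val_inj.
by rewrite /= pj -E.
Qed.

Lemma after_i : s < pos' i.
Proof. by rewrite after_prefix // pi ltnn. Qed.

Let la_dec r : nth 0 la r.+1 <= nth 0 la r.
Proof. exact: (part_noninc la_part). Qed.

Let L_le t : L t <= n.
Proof. exact: (part_sum_le la_part). Qed.

(** Here [nu] has equal rows [u] and [u + 1] of length [c > 0]; the entry [j] and
    then [i] extend them, which is impossible in the order of [pos], where [i]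
    comes first.  The rows below are shortened to a column to allow every size [s]
    of the prefix. *)
Lemma separate_thick u : u.+1 < size la -> 2 <= nth 0 la u.+1 -> u.+1.*2 <= s ->
  s + 2 + nth 0 la u <= n + nth 0 la u.+1 -> exists rho', separates rho'.
Proof.
move=> ula la2 us sn; set lu := nth 0 la u.+1 in la2 sn *.
have Lu : L u.+2 <= n := L_le _.
have lou t : t <= u.+1 -> t * lu <= L t.
  elim: t => [|t IHt] tu; first by rewrite mul0n.
  rewrite part_sumS mulSn addnC leq_add ?IHt //; first exact: ltnW.
  by apply: (part_noninc la_part); apply: ltnW.
(* The sizes reached by the partitions [nu] form an interval for every [c]; the
   largest [c] for which the interval starts before [s] is chosen. *)
have [c [c_gt0 clu starts ends]] : exists c, [/\ 0 < c, c < lu,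
    u * c.+1 + c.*2 <= s & s < L u + (n - L u.+1) + c].
  have ex : exists c, (c < lu) && (u * c.+1 + c.*2 <= s).
    by exists 1; rewrite la2 /=; lia.
  have bd c : (c < lu) && (u * c.+1 + c.*2 <= s) -> c <= lu by case/andP => /ltnW.
  case: (ex_maxnP ex bd) => c /andP[clu starts] cmax.
  exists c; split=> //.
    by apply: cmax; rewrite la2 /=; lia.
  have [last|notlast] := leqP lu c.+1.
    move: sn Lu; rewrite !part_sumS -/lu; lia.
  have : ~~ (u * c.+2 + c.+1.*2 <= s).
    by apply/negP => h; have := cmax c.+1; rewrite notlast h ltnn => /(_ isT).
  rewrite -ltnNge => /leq_trans; apply.
  have h1 : u * c.+2 <= L u by apply: leq_trans (lou u (leqnSn u)); rewrite leq_mul2l notlast orbT.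
  move: Lu; rewrite part_sumS -/lu; lia.
pose b := n - L u.+1 - c.+1.
have bE : L u.+1 + c.+1 + b = n.
  by rewrite /b; move: Lu; rewrite part_sumS -/lu; lia.
pose al r := if r < u then c.+1 else if r < u.+2 then c else 0.
pose be r := if r < u then nth 0 la r else if r < u.+2 then c else if r < u + 2 + b then 1 else 0.
pose mu0 r := if r < u.+1 then nth 0 la r else if r == u.+1 then c.+1 else if r < u + 2 + b then 1 else 0.
have luu : lu <= nth 0 la u by apply: la_dec.
have u_ge r : r < u -> lu <= nth 0 la r.
  by move=> ru; apply: (part_noninc la_part); apply: ltnW; apply: leq_trans ru _.
have al3 : al u = c /\ al u.+1 = c by rewrite /al !ltnn; split=> //; case_ifs; lia.
have be3 : be u = c /\ be u.+1 = c by rewrite /be !ltnn; split=> //; case_ifs; lia.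
have mu3 : mu0 u = nth 0 la u /\ mu0 u.+1 = c.+1.
  by rewrite /mu0 ltnSn ltnn eqxx.
have mu_tail : mu0 u.+2 <= 1.
  by rewrite /mu0 (gtn_eqF (ltnSn u.+1)) (ltnNge u.+2) (ltnW (ltnSn u.+1)) /=; case: ifP.
have mu_dec r : mu0 r.+1 <= mu0 r.
  have [->|ru] := eqVneq r u; first by rewrite mu3.1 mu3.2; lia.
  have [->|ru1] := eqVneq r u.+1; first by rewrite mu3.2 (leq_trans mu_tail).
  have dr := la_dec r; rewrite /mu0 eqSS (negbTE ru) (negbTE ru1).
  by clear -ru ru1 dr; case_ifs; lia.
have mu_le r : r < size la -> mu0 r <= nth 0 la r.
  move=> rla; have [->|ru1] := eqVneq r u.+1; first by rewrite mu3.2.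
  have pr := la_pos rla; rewrite /mu0 (negbTE ru1).
  by clear -pr; case_ifs; lia.
have sum_al : \sum_(r < u + 2 + b) al r = u * c.+1 + c.*2.
  rewrite sum_split3 al3.1 al3.2 (eq_bigr (fun=> c.+1)) => [|r _]; last by rewrite /al ltn_ord.
  rewrite [X in _ + X]big1 => [|r _]; last by rewrite /al; case_ifs; lia.
  by rewrite sum_nat_const card_ord; lia.
have sum_be : \sum_(r < u + 2 + b) be r = L u + c.*2 + b.
  rewrite sum_split3 be3.1 be3.2 (eq_bigr (fun r : 'I_u => nth 0 la r)) => [|r _].
    rewrite [X in _ + X](eq_bigr (fun=> 1)) => [|r _].
      by rewrite sum_nat_const card_ord muln1 -/(L u); lia.
    by rewrite /be; have := ltn_ord r; case_ifs; lia.
  by rewrite /be ltn_ord.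
have sum_mu : \sum_(r < u + 2 + b) mu0 r = n.
  rewrite sum_split3 mu3.1 mu3.2 (eq_bigr (fun r : 'I_u => nth 0 la r)) => [|r _].
    rewrite [X in _ + X](eq_bigr (fun=> 1)) => [|r _].
      by rewrite sum_nat_const card_ord muln1 -part_sumS bE.
    by rewrite /mu0; have := ltn_ord r; case: eqP; case_ifs; lia.
  by rewrite /mu0 ltnS (ltnW (ltn_ord r)).
have [|||||nu [nu_dec nu_bd sum_nu]] := @partition_between al be (u + 2 + b) s.
- by move=> r; rewrite /al; case_ifs; lia.
- move=> r; rewrite /be; have := la_dec r; have := u_ge r.
  by case_ifs; lia.
- by move=> r; rewrite /al /be; have := u_ge r; case_ifs; lia.
- by move=> r; rewrite /be; case_ifs; lia.
- rewrite sum_al sum_be starts /=; move: ends bE; rewrite part_sumS; lia.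
have nu_u : nu u = c by have := nu_bd u; rewrite al3.1 be3.1; lia.
have nu_u1 : nu u.+1 = c by have := nu_bd u.+1; rewrite al3.2 be3.2; lia.
pose m r := mu0 r - nu r - (r == u) - (r == u.+1).
have mE r : nu r + m r + (r == u) + (r == u.+1) = mu0 r.
  have := nu_bd r; rewrite /m; have [->|ru] := eqVneq r u; first by rewrite nu_u mu3.1; lia.
  have [->|ru1] := eqVneq r u.+1; first by rewrite nu_u1 mu3.2; lia.
  by rewrite /be /mu0 (negbTE ru1); case_ifs; lia.
have nuN r : u + 2 + b <= r -> nu r = 0.
  by move=> h; have := nu_bd r; rewrite /be; case_ifs; lia.
have mN r : u + 2 + b <= r -> m r = 0.
  by move=> h; have := mE r; rewrite nuN // /mu0; case: (r =P u.+1); case_ifs; lia.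
have cardF : #|[pred l | pred1 i l]| = 1 by rewrite -(card1 i); apply: eq_card.
have [|||||||||||rho [lat rows Fi rj pre]] := @adapted_filling n pos' s j (pred1 i) u nu m (u + 2 + b).
- exact: pj.
- by move=> l /eqP ->; exact: after_i.
- exact: nu_dec.
- by move=> r ur; have := nu_bd r; rewrite nu_u /al ur ltnSn; lia.
- exact: nuN.
- exact: mN.
- exact: sum_nu.
- have : \sum_(r < u + 2 + b) (nu r + m r + (r == u :> nat) + (r == u.+1 :> nat)) = n.
    by rewrite -sum_mu; apply: eq_bigr => r _; rewrite mE.
  rewrite !big_split /= sum_nu cardF; move: (\sum_(r < u + 2 + b) m r) => M.
  have single x : x < u + 2 + b -> \sum_(r < u + 2 + b) (r == x :> nat) = 1.
    move=> xb; rewrite (bigD1 (Ordinal xb)) //= eqxx big1 // => r /negbTE.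
    by rewrite -val_eqE /= => ->.
  by rewrite !single; lia.
- by rewrite nu_u nu_u1 cardF addn1.
- by move=> r; rewrite cardF !mul1n !mE.
- by rewrite cardF mul1n mE nu_u1; apply: leq_trans mu_tail (leq_trans c_gt0 (leq_addr _ _)).
have rowsE r : #|[pred l | rho l == r]| = mu0 r by rewrite rows cardF mul1n mE.
exists rho; split=> //.
  by apply: (rows_dominated la_part) => r rla; rewrite rowsE mu_le.
move=> rho0 lat0 dom0 le0; apply: (tight_block (i := i) (u := u) lat0 dom0 le0).
- by apply: rows_tight => r ru; rewrite rowsE /mu0 ru.
- by rewrite Fi //= eqxx.
right; split; first by rewrite Fi //= eqxx.
have E r : #|[pred l | (pos l < pos i) && (rho l == r)]| = nu r.
  by rewrite -pre; apply: eq_card => l; rewrite !inE pi prefix_agree.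
by rewrite !E nu_u nu_u1.
Qed.

(** Here row [u] and the rows below are still empty when [j] comes, so [i] cannot
    be placed below row [u] in the order of [pos]; in the order of [pos'] it takes
    part in a column filling the rows from [u + 1] on. *)
Lemma separate_thin u : u.+1 < size la -> u <= s <= L u -> exists rho', separates rho'.
Proof.
move=> ula /andP[us sL].
have la_u : 0 < nth 0 la u by apply: la_pos; apply: ltnW.
have la_u1 : 0 < nth 0 la u.+1 by apply: la_pos.
have Ln := L_le u.+2.
pose B := n - L u.+1.
have B_gt0 : 0 < B by rewrite /B; move: Ln; rewrite part_sumS; lia.
have LB : L u.+1 + B = n by rewrite /B subnKC // L_le.
have sLu : s < L u.+1 by rewrite part_sumS; lia.
have ji := after_i.
pose O := [pred l | (s < pos' l) && (l != i)].
have cardO : #|[pred l | O l]| + s.+2 = n.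
  have := cardC [pred l | pos' l < s.+1].
  rewrite card_ord (card_pos_lt pos' (leq_trans ji (ltnW (ltn_ord _)))).
  rewrite (cardD1 i) !inE -ltnNge ltnS ji /=.
  rewrite (_ : #|[predD1 [predC [pred l | pos' l < s.+1]] & i]| = #|[pred l | O l]|).
    by move=> h; rewrite -[RHS]h addnC addnA addn1.
  by apply: eq_card => l; rewrite !inE -ltnNge ltnS andbC.
have [|p pn cardp] := @prefix_card n pos' O B.-1; first by rewrite -(leq_add2r s.+2) cardO; lia.
(* [Y] consists of [i] and of the first entries after [j], as many as do not fit
   in the first [u + 1] rows; they form a column below row [u]. *)
pose Y := [pred l | (l == i) || ((pos' l < p) && O l)].
have cardY : #|[pred l | Y l]| = B.
  rewrite (cardD1 i) !inE eqxx /= -[RHS]prednK // add1n; congr _.+1.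
  rewrite -cardp; apply: eq_card => l; rewrite !inE.
  by case: (l == i) => //=; rewrite !andbF.
pose rk l := #|[pred l' | (pos' l' < pos' l) && Y l']|.
have rk_lt l l' : Y l -> pos' l < pos' l' -> rk l < rk l'.
  move=> Yl ll'; rewrite /rk [X in _ < X](cardD1 l) inE ll' Yl add1n ltnS.
  apply: sub_card => l2 /andP[l2l Yl2]; rewrite !inE in Yl2 *.
  rewrite (ltn_trans l2l ll') Yl2 !andbT.
  by apply: contraTneq l2l => ->; rewrite ltnn.
have rk_inj l l' : Y l -> Y l' -> rk l = rk l' -> l = l'.
  move=> Yl Yl' E; case: (ltngtP (pos' l) (pos' l')) => [h|h|/val_inj/perm_inj //].
    by have := rk_lt _ _ Yl h; rewrite E ltnn.
  by have := rk_lt _ _ Yl' h; rewrite E ltnn.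
have rk_pred l d : Y l -> rk l = d.+1 -> exists l', [/\ Y l', pos' l' < pos' l & rk l' = d].
  move=> Yl rl; have ex : exists x, d < #|[pred l' | (pos' l' < x) && Y l']|.
    by exists (pos' l); rewrite -/(rk l) rl.
  case: (ex_minnP ex) => -[|x] dx xmin; first by rewrite eq_card0 in dx.
  have xl : x < pos' l by apply: xmin; rewrite -/(rk l) rl.
  have [z pz] := at_pos pos' (ltn_trans xl (ltn_ord _)).
  have le_d : #|[pred l' | (pos' l' < x) && Y l']| <= d.
    by rewrite leqNgt; apply/negP => /xmin; rewrite ltnn.
  exists z; rewrite pz xl; move: dx; rewrite (prefix_step _ pz).
  case Yz: (Y z); last by rewrite addn0 ltnNge le_d.
  by rewrite addn1 ltnS => h; split=> //; apply/eqP; rewrite /rk pz eqn_leq le_d h.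
pose g l := u.+1 + rk l.
pose phi x r := #|[pred l | (pos' l < x) && (Y l && (g l == r))]|.
have phi_le1 x r : phi x r <= 1.
  rewrite leqNgt; apply/negP => /card_gt1P[l [l' []]]; rewrite !inE -/(Y l) -/(Y l').
  move=> /and3P[_ Yl /eqP rl] /and3P[_ Yl' /eqP rl'] /eqP; apply; apply: rk_inj => //.
  by apply: (@addnI u.+1); rewrite -/(g l) -/(g l') rl rl'.
have phi0 x r : r <= u -> phi x r = 0.
  move=> ru; apply: eq_card0 => l; rewrite !inE; apply/negbTE; rewrite !negb_and.
  by rewrite [g l == r]gtn_eqF ?orbT // /g; lia.
have phi_dec x r : u < r -> phi x r.+1 <= phi x r.
  move=> ur; have [->//|/card_gt0P[l]] := posnP (phi x r.+1).
  rewrite inE => /and3P[lx Yl /eqP gl].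
  have [|l' [Yl' ll' rl']] := @rk_pred l (r - u.+1) Yl; first by move: gl; rewrite /g; lia.
  apply: leq_trans (phi_le1 _ _) _; apply/card_gt0P; exists l'.
  rewrite inE; apply/and3P; split=> //; first exact: ltn_trans ll' lx.
  by rewrite /g rl'; apply/eqP; lia.
pose al r := if r < u then 1 else 0.
pose be r := if r < u then nth 0 la r else 0.
have sum_part f : (forall r, r < u -> f r = be r) -> \sum_(r < u) f r = L u.
  by move=> h; apply: eq_bigr => r _; rewrite h // /be ltn_ord.
have [|||||nu [nu_dec nu_bd sum_nu]] := @partition_between al be u s.
- by move=> r; rewrite /al; clear; case_ifs; lia.
- by move=> r; rewrite /be; have := la_dec r; clear; case_ifs; lia.
- by move=> r; rewrite /al /be; case: ltnP => // ru; apply: la_pos; apply: ltn_trans ula; apply: ltnW.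
- by move=> r ru; rewrite /be ltnNge ru.
- rewrite (sum_part be) // sL andbT (eq_bigr (fun=> 1)) => [|r _]; last by rewrite /al ltn_ord.
  by rewrite sum_nat_const card_ord muln1.
have nu_hi r : u <= r -> nu r = 0.
  by move=> ur; have := nu_bd r; rewrite /be ltnNge ur /=; lia.
have nu_lo r : r < u -> 0 < nu r <= nth 0 la r.
  by move=> ru; have := nu_bd r; rewrite /al /be ru.
pose m r := if r < u.+1 then nth 0 la r - nu r - (r == u) else 0.
have mE r : r < u.+1 -> nu r + (r == u) + m r = nth 0 la r.
  rewrite /m => ru; rewrite ru; have [E|ne] := eqVneq r u.
    by rewrite E nu_hi //; lia.
  have := nu_lo r; rewrite ltn_neqAle ne -ltnS ru /= => /(_ isT); lia.
have mN r : u.+1 <= r -> m r = 0 by move=> ur; rewrite /m ltnNge ur.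
have [||||||||rho [lat rows Yrow rj pre]] := @assembled_filling n pos' s j Y g u nu m u.+1.
- exact: pj.
- by move=> l /orP[/eqP->//|/and3P[]].
- exact: nu_dec.
- by move=> r ur; apply: nu_hi; apply: ltnW.
- exact: mN.
- by rewrite big_ord_recr /= sum_nu nu_hi // addn0.
- rewrite cardY.
  have : \sum_(r < u.+1) (nu r + (r == u :> nat) + m r) = L u.+1.
    by apply: eq_bigr => r _; rewrite mE.
  rewrite !big_split /= [X in X + _ + _]big_ord_recr /= sum_nu nu_hi //.
  rewrite [X in _ + X + _](_ : _ = 1); last first.
    rewrite big_ord_recr /= eqxx big1 // => r _.
    by rewrite ltn_eqF.
  by move: LB; lia.
- move=> x r o1 o0 _ h1 h0 hp; rewrite -!/(phi _ _).
  have [ru|ur] := ltnP u r.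
    rewrite !nu_hi ?(ltnW ru) // ?(leq_trans (ltnW ru)) // (gtn_eqF ru) (gtn_eqF (leqW ru)).
    by move: h1 h0; rewrite !mN ?(leqW ru) // => h1 h0; have := phi_dec x r ru; lia.
  have [ru|ne] := eqVneq r u.
    move: h1 h0; rewrite ru !nu_hi // (gtn_eqF (ltnSn u)) mN // => h1 h0.
    by have := phi_le1 x u.+1; lia.
  have {}ur : r < u by rewrite ltn_neqAle ne.
  rewrite !phi0 ?(ltnW ur) //.
  have E0 := mE r (ltnW ur); have E1 := mE r.+1 ur; rewrite (negbTE ne) in E0 *.
  have := la_dec r; have := nu_dec r; have := nu_lo r ur.
  have [E|ne1] := eqVneq r.+1 u.
    by rewrite E eqxx nu_hi // in E1 h1 *; case: hp => ->; lia.
  by rewrite (negbTE ne1) in E1 *; case: hp => ->; lia.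
have phi_all r : #|[pred l | Y l && (g l == r)]| = phi n r.
  by apply: eq_card => l; rewrite !inE ltn_ord.
have row_lo r : r < u.+1 -> #|[pred l | rho l == r]| = nth 0 la r.
  by move=> ru; rewrite rows phi_all phi0 // addn0 mE.
exists rho; split=> //.
  apply: (rows_dominated la_part) => r rla.
  have [ru|ur] := ltnP r u.+1; first by rewrite row_lo.
  rewrite rows phi_all mN // nu_hi; last exact: ltnW.
  by rewrite gtn_eqF // !add0n addn0 (leq_trans (phi_le1 _ _)) // la_pos.
move=> rho0 lat0 dom0 le0; apply: (tight_block (i := i) (u := u) lat0 dom0 le0).
- exact: rows_tight.
- by rewrite Yrow /= ?eqxx // /g addSn ltnS leq_addr.
left; rewrite -[RHS](nu_hi u) // -pre; apply: eq_card => l.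
by rewrite !inE pi prefix_agree.
Qed.

(** With two rows and a single entry in the prefix, the contradiction comes one
    step later: for [pos] the entries in positions [1] and [2] would both be in
    row [1], below a single entry of row [0].  If [j] is one of these two, it has
    to be put in row [1] itself, and [i] below it. *)
Lemma separate_short : size la = 2 -> s = 1 -> 2 <= nth 0 la 1 -> exists rho', separates rho'.
Proof.
move=> la2 s1 la1; have la01 := la_dec 0.
have Ln : nth 0 la 0 + nth 0 la 1 = n.
  by rewrite -(part_sum_full la_part (leqnn _)) la2 /part_sum !big_ord_recr big_ord0.
have n3 : 2 < n by rewrite -Ln; lia.
have [l pl] := at_pos pos n3.
have il : i != l.
  by apply/eqP => E; move: pi; rewrite E pl s1.
have clash (rho' : 'I_n -> nat) : #|[pred x | rho' x < 1]| = L 1 -> 0 < rho' i -> rho' l = 1 ->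
    (forall r, #|[pred x | (pos' x < s) && (rho' x == r)]| = (r == 0)) ->
    forall rho, lattice pos rho -> dominated L rho -> (forall x, rho x <= rho' x) -> False.
  move=> tight ri rl pre rho lat dom le.
  have tr := tight_rows tight dom le.
  have low x : pos x = 0 :> nat -> rho x = 0.
    move=> x0; apply/eqP; rewrite -leqn0 -ltnS tr ltnS leqn0.
    have /card_gt0P[z] : 0 < #|[pred x | (pos' x < s) && (rho' x == 0)]| by rewrite pre.
    rewrite inE s1 ltnS leqn0 => /andP[/eqP z0 rz]; rewrite (_ : x = z) //.
    apply: (@perm_inj _ pos'); apply: val_inj; rewrite /= z0.
    by have := @agree x; rewrite x0 s1 => /(_ isT) <-.
  have l1 : rho l = 1.
    by apply/eqP; rewrite eqn_leq -{1}rl le lt0n -leqn0 -ltnS tr rl.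
  have at1 x : pos x = 1 :> nat -> x = i.
    by move=> x1; apply: (@perm_inj _ pos); apply: val_inj; rewrite /= x1 pi s1.
  have i1 : rho i = 1.
    have : 0 < rho i by rewrite lt0n -leqn0 -ltnS tr -leqNgt.
    case E: (rho i) => [//|r] _; congr _.+1.
    have : 0 < #|[pred x | (pos x < 2) && (rho x == r)]|.
      apply: leq_trans (lat 2 r (ltnW n3)).
      by apply/card_gt0P; exists i; rewrite inE pi s1 E eqxx.
    move=> /card_gt0P[x]; rewrite inE => /andP[].
    case px: (pos x : nat) => [|[|//]] _ /eqP rx; first by rewrite -rx low.
    by move: E; rewrite -(at1 _ px) rx => /n_Sn.
  have := lat 3 0 n3; apply/negP; rewrite -ltnNge.
  apply: (@leq_ltn_trans #|[pred x | pos x < 1]|).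
    apply: sub_card => x /andP[].
    case px: (pos x : nat) => [|[|[|x3]]] // lt3.
    - by rewrite (at1 _ px) i1.
    - by rewrite (_ : x = l) ?l1 //; apply: (@perm_inj _ pos); apply: val_inj; rewrite /= px pl.
  rewrite (card_pos_lt pos (ltnW (ltnW n3))).
  by apply/card_gt1P; exists i, l; split=> //; rewrite inE ?i1 ?l1 ?pl ?pi ?s1.
have sum2 f : \sum_(r < 2) f (r : nat) = f 0 + f 1 by rewrite !big_ord_recr big_ord0.
pose nu r : nat := (r == 0).
have nu_dec r : nu r.+1 <= nu r by [].
have nuN r : 2 <= r -> nu r = 0 by case: r.
have sum_nu : \sum_(r < 2) nu r = s by rewrite sum2 s1.
have after_l : l != j -> s < pos' l by move=> lj; rewrite after_prefix // pl s1.
have low_dom (rho : 'I_n -> nat) : #|[pred x | rho x < 1]| = L 1 -> #|[pred x | rho x < 2]| <= L 2 ->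
    dominated L rho.
  move=> h1 h2 [|[|[|t]]]; rewrite ?h1 ?h2 //; first by rewrite eq_card0.
  apply: leq_trans (max_card _) _. 
  by rewrite card_ord (part_sum_full la_part) ?la2.
have L1 : L 1 = nth 0 la 0 by rewrite /part_sum big_ord1.
have L2 : L 2 = nth 0 la 0 + nth 0 la 1 by rewrite /part_sum !big_ord_recr big_ord0.
have [lj|lj] := eqVneq l j.
  pose m r := if r == 0 then nth 0 la 0 - 1 else if r == 1 then nth 0 la 1 - 2 else 0.
  have cardF : #|[pred x | pred1 i x]| = 1 by rewrite -(card1 i); apply: eq_card.
  have mN r : 2 <= r -> m r = 0 by case: r => [|[]].
  have [|||||| rho [lat rows Fi rj pre]] :=
      @adapted_filling n pos' s j (pred1 i) 1 nu m 2 pj _ nu_dec _ nuN mN sum_nu.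
  - by move=> x /eqP ->; exact: after_i.
  - by case.
  - by rewrite sum2 cardF s1 /m /=; lia.
  - by rewrite cardF.
  - by rewrite cardF /nu /m => -[|[|[|r]]] //=; lia.
  - by rewrite cardF.
  rewrite cardF /= in rows.
  have row1 : #|[pred x | rho x < 1]| = L 1.
    by rewrite card_rows big_ord1 rows L1 /nu /m /=; lia.
  exists rho; split=> //.
    by apply: low_dom => //; rewrite card_rows !big_ord_recr big_ord0 /= !rows L2 /nu /m /=; lia.
  by apply: clash => //; rewrite ?lj // Fi /=.
pose m r := if r == 0 then nth 0 la 0 - 2 else if r == 1 then nth 0 la 1 - 2 else 0.
pose F : pred 'I_n := pred2 i l.
have cardF : #|[pred x | F x]| = 2.
  by have := card2 i l; rewrite il => <-; apply: eq_card.
have mN r : 2 <= r -> m r = 0 by case: r => [|[]].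
have [|||||| rho [lat rows Fi rj pre]] :=
    @adapted_filling n pos' s j F 0 nu m 2 pj _ nu_dec _ nuN mN sum_nu.
- by move=> x /orP[] /eqP ->; [exact: after_i|exact: after_l].
- by [].
- by rewrite sum2 cardF s1 /m /=; lia.
- by rewrite cardF.
- by rewrite cardF /nu /m => -[|[|[|r]]] //=; lia.
- by rewrite cardF.
rewrite cardF /= in rows.
have row1 : #|[pred x | rho x < 1]| = L 1.
  by rewrite card_rows big_ord1 rows L1 /nu /m /=; lia.
exists rho; split=> //.
  by apply: low_dom => //; rewrite card_rows !big_ord_recr big_ord0 /= !rows L2 /nu /m /=; lia.
have Fi1 : rho i = 1 by apply: Fi; rewrite /F /= eqxx.
have Fl1 : rho l = 1 by apply: Fi; rewrite /F /= eqxx orbT.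
by apply: clash => //; rewrite Fi1.
Qed.

Variable k : nat.
Hypothesis la_size : 1 < size la.
Hypothesis la_gap : forall t, 0 < t -> t < size la -> nth 0 la t + k <= nth 0 la t.-1.
Hypothesis gap_attained : exists2 t, 0 < t < size la & nth 0 la t + k = nth 0 la t.-1.

(** A row [t] shorter than the previous one by exactly [k] leaves room for the
    thick filling as long as [s + k + 2 <= n].  When [s] is too small for that, a
    higher row is used, where the rows are so long that the larger gap does no
    harm.  If row [t] has only one box, [s] is small enough for the thin filling.
    What is left are two rows and [s = 1]. *)
Lemma separation : s + k.+2 <= n -> exists rho', separates rho'.
Proof.
move=> sn; case E: (size la) la_size => [|[|m]] // _.
have la_dec2 a b : a <= b -> nth 0 la b <= nth 0 la a by exact: (part_noninc la_part).
have L_ge t : t <= m.+2 -> t <= L t.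
  elim: t => [//|t IHt] tm; rewrite part_sumS -addn1 leq_add ?IHt ?la_pos ?E //.
  exact: ltnW.
have [sLm|Lms] := leqP s (L m).
  apply: (@separate_thin (minn s m)); first by rewrite E !ltnS geq_minr.
  by rewrite geq_minl /=; case: (leqP s m) => // sm; apply: L_ge; lia.
have la_pos2 r : r < m.+2 -> 0 < nth 0 la r by rewrite -E; apply: la_pos.
have Ln : L m + nth 0 la m + nth 0 la m.+1 = n.
  by rewrite -!part_sumS -E (part_sum_full la_part).
case: gap_attained => t; rewrite E => /andP[t_gt0 tm] gap.
have t2 : 2 <= nth 0 la t.
  have pt : 0 < nth 0 la t by exact: la_pos2.
  rewrite leqNgt; apply/negP => t1.
  have lm := la_dec2 t m.+1 tm; have pm := la_pos2 m.+1 (ltnSn _).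
  have [tm1|tm1] := eqVneq t m.+1; first by move: gap; rewrite tm1 /= in t1 pt *; lia.
  have tm2 : t < m.+1 by lia.
  have := @la_gap t.+1 isT; rewrite E => /(_ tm2).
  have := la_dec2 t.-1 m; have := la_pos2 t.+1 tm2; lia.
have [s1|s2] := leqP s 1.
  have m0 : m = 0 by have := L_ge m; lia.
  apply: separate_short; rewrite ?E ?m0 //; first by lia.
  by move: t2; rewrite (_ : t = 1) //; lia.
have [ts|st] := leqP t.*2 s.
  by apply: (@separate_thick t.-1); rewrite ?prednK ?E //; lia.
set v := s./2; have v_gt0 : 0 < v by rewrite /v; lia.
have vt : v < t by rewrite /v; lia.
have v2 : 2 <= nth 0 la v by apply: leq_trans t2 (la_dec2 _ _ (ltnW vt)).
have L_ge2 x : x <= v -> x * 2 <= L x.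
  elim: x => [//|x IHx] xv; rewrite part_sumS mulSn addnC leq_add ?IHx //; first exact: ltnW.
  by apply: leq_trans v2 (la_dec2 _ _ (ltnW xv)).
have v1 : 2 <= nth 0 la v.+1 by apply: leq_trans t2 (la_dec2 _ _ vt).
have := L_le v.+2; rewrite !part_sumS -{1}(prednK v_gt0) part_sumS => Lv.
have := L_ge2 v.-1 (leq_pred _) => {}L_ge2.
apply: (@separate_thick v.-1); rewrite ?prednK ?E //; first by lia.
  by rewrite /v; lia.
suff : s <= v.*2.+1 by lia.
by rewrite /v; lia.
Qed.

End Separation.

Section DetectedInitial.
Variables (R : realType) (K : fieldType) (n k : nat) (la : seq nat).
Hypothesis la_part : is_partition n la.
Hypothesis la_pos : forall r, (r < size la)%N -> (0 < nth 0 la r)%N.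
Hypothesis la_size : (1 < size la)%N.
Hypothesis la_gap : forall t, (0 < t)%N -> (t < size la)%N -> (nth 0 la t + k <= nth 0 la t.-1)%N.
Hypothesis gap_attained :
  exists2 t, (0 < t < size la)%N & (nth 0 la t + k)%N = nth 0%N la t.-1.
Implicit Types (w : 'rV[R]_n) (pos : 'S_n).
Local Notation I := (specht_ideal K n la).
Local Open Scope ring_scope.

(** At the first position where the two orders differ, a separating filling
    would exist. *)
Let order_agree w w' (v : 'I_n -> nat) pos pos' :
  sorts pos w v -> sorts pos' w' v ->
  initial_ideal w I = initial_ideal w' I ->
  forall s, (s + k.+1 <= n)%N ->
  forall l, (pos l < s)%N || (pos' l < s)%N -> pos l = pos' l.
Proof.
move=> hpos hpos' same; elim=> [//|s IH] sn.
have {}IH := IH (leq_trans (leqnSn _) sn).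
have sn' : (s < n)%N by apply: leq_trans sn; rewrite addSn ltnS leq_addr.
have [i pi] := at_pos pos sn'; have [j pj] := at_pos pos' sn'.
have [ij|ij] := eqVneq i j.
  rewrite -ij in pj => l; rewrite !ltnS [(pos l <= s)%N]leq_eqVlt [(pos' l <= s)%N]leq_eqVlt.
  case/orP => /orP[/eqP E|h].
  - by rewrite (_ : l = i); [apply: val_inj; rewrite /= pi pj|apply: (@perm_inj _ pos); apply: val_inj; rewrite /= E pi].
  - by apply: IH; rewrite h.
  - by rewrite (_ : l = i); [apply: val_inj; rewrite /= pi pj|apply: (@perm_inj _ pos'); apply: val_inj; rewrite /= E pj].
  - by apply: IH; rewrite h orbT.
have [|rho' [lat dom no]] := separation la_part la_pos IH pi pj ij la_size la_gap gap_attained.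
  by rewrite addnS -addSn.
have [rho [lat0 dom0 le0]] := initial_eq_lattice la_part la_gap hpos hpos' same lat dom.
by case: (no rho lat0 dom0 le0).
Qed.

(** With [x_i] first among the variables of its weight, its place in the order is
    the number of strictly lighter variables.  A detected comparison thus concerns
    one of the places where the two orders agree. *)
Lemma initial_detected w w' i j : initial_ideal w I = initial_ideal w' I ->
  detected k w i j -> detected k w' i j.
Proof.
move=> same /and3P[ij wij hi].
have [pos hpos] := weight_order w (@first_in_tie_inj n i).
have [pos' hpos'] := weight_order w' (@first_in_tie_inj n i).
have Ei := first_in_tie_pos hpos; have Ei' := first_in_tie_pos hpos'.
have sn : ((pos i).+1 + k.+1 <= n)%N by rewrite addSnnS -[X in (_ <= X)%N]Ei leq_add2l.
have agree := order_agree hpos hpos' same sn.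
have pi : pos i = pos' i by apply: agree; rewrite ltnSn.
have pij : (pos i < pos j)%N by rewrite (first_in_tie_lt hpos).
have pij' : (pos' i < pos' j)%N.
  rewrite ltnNge; apply/negP => ji; have := agree j.
  rewrite orbC ltnS pi ji => /(_ isT) E.
  by move: pij; rewrite E pi ltnNge ji.
rewrite /detected ij /=; apply/andP; split.
  by rewrite -(first_in_tie_lt hpos').
by move: Ei'; rewrite -[RHS]Ei -pi => /addnI ->.
Qed.

Lemma initial_eqP w w' : initial_ideal w I = initial_ideal w' I <->
  forall i j, detected k w i j = detected k w' i j.
Proof.
split=> [same i j|]; last exact: detected_initial.
by apply/idP/idP; apply: initial_detected.
Qed.

End DetectedInitial.

(** * Faces of the polytope *)

Section Polytope.
Variables (R : realType) (n k : nat).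
Hypothesis k_lt : (k < n)%N.
Implicit Types (w x y : 'rV[R]_n) (s : 'S_n).
Local Open Scope ring_scope.
Local Notation P := (Pi_polytope R n k).

Definition height s i : nat := minn (s i).+1 (n - k).

Definition vertex s : 'rV[R]_n := \row_i (height s i)%:R.

Lemma dotvDl x y w : dotv (x + y) w = dotv x w + dotv y w.
Proof. by rewrite -big_split; apply: eq_bigr => i _; rewrite mxE mulrDl. Qed.

Lemma dotvZl (c : R) x w : dotv (c *: x) w = c * dotv x w.
Proof. by rewrite mulr_sumr; apply: eq_bigr => i _; rewrite mxE mulrA. Qed.

Lemma vertex_in s : P (vertex s).
Proof.
apply: sub_gen_smallest; exists s => //.
by apply/rowP => i; rewrite !mxE.
Qed.

Lemma Pi_convex_polytope : convex_polytope P.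
Proof.
rewrite /Pi_polytope /perm_polytope; set V := (V in convex_hull V).
exists V => //; split; first by apply: finite_image; exact: finite_finset.
by rewrite /V; eexists; exists 1%g.
Qed.

Lemma polytope_sub (D : set 'rV[R]_n) :
  (forall x y (t : R), D x -> D y -> 0 < t -> t < 1 -> D (t *: x + (1 - t) *: y)) ->
  (forall s, D (vertex s)) -> forall x, P x -> D x.
Proof.
move=> cD vD; apply: smallest_sub.
  apply/convex_setW => x y /set_mem Dx /set_mem Dy t t0 t1; apply/mem_set.
  exact: cD.
by move=> _ [s _ <-]; rewrite (_ : \row_i _ = vertex s) //; apply/rowP => i; rewrite !mxE.
Qed.

Definition vertex_max w s := forall s', dotv (vertex s') w <= dotv (vertex s) w.

Lemma vertex_max_ex w : exists s, vertex_max w s.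
Proof.
have [s _ smax] := @arg_maxP _ R 'S_n 1%g xpredT (fun s => dotv (vertex s) w) isT.
by exists s => s'; apply: smax.
Qed.

Lemma dotv_le w c : (forall s, dotv (vertex s) w <= c) -> forall x, P x -> dotv x w <= c.
Proof.
move=> h; apply: polytope_sub => // x y t hx hy t0 t1.
rewrite dotvDl !dotvZl; nra.
Qed.

Lemma max_face_vertex w s : max_face P w (vertex s) <-> vertex_max w s.
Proof.
split=> [[_ h] s'|h]; first by apply: h; apply: vertex_in.
by split; [exact: vertex_in|exact: dotv_le].
Qed.

(** A point of the polytope can only maximize [w] as a mixture of vertices
    maximizing [w]: the points of the polytope which, if they maximize [w], also
    maximize [w'] form a convex set. *)
Lemma max_face_sub w w' : (forall s, vertex_max w s -> vertex_max w' s) <->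
  (forall x, max_face P w x -> max_face P w' x).
Proof.
split=> [sub|sub s]; last by move=> /max_face_vertex/sub/max_face_vertex.
have [s0 m0] := vertex_max_ex w; have m0' := sub _ m0.
have mixed : forall x, P x -> dotv x w = dotv (vertex s0) w -> dotv x w' = dotv (vertex s0) w'.
  pose D : set 'rV[R]_n := fun x => [/\ dotv x w <= dotv (vertex s0) w,
    dotv x w' <= dotv (vertex s0) w' &
    dotv x w = dotv (vertex s0) w -> dotv x w' = dotv (vertex s0) w'].
  suff PD x : P x -> D x by move=> x /PD[].
  apply: (@polytope_sub D) => {x} [x y t [x1 x2 x3] [y1 y2 y3] t0 t1|s].
    by rewrite /D !dotvDl !dotvZl; split; nra.
  split; [exact: m0|exact: m0'|move=> E].
  have ms : vertex_max w s by move=> s'; rewrite E.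
  by apply/eqP; rewrite eq_le m0' sub.
move=> x [Px xmax]; split=> // y Py.
rewrite (mixed x) //; first exact: dotv_le.
apply/eqP; rewrite eq_le xmax ?andbT; last exact: vertex_in.
exact: dotv_le.
Qed.

(** Otherwise exchanging the two coordinates would increase the value. *)
Lemma vertex_max_comonotone w s i j : vertex_max w s -> w 0 i < w 0 j ->
  (height s i <= height s j)%N.
Proof.
move=> smax wij; have ij : i != j by apply: contraTneq wij => ->; rewrite ltxx.
rewrite leqNgt; apply/negP => hji.
have := smax (tperm i j * s)%g; apply/negP; rewrite -ltNge /dotv.
rewrite (bigD1 i) // (bigD1 j) 1?eq_sym //= [X in _ < X](bigD1 i) // [X in _ < _ + X](bigD1 j) 1?eq_sym //=.
have -> : \sum_(l < n | (l != i) && (l != j)) vertex (tperm i j * s)%g 0 l * w 0 l =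
    \sum_(l < n | (l != i) && (l != j)) vertex s 0 l * w 0 l.
  by apply: eq_bigr => l /andP[li lj]; rewrite !mxE /height permM tpermD // eq_sym.
rewrite !addrA ltrD2r !mxE /height !permM tpermL tpermR -!/(height _ _).
have : (height s j)%:R < (height s i)%:R :> R by rewrite ltr_nat.
by move: (_%:R) (_%:R) => a b ab; nra.
Qed.

Let height_sum s i : height s i = (\sum_(t < n - k) (t <= s i))%N.
Proof.
rewrite /height; elim: (n - k)%N => [|m IH]; first by rewrite big_ord0 minn0.
by rewrite big_ord_recr -IH /=; lia.
Qed.

(** Layer by layer: the coordinates of height greater than [t] are [n - t] in
    number and none of them has a smaller weight than any other coordinate, so
    their weights have the largest possible sum. *)
Lemma comonotone_vertex_max w s :
  (forall i j, w 0 i < w 0 j -> (height s i <= height s j)%N) -> vertex_max w s.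
Proof.
move=> mono s'.
have layers s0 : dotv (vertex s0) w =
    \sum_(t < n - k) \sum_i (t <= s0 i)%N%:R * w 0 i.
  rewrite exchange_big; apply: eq_bigr => i _.
  by rewrite !mxE height_sum natr_sum mulr_suml.
rewrite !layers; apply: ler_sum => t _.
have tn : (t < n)%N by apply: leq_trans (ltn_ord t) (leq_subr _ _).
have [z pz] := at_pos s tn.
have [|i0 hi0 imin] := @arg_minP _ R 'I_n z (fun i => (t <= s i)%N) (fun i => w 0 i).
  by rewrite pz.
(* Between the weights in the layer and those outside of it. *)
pose c := w 0 i0.
have shift s0 : \sum_i (t <= s0 i)%N%:R * w 0 i =
    \sum_i (t <= s0 i)%N%:R * (w 0 i - c) + \sum_(i : 'I_n) (t <= i)%N%:R * c.
  rewrite [X in _ + X](reindex_inj (@perm_inj _ s0)) -big_split /=.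
  by apply: eq_bigr => i _; rewrite -mulrDr subrK.
rewrite !shift lerD2r; apply: ler_sum => i _.
have [ti|it] := leqP t (s i).
  have : c <= w 0 i := imin i ti.
  by case: (t <= s' i)%N; rewrite ?mul1r ?mul0r //= subr_ge0.
have : w 0 i <= c.
  rewrite leNgt; apply/negP => /mono; rewrite /height leqNgt; apply/negP; rewrite negbK.
  by have := ltn_ord t; move: it hi0; lia.
by case: (t <= s' i)%N; rewrite ?mul1r ?mul0r //= subr_le0.
Qed.

Local Notation D := (detected k).

(** The face maximizing [w] shows the comparison of [x_i] with [x_j] exactly if
    one of its vertices gives [x_j] a larger coordinate, and this is impossible
    as soon as [x_i] is among the [k + 1] variables with the largest coordinate. *)
Lemma detected_vertex w i j : D w i j <->
  i != j /\ exists2 s, vertex_max w s & (height s i < height s j)%N.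
Proof.
split=> [/and3P[ij wij hi]|[ij [s smax hij]]].
  split=> //; have [s hs] := weight_order w (@first_in_tie_inj n i); exists s.
    apply: comonotone_vertex_max => l l' ll'.
    have : (s l < s l')%N by rewrite hs ll'.
    by rewrite /height; lia.
  have sij : (s i < s j)%N by rewrite (first_in_tie_lt hs).
  have := first_in_tie_pos hs.
  by move: sij hi (k_lt); rewrite /height; lia.
have wij : w 0 i <= w 0 j.
  rewrite leNgt; apply/negP => /(vertex_max_comonotone smax).
  by rewrite leqNgt hij.
rewrite /detected ij wij /=.
have si : (s i < n - k.+1)%N by move: hij; rewrite /height; lia.
have : (n - (s i) <= heavier w i)%N.
  rewrite -[X in (X - _)%N]card_ord -(cardC [pred l | (s l < s i)%N]) card_pos_lt; last exact: ltnW.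
  rewrite addKn; apply: sub_card => l; rewrite !inE -leqNgt leq_eqVlt => /orP[/eqP/val_inj/perm_inj->//|sil].
  rewrite leNgt; apply/negP => /(vertex_max_comonotone smax); rewrite /height.
  by move: si sil; lia.
by move: si; lia.
Qed.

Lemma detected_max_face w w' : (forall i j, D w i j -> w' 0 i <= w' 0 j) <->
  (forall x, max_face P w x -> max_face P w' x).
Proof.
split=> [sub|/max_face_sub sub i j].
  apply/max_face_sub => s smax; apply: comonotone_vertex_max => i j.
  apply: contraTT; rewrite -ltnNge -leNgt => hji; apply: sub.
  apply/detected_vertex; split; last by exists s.
  by apply: contraTneq hji => ->; rewrite ltnn.
move=> /detected_vertex[ij [s /sub smax hij]].
rewrite leNgt; apply/negP => /(vertex_max_comonotone smax).
by rewrite leqNgt hij.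
Qed.

End Polytope.

(** * The two fans *)

Section Cones.
Variables (R : realType) (n k : nat).
Implicit Types (w : 'rV[R]_n).
Local Open Scope ring_scope.
Local Notation D := (detected k).

Lemma detected_sub w w' : (forall i j, D w i j -> w' 0 i <= w' 0 j) ->
  forall i j, D w i j -> D w' i j.
Proof.
move=> sub i j dij; have /and3P[ij wij hi] := dij.
rewrite /detected ij sub //=; apply: leq_trans hi _; apply: sub_card => l wil.
by have [->|il] := eqVneq l i; rewrite // sub // /detected eq_sym il wil; case/and3P: dij.
Qed.

(** A strict comparison stays strict if the lighter variable is not among the
    [k + 1] heaviest; hence these remain the heaviest ones. *)
Lemma detected_perturb w w' (e : R) : 0 < e -> (forall i j, D w i j -> w' 0 i <= w' 0 j) ->
  forall i j, D w i j = D (w' + e *: w) i j.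
Proof.
move=> e0 sub i j; set w2 := w' + e *: w.
have w2E l : w2 0 l = w' 0 l + e * w 0 l by rewrite !mxE.
have sub2 i' j' : D w i' j' -> w2 0 i' <= w2 0 j'.
  move=> d; have := sub _ _ d; case/and3P: d => _ h _; rewrite !w2E => h'.
  by apply: lerD => //; rewrite ler_pM2l.
apply/idP/idP; first exact: detected_sub.
case/and3P=> ij w2ij h2.
have strict l l' : (k.+1 < heavier w l)%N -> w 0 l < w 0 l' -> w2 0 l < w2 0 l'.
  move=> hl ll'; have d : D w l l'.
    by rewrite /detected (ltW ll') hl /= andbT; apply: contraTneq ll' => ->; rewrite ltxx.
  have := sub _ _ d; rewrite !w2E => h'.
  by apply: ler_ltD => //; rewrite ltr_pM2l.
have hi : (k.+1 < heavier w i)%N.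
  rewrite ltnNge; apply/negP => hi; move: h2; rewrite ltnNge => /negP; apply.
  apply: leq_trans (card_heaviest k w); apply: sub_card => l w2il; rewrite leqNgt; apply/negP => hl.
  have wli : w 0 l < w 0 i.
    by rewrite ltNge; apply/negP => /heavier_le h; have := leq_trans hl (leq_trans h hi); rewrite ltnn.
  by have := strict _ _ hl wli; rewrite ltNge w2il.
rewrite /detected ij hi andbT leNgt; apply/negP => ji.
have hj : (k.+1 < heavier w j)%N.
  by apply: leq_trans hi _; apply: sub_card => l; apply: le_trans; apply: ltW.
by have := strict _ _ hj ji; rewrite ltNge w2ij.
Qed.

End Cones.

Section State.
Variables (R : realType) (K : fieldType) (n k : nat) (la : seq nat).
Hypothesis la_part : is_partition n la.
Hypothesis la_pos : forall r, (r < size la)%N -> (0 < nth 0 la r)%N.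
Hypothesis la_size : (1 < size la)%N.
Hypothesis la_gap : forall t, (0 < t)%N -> (t < size la)%N -> (nth 0 la t + k <= nth 0 la t.-1)%N.
Hypothesis gap_attained :
  exists2 t, (0 < t < size la)%N & (nth 0 la t + k)%N = nth 0%N la t.-1.
Hypothesis k_lt : (k < n)%N.
Implicit Types (w : 'rV[R]_n).
Local Open Scope ring_scope.
Local Open Scope classical_set_scope.
Local Notation D := (detected k).
Local Notation I := (specht_ideal K n la).
Local Notation P := (Pi_polytope R n k).

Let cellE w w' : groebner_cell I w w' <-> forall i j, D w i j = D w' i j.
Proof. exact: initial_eqP. Qed.

(** If the detected comparisons of [w] hold weakly for [w'], then [w' + d w] is in
    the cell of [w] for every [d > 0]. *)
Lemma closure_cell w :
  closure (groebner_cell I w) = [set w' | forall i j, D w i j -> w' 0 i <= w' 0 j].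
Proof.
apply/seteqP; split=> [w' cl i j d | w' sub B /nbhs_ballP[e /= e0 eB]].
  rewrite leNgt; apply/negP => ji.
  pose e := (w' 0 i - w' 0 j) / 2; have e0 : 0 < e by rewrite /e; lra.
  have [w2 [/cellE cw [_ bw]]] := cl _ (nbhsx_ballx w' _ e0).
  have /and3P[_ w2ij _] : D w2 i j by rewrite -cw.
  have := bw 0 i; have := bw 0 j; rewrite /ball /= !ltr_norml /e.
  move=> /andP[h1 h2] /andP[h3 h4]; lra.
pose M := \sum_i `|w 0 i| + 1.
have M0 : 0 < M by rewrite ltr_wpDl // sumr_ge0.
have wM i : `|w 0 i| < M.
  rewrite ltr_pwDr // (bigD1 i) //= lerDl sumr_ge0 // => l _.
pose d := e / M; have d0 : 0 < d by rewrite divr_gt0.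
exists (w' + d *: w); split; first by apply/cellE => i j; apply: detected_perturb.
apply: eB; split=> // a i; rewrite [a]ord1 /ball /= !mxE opprD addrA subrr sub0r normrN normrM gtr0_norm //.
by rewrite /d mulrAC ltr_pdivrMr // ltr_pM2l.
Qed.

Lemma normal_cone_face w :
  normal_cone P (max_face P w) = [set w' | forall i j, D w i j -> w' 0 i <= w' 0 j].
Proof. by apply/seteqP; split=> w' /(detected_max_face k_lt). Qed.

Lemma fan_eq : groebner_fan R I = normal_fan P.
Proof.
by apply/seteqP; split=> C [w _ <-]; exists w; rewrite // ?closure_cell normal_cone_face.
Qed.

Lemma braid_cell_sub w : braid_cell w `<=` groebner_cell I w.
Proof.
move=> w' sg; apply/cellE => i j.
have le_sg a b : (w 0 a <= w 0 b) = (w' 0 a <= w' 0 b).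
  by rewrite -subr_le0 -sgr_le0 -sg sgr_le0 subr_le0.
by rewrite /detected le_sg; congr [&& _, _ & _ < _]%N; apply: eq_card => l; rewrite !inE le_sg.
Qed.

Lemma braid_refines : refines (braid_fan R n) (groebner_fan R I).
Proof.
split=> [|C [w _ <-]]; last first.
  exists (closure (groebner_cell I w)); first by exists w.
  exact/closureS/braid_cell_sub.
apply/seteqP; split=> w _.
  by exists (closure (groebner_cell I w)); [exists w|exact: subset_closure].
by exists (closure (braid_cell w)); [exists w|exact: subset_closure].
Qed.

End State.

(** * The smallest difference of consecutive parts *)

Section MinGap.
Local Open Scope nat_scope.

Lemma big_minn (r : seq nat) (F : nat -> nat) x :
  let b := \big[minn/x]_(i <- r) F i in
  (forall i, i \in r -> b <= F i) /\ (b = x \/ exists2 i, i \in r & b = F i).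
Proof.
elim: r => [|i r [IH1 IH2]] /=; first by rewrite big_nil; split=> //; left.
rewrite big_cons; set b := \big[minn/x]_(j <- r) F j in IH1 IH2 *; split.
  move=> j; rewrite inE => /predU1P[->|/IH1 h]; first exact: geq_minl.
  by apply: leq_trans (geq_minr _ _) h.
case: (leqP (F i) b) => _; first by right; exists i; rewrite ?mem_head.
case: IH2 => [->|[j jr ->]]; [by left|right; exists j => //].
by rewrite inE jr orbT.
Qed.

Variable la : seq nat.
Hypothesis la_dec : forall a b, a <= b -> nth 0 la b <= nth 0 la a.

Lemma min_gap_le t : 0 < t -> t < size la -> nth 0 la t + min_gap la <= nth 0 la t.-1.
Proof.
move=> t_gt0 tla; have [h _] := big_minn (index_iota 1 (size la))
  (fun i => nth 0 la i.-1 - nth 0 la i) (head 0 la).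
by rewrite -leq_subRL ?la_dec ?leq_pred // h // mem_index_iota t_gt0.
Qed.

(** The seed of the minimum can only be its value if [la_1 = 0], and then it is
    the first difference. *)
Lemma min_gap_attained : 1 < size la ->
  exists2 t, 0 < t < size la & nth 0 la t + min_gap la = nth 0 la t.-1.
Proof.
move=> la_size; have [_] := big_minn (index_iota 1 (size la))
  (fun i => nth 0 la i.-1 - nth 0 la i) (head 0 la).
rewrite -/(min_gap la) => -[E|[t]]; last first.
  by rewrite mem_index_iota => ht ->; exists t; rewrite ?subnKC ?la_dec ?leq_pred.
exists 1; rewrite ?la_size //; apply/eqP.
by rewrite eqn_leq min_gap_le //= E nth0 leq_addl.
Qed.

End MinGap.

Theorem theorem3p5 (R : realType) (K : fieldType) (n : nat) (la : seq nat)
    (n_gt0 : (0 < n)%N)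
    (la_part : is_partition n la)
    (m_ge2 : (2 <= size la)%N)
    (la_last_gt0 : (0 < last 0%N la)%N) :
  let k := min_gap la in
  let I := specht_ideal K n la in
  [/\ state_polytope I (Pi_polytope R n k),
      groebner_fan R I = normal_fan (Pi_polytope R n k)
    & refines (braid_fan R n) (groebner_fan R I)].
Proof.
move=> k I; have la_dec a b : (a <= b)%N -> (nth 0 la b <= nth 0 la a)%N.
  exact: (part_noninc la_part).
have la_pos r : (r < size la)%N -> (0 < nth 0 la r)%N.
  move=> rla; apply: leq_trans la_last_gt0 _; rewrite -nth_last; apply: la_dec.
  by rewrite -ltnS prednK // (leq_trans _ rla).
have gap := min_gap_le la_dec.
have attained := min_gap_attained la_dec m_ge2.
have k_lt : (k < n)%N.
  have := part_sum_le la_part 1.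
  have := gap 1%N isT m_ge2; have := la_pos 1%N m_ge2.
  rewrite /part_sum big_ord1 -/k => la1 h; apply: leq_trans; apply: leq_trans h.
  by rewrite addnC -addn1 leq_add2l.
have fans := fan_eq R K la_part la_pos m_ge2 gap attained k_lt.
split=> //; last exact: (braid_refines R K la_part la_pos m_ge2 gap attained).
by split=> //; exact: Pi_convex_polytope.
Qed.
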